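(* Let $\mathcal{H}$ be a complex Hilbert space and identify $\mathrm{T}^*\mathbb{P}\mathcal{H}$ with the complex submanifold $X=\{q\in\mathcal{B}(\mathcal{H}): q^2=q,\ \mathrm{Tr}(q)=1\}$ of $\mathcal{B}(\mathcal{H})\setminus\{0\}$ consisting of all (not necessarily Hermitian) rank-$1$ projections, with $\mathrm{T}_qX=\{A\in\mathcal{B}(\mathcal{H}): qA+Aq=A\}$. Let $\|q\|=\sqrt{\mathrm{Tr}(q^*q)}$ be the Hilbert–Schmidt norm. Then $X$ has a hyperkähler structure given as follows. (1) The function $X\to\mathbb{R}$, $q\mapsto\|q\|$, is a Kähler potential, with respect to the complex structure $I A:=iA$, for the Riemannian metric on $X$ given by the real part of $$\mathbf{h}(A,B)=\frac{1}{\|q\|}\mathrm{Tr}(A^*B)-\frac{1}{2\|q\|^3}\mathrm{Tr}(A^*q)\,\mathrm{Tr}(Bq^* ),\qquad A,B\in \mathrm{T}_qX .$$ (2) The form $\Omega(A,B)=i\,\mathrm{Tr}(q[A,B])$, $A,B\in\mathrm{T}_qX$, is an $I$-holomorphic symplectic form on $X$, and the equation $$\mathbf{h}(\mathbf{J}A,B)=\Omega(A,B)\qquad (A,B\in \mathrm{T}_qX)$$ defines an integrable almost complex structure $\mathbf{J}$ on $X$ that anticommutes with $I$. Explicitly, $$\mathbf{J}A=\frac{i}{\|q\|}[q,A^*]-\frac{i}{2\|q\|^3}\mathrm{Tr}(A^*q)\,[q,q^*].$$ The triple $(\mathrm{Re}\,\mathbf{h},I,\mathbf{J})$ is the hyperkähler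 structure. (3) Furthermore, there is a third integrable almost complex structure $J$ on $X$ that commutes with $I$, given by $JA=i[A,q]$ for $A\in \mathrm{T}_qX$, and it satisfies $\Omega(JA,JB)=\Omega(A,B)$.
   Context: $\mathcal{B}(\mathcal{H})$ denotes the bounded linear operators on $\mathcal{H}$; $[A,B]=AB-BA$; $^*$ is the adjoint. All traces are of finite-rank operators. The cotangent bundle $\mathrm{T}^*\mathbb{P}\mathcal{H}$ of projective space is identified with the set $X$ of rank-$1$ idempotents as follows: an idempotent $q$ with image the line $V$ corresponds to the covector at $V$ given by $q|_{V^\perp}\in\mathrm{Hom}(V^\perp,V)$, acting on $\mathrm{T}_V\mathbb{P}\mathcal{H}\cong \mathrm{Hom}(V,V^\perp)$ by $g\mapsto \mathrm{Re}\,\mathrm{Tr}(q|_{V^\perp}\,g)$. Inner products are linear in the second argument. ''$\tau$ is a Kähler potential for the Riemannian metric $g$'' means that $\omega=i\partial\bar\partial\tau$ is the Kähler form of $g$, i.e. $g(A,B)=\omega(A,IB)$. A hyperkähler structure is a triple $(g,I,\mathbf{J})$ with $g$ a Riemannian metric and $I,\mathbf{J}$ anticommuting almost complex structures such that $g(I\cdot,\cdot)$, $g(\mathbf{J}\cdot,\cdot)$ and $g(I\mathbf{J}\cdot,\cdot)$ are closed $2$-forms. *)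

(* Defs.v *)
From HB Require Import structures.
From mathcomp Require Import all_boot all_order all_algebra.
From mathcomp Require Import all_classical all_reals all_analysis.
From mathcomp Require Import complex.

Set Implicit Arguments.
Unset Strict Implicit.
Unset Printing Implicit Defensive.

Import Order.TTheory GRing.Theory Num.Theory numFieldNormedType.Exports.

Local Open Scope classical_set_scope.
Local Open Scope complex_scope.
Local Open Scope ring_scope.

Lemma Re_norm_real (R : realType) (E : normedModType R[i]) (x : E) :
  (complex.Re `|x|)%:C = `|x|.
Proof. by rewrite -[in RHS](RRe_real (normr_real x)). Qed.

Lemma Re_norm_ge0 (R : realType) (E : normedModType R[i]) (x : E) :
  0 <= complex.Re `|x|.
Proof. by rewrite -lecR Re_norm_real; exact: normr_ge0. Qed.

Lemma Re_normD (R : realType) (E : normedModType R[i]) (x y : E) :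
  complex.Re `|x + y| <= complex.Re `|x| + complex.Re `|y|.
Proof. by rewrite -lecR rmorphD /= !Re_norm_real ler_normD. Qed.

Lemma Re_normZ (R : realType) (E : normedModType R[i]) (a : R[i]) (x : E) :
  complex.Re `|a *: x| = complex.Re `|a| * complex.Re `|x|.
Proof.
apply: (@complexI R); rewrite rmorphM /= !Re_norm_real [LHS]normrZ.
by rewrite (RRe_real (normr_real a)).
Qed.

Lemma Re_norm0_eq0 (R : realType) (E : normedModType R[i]) (x : E) :
  complex.Re `|x| = 0 -> x = 0.
Proof.
move=> x0; have := Re_norm_real x.
by rewrite x0 => /esym/eqP; rewrite normr_eq0 => /eqP.
Qed.

(* Restriction of scalars: [E] seen as a real normed space, with the topology
   given by the same norm.  The differential calculus below is real; complex
   linearity of differentials is imposed separately. *)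
Definition realified (R : realType) (E : normedModType R[i]) : Type := E.

Section Realified.
Variables (R : realType) (E : normedModType R[i]).

HB.instance Definition _ := GRing.Zmodule.copy (realified E) E.

Let rscale (a : R) (x : realified E) : realified E := a%:C *: (x : E).

Let rscaleA a b x : rscale a (rscale b x) = rscale (a * b) x.
Proof. by rewrite /rscale scalerA rmorphM. Qed.

Let rscale1 : left_id 1 rscale.
Proof. by move=> x; rewrite /rscale rmorph1 scale1r. Qed.

Let rscaleDr : right_distributive rscale +%R.
Proof. by move=> a x y; rewrite /rscale scalerDr. Qed.

Let rscaleDl x : {morph rscale^~ x : a b / a + b}.
Proof. by move=> a b; rewrite /rscale rmorphD scalerDl. Qed.

HB.instance Definition _ :=
  GRing.Zmodule_isLmodule.Build R (realified E) rscaleA rscale1 rscaleDr rscaleDl.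

Let rnorm (x : realified E) : R := complex.Re `|x : E|.

Let rnormD x y : rnorm (x + y) <= rnorm x + rnorm y.
Proof. exact: Re_normD. Qed.

Let rnormZ (a : R) x : rnorm (a *: x) = `|a| * rnorm x.
Proof. by rewrite /rnorm Re_normZ normc_def /= expr0n /= addr0 sqrtr_sqr. Qed.

Let rnorm0_eq0 x : rnorm x = 0 -> x = 0.
Proof. exact: Re_norm0_eq0. Qed.

HB.instance Definition _ :=
  Lmodule_isNormed.Build R (realified E) rnormD rnormZ rnorm0_eq0.

End Realified.

(* The inner product is linear in its second argument. *)
HB.mixin Record isHilbert (R : realType) H & CompleteNormedModule R[i] H := {
  inner : H -> H -> R[i] ;
  innerC : forall x y, inner x y = (inner y x)^* ;
  innerDr : forall x y z, inner x (y + z) = inner x y + inner x z ;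
  innerZr : forall (a : R[i]) x y, inner x (a *: y) = a * inner x y ;
  norm_inner : forall x, `|x| ^+ 2 = inner x x
}.

#[short(type="hilbertType")]
HB.structure Definition Hilbert (R : realType) :=
  {H of CompleteNormedModule R[i] H & isHilbert R H}.

Section BoundedOperators.
Variables (R : realType) (H : hilbertType R).

Definition bounded_linear_pred : {pred H -> H} :=
  fun f => `[< linear f /\ exists M : R, forall x, `|f x| <= M%:C * `|x| >].

Record bounded_op := BoundedOp {
  bounded_op_fun :> H -> H ;
  bounded_op_subproof : bounded_op_fun \in bounded_linear_pred }.

HB.instance Definition _ := [isSub for bounded_op_fun].
HB.instance Definition _ := [Choice of bounded_op by <:].

Fact bounded_linear_submod : submod_closed bounded_linear_pred.
Proof.
split=> [|a f g /asboolP[fl [M fM]] /asboolP[gl [N gN]]]; apply/asboolP; split.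
- by move=> a x y; rewrite scaler0 addr0.
- by exists 0 => x; rewrite normr0 mul0r.
- move=> b x y; have E z : (a *: f + g) z = a *: f z + g z by [].
  by rewrite !E fl gl !scalerDr !scalerA [a * b]mulrC addrACA.
- exists (complex.Re `|a| * M + N) => x; rewrite (le_trans (ler_normD _ _)) //.
  rewrite rmorphD rmorphM mulrDl lerD //.
  by rewrite [leLHS]normrZ -[`|a|](RRe_real (normr_real a)) -mulrA ler_wpM2l // lecR Re_norm_ge0.
Qed.

HB.instance Definition _ :=
  GRing.isSubmodClosed.Build R[i] (H -> H) bounded_linear_pred
    bounded_linear_submod.
HB.instance Definition _ := [SubChoice_isSubLmodule of bounded_op by <:].

Implicit Types A B C : bounded_op.

Lemma bounded_op_linear A : linear A.
Proof. by case: A => f /= /asboolP[]. Qed.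

HB.instance Definition _ A :=
  GRing.isLinear.Build R[i] H H *:%R A (bounded_op_linear A).

Lemma bounded_op_bounded A : exists M : R, forall x, `|A x| <= M%:C * `|x|.
Proof. by case: A => f /= /asboolP[]. Qed.

Lemma bounded_opP A B : A =1 B -> A = B.
Proof. by move=> AB; apply/val_inj/funext. Qed.

Fact bounded_op_id_subproof : idfun \in bounded_linear_pred.
Proof. by apply/asboolP; split=> //; exists 1 => x; rewrite mul1r. Qed.

Definition bounded_op_id := BoundedOp bounded_op_id_subproof.

Fact bounded_op_comp_subproof A B : A \o B \in bounded_linear_pred.
Proof.
apply/asboolP; split=> [a x y|]; first by rewrite /= !linearP.
have [[M AM] [N BN]] := (bounded_op_bounded A, bounded_op_bounded B).
exists (`|M| * N) => x; rewrite (le_trans (AM _)) // rmorphM /= -mulrA.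
rewrite (@le_trans _ _ (`|M|%:C * `|B x|)) ?ler_wpM2l ?lecR //.
by rewrite ler_wpM2r // lecR ler_norm.
Qed.

Definition bounded_op_comp A B := BoundedOp (bounded_op_comp_subproof A B).

Let compA : associative bounded_op_comp.
Proof. by move=> A B C; exact: bounded_opP. Qed.

Let comp1l : left_id bounded_op_id bounded_op_comp.
Proof. by move=> A; exact: bounded_opP. Qed.

Let compr1 : right_id bounded_op_id bounded_op_comp.
Proof. by move=> A; exact: bounded_opP. Qed.

Let compDl : left_distributive bounded_op_comp +%R.
Proof. by move=> A B C; exact: bounded_opP. Qed.

Let compDr : right_distributive bounded_op_comp +%R.
Proof. by move=> A B C; apply: bounded_opP => x /=; rewrite linearD. Qed.

(* Not an nzRing: H may be the zero space. *)
HB.instance Definition _ := GRing.Zmodule_isPzRing.Build bounded_op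
  compA comp1l compr1 compDl compDr.

Let ball_values A : set R := [set complex.Re `|A x| | x in [set x | `|x| <= 1]].

Definition opnorm A : R := sup (ball_values A).

Let ball_values_sup A : has_sup (ball_values A).
Proof.
split; first by exists (complex.Re `|A 0|), 0; rewrite //= normr0.
have [M AM] := bounded_op_bounded A; exists `|M| => _ [x /= x1 <-].
rewrite -lecR Re_norm_real (le_trans (AM x)) //.
rewrite (@le_trans _ _ (`|M|%:C * `|x|)) ?ler_wpM2r ?lecR ?ler_norm //.
by rewrite ler_piMr // lecR.
Qed.

Let opnorm_ub A x : `|x| <= 1 -> complex.Re `|A x| <= opnorm A.
Proof.
move=> x1; apply: sup_upper_bound; first exact: ball_values_sup.
by exists x.
Qed.

Let opnorm_le A M : (forall x, `|x| <= 1 -> complex.Re `|A x| <= M) ->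
  opnorm A <= M.
Proof.
move=> AM; apply: ge_sup; first by have [] := ball_values_sup A.
by move=> _ [x /= /AM ? <-].
Qed.

Let opnormD A B : (opnorm (A + B))%:C <= (opnorm A)%:C + (opnorm B)%:C.
Proof.
rewrite -rmorphD /= lecR; apply: opnorm_le => x x1.
exact: le_trans (Re_normD _ _) (lerD (opnorm_ub _ x1) (opnorm_ub _ x1)).
Qed.

Let opnormZ_le (a : R[i]) A : opnorm (a *: A) <= complex.Re `|a| * opnorm A.
Proof.
apply: opnorm_le => x x1; rewrite [complex.Re _]Re_normZ.
by rewrite ler_wpM2l ?opnorm_ub // -lecR (RRe_real (normr_real a)) normr_ge0.
Qed.

Let opnorm_ge0 A : 0 <= opnorm A.
Proof.
have n0 : `|0 : H| <= 1 by rewrite normr0.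
exact: le_trans (Re_norm_ge0 (A 0)) (opnorm_ub A n0).
Qed.

Let opnormZ (a : R[i]) A : (opnorm (a *: A))%:C = `|a| * (opnorm A)%:C.
Proof.
have aE : `|a| = (complex.Re `|a|)%:C by rewrite (RRe_real (normr_real a)).
rewrite aE -rmorphM; congr (_%:C); apply/eqP; rewrite eq_le opnormZ_le andTb.
have [->|a0] := eqVneq a 0; first by rewrite normr0 mul0r opnorm_ge0.
have ra0 : 0 < complex.Re `|a| by rewrite -ltcR -aE normr_gt0.
rewrite -ler_pdivlMl //; have := opnormZ_le a^-1 (a *: A).
rewrite scalerA mulVf // scale1r normfV => /le_trans; apply.
by rewrite {1}aE -fmorphV /=.
Qed.

Let opnorm0_eq0 A : (opnorm A)%:C = 0 -> A = 0.
Proof.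
move=> /complexI A0; apply: bounded_opP => x; apply: Re_norm0_eq0.
have [->|x0] := eqVneq x 0; first by rewrite linear0 normr0.
have xE : x = `|x| *: (`|x|^-1 *: x).
  by rewrite scalerA divff ?normr_eq0 // scale1r.
have y1 : `|(`|x|^-1 *: x)| <= 1.
  by rewrite normrZ normfV normr_id mulVf ?normr_eq0.
have Ay : complex.Re `|A (`|x|^-1 *: x)| = 0.
  by apply/eqP; rewrite eq_le Re_norm_ge0 andbT -A0 opnorm_ub.
by rewrite [in A x]xE linearZ /= Re_normZ Ay mulr0.
Qed.

HB.instance Definition _ := Lmodule_isNormed.Build R[i] bounded_op
  opnormD opnormZ opnorm0_eq0.

End BoundedOperators.

Section Operators.
Variables (R : realType) (H : hilbertType R).
Implicit Types (q A B : bounded_op H).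

(* Unique by definiteness, exists by Riesz representation. *)
Definition adj A : bounded_op H :=
  xget 0 [set B : bounded_op H | forall x y, inner (B x) y = inner x (A y)].

Definition finite_rank A : Prop :=
  exists (n : nat) (e : 'I_n -> H),
    forall x, exists c : 'I_n -> R[i], A x = \sum_(i < n) c i *: e i.

(* [e] is an orthonormal basis of a finite-dimensional subspace containing the
   range of [A]; the value does not depend on [e], and exists exactly when [A]
   has finite rank. *)
Definition is_trace A (t : R[i]) : Prop :=
  exists (n : nat) (e : 'I_n -> H),
    [/\ forall i j, inner (e i) (e j) = (i == j)%:R,
        forall x, A x = \sum_(i < n) inner (e i) (A x) *: e i
      & t = \sum_(i < n) inner (e i) (A (e i))].

Definition tr A : R[i] := xget 0 [set t | is_trace A t].

Definition comm A B : bounded_op H := A * B - B * A.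

Definition hsnorm A : R := Num.sqrt (complex.Re (tr (adj A * A))).

Definition is_line (V : set H) : Prop :=
  exists2 v : H, v != 0 & V = range (fun a : R[i] => a *: v).

Definition projections : set (realified (bounded_op H)) :=
  [set q : bounded_op H | [/\ q * q = q, finite_rank q & tr q = 1]].

Definition tangent q : set (realified (bounded_op H)) :=
  [set A : bounded_op H | q * A + A * q = A].

(* Points of the cotangent bundle of projective space: a line [V] and an
   element of Hom(V^perp, V), represented by its extension by zero on [V]. *)
Definition cotangentP : set (set H * bounded_op H) :=
  [set Vc : set H * bounded_op H |
    [/\ is_line Vc.1, forall x, Vc.1 (Vc.2 x)
      & forall x, Vc.1 x -> Vc.2 x = 0]].

Definition represents q (Vc : set H * bounded_op H) : Prop :=
  range q = Vc.1 /\
  forall x, (forall y, Vc.1 y -> inner y x = 0) -> q x = Vc.2 x.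

Definition hform q A B : R[i] :=
  ((hsnorm q)%:C)^-1 * tr (adj A * B)
  - (2 * (hsnorm q)%:C ^+ 3)^-1 * (tr (adj A * q) * tr (B * adj q)).

Definition gform q A B : R^o := complex.Re (hform q A B).

Definition Omega q A B : R[i] := 'i%C * tr (q * comm A B).

Definition Jbold q A : bounded_op H :=
  ('i%C / (hsnorm q)%:C) *: comm q (adj A)
  - ('i%C / (2 * (hsnorm q)%:C ^+ 3) * tr (adj A * q)) *: comm q (adj q).

Definition Jthird q A : bounded_op H := 'i%C *: comm A q.

End Operators.

Section Smooth.
Variable R : realType.

(* A map on an open set is of class C^(k+1) when it is Frechet differentiable
   and its differential is of class C^k as a map of the point and the vector
   jointly; for all k at once this is the usual notion of smoothness between
   Banach spaces. *)
Fixpoint Ck (k : nat) : forall E F : normedModType R, set E -> (E -> F) -> Prop :=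
  match k with
  | 0 => fun E F U f => forall x, U x -> {for x, continuous f}
  | k'.+1 => fun E F U f =>
      (forall x, U x -> differentiable f x) /\
      Ck k' (U `*` [set: E]) (fun p : E * E => 'd f (p.1) p.2)
  end.

Definition smooth (E F : normedModType R) (U : set E) (f : E -> F) : Prop :=
  forall k, Ck k U f.

(* Exterior derivative of a 2-form on constant vector fields. *)
Definition dext (E F : normedModType R) (beta : E -> E -> E -> F) (x A B C : E) : F :=
  'D_A (fun y => beta y B C) x - 'D_B (fun y => beta y A C) x
  + 'D_C (fun y => beta y A B) x.

End Smooth.

Section Dolbeault.
Variables (R : realType) (E : normedModType R[i]).

Definition mulI (v : realified E) : realified E := 'i%C *: (v : E).

(* Wirtinger derivatives along a constant vector field. *)
Definition del (A : realified E) (f : realified E -> realified R[i]^o)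
    (x : realified E) : realified R[i]^o :=
  2^-1 * (('D_A f x : R[i]) - 'i%C * ('D_(mulI A) f x : R[i])).

Definition delbar (A : realified E) (f : realified E -> realified R[i]^o)
    (x : realified E) : realified R[i]^o :=
  2^-1 * (('D_A f x : R[i]) + 'i%C * ('D_(mulI A) f x : R[i])).

(* In linear coordinates, i times the sum of
   (d^2 tau / dz_j dzbar_k) dz_j /\ dzbar_k, evaluated on (A, B). *)
Definition i_ddbar (tau : realified E -> R) (x A B : realified E) : R[i] :=
  let f : realified E -> realified R[i]^o := fun y => (tau y)%:C in
  'i%C * ((del A (delbar B f) x : R[i]) - (del B (delbar A f) x : R[i])).

End Dolbeault.

(* Differential geometry on a submanifold [M] of a complex Banach space [F],
   with tangent spaces [T p], p in [M].  Tensors on [M] are given by their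
   values on vectors of [F]; only tangent vectors matter. *)
Section Submanifold.
Variables (R : realType) (F : normedModType R[i]).
Local Notation rF := (realified F).
Variables (M : set rF) (T : rF -> set rF).

(* Smooth local parametrizations of [M]; complex model spaces are no
   restriction, since the tangent spaces considered are complex subspaces.  The smooth left inverse on an open
   subset of [F] makes [M] a split embedded submanifold. *)
Record chart (E : completeNormedModType R[i]) (V : set (realified E))
    (phi : realified E -> rF) : Prop := Chart {
  chart_open : open V ;
  chart_smooth : smooth V phi ;
  chart_inverse : exists (U : set rF) (psi : rF -> realified E),
    [/\ open U, smooth U psi, phi @` V = M `&` U
      & forall x, V x -> psi (phi x) = x] ;
  chart_tangent : forall x, V x -> range ('d phi x) = T (phi x)
}.

Definition complex_chart (J : rF -> rF -> rF) (E : completeNormedModType R[i])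
    (V : set (realified E)) (phi : realified E -> rF) : Prop :=
  chart V phi /\
  forall x v, V x -> 'd phi x (mulI v) = J (phi x) ('d phi x v).

Definition has_complex_atlas (J : rF -> rF -> rF) : Prop :=
  forall p, M p -> exists (E : completeNormedModType R[i])
    (V : set (realified E)) (phi : realified E -> rF),
    complex_chart J V phi /\ (phi @` V) p.

Definition ambientI (p A : rF) : rF := mulI A.

Definition holomorphic_chart (E : completeNormedModType R[i])
    (V : set (realified E)) (phi : realified E -> rF) : Prop :=
  complex_chart ambientI V phi.

Definition complex_submanifold : Prop := has_complex_atlas ambientI.

Definition almost_complex (J : rF -> rF -> rF) : Prop :=
  [/\ forall p A, M p -> T p A -> T p (J p A),
      forall p (a : R) A B, M p -> T p A -> T p B ->
        J p (a *: A + B) = a *: J p A + J p B,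
      forall p A, M p -> T p A -> J p (J p A) = - A
    & forall (E : completeNormedModType R[i]) V (phi : realified E -> rF),
        chart V phi ->
        smooth (V `*` setT)
          (fun z : realified E * realified E => J (phi z.1) ('d phi (z.1) z.2))].

(* Integrable: induced by a complex manifold structure. *)
Definition integrable_complex (J : rF -> rF -> rF) : Prop :=
  almost_complex J /\ has_complex_atlas J.

Definition tensors_anticommute (J K : rF -> rF -> rF) : Prop :=
  forall p A, M p -> T p A -> J p (K p A) = - K p (J p A).

Definition tensors_commute (J K : rF -> rF -> rF) : Prop :=
  forall p A, M p -> T p A -> J p (K p A) = K p (J p A).

Definition pullback (G : normedModType R) (E : normedModType R[i])
    (phi : realified E -> rF) (b : rF -> rF -> rF -> G) :=
  fun x A B : realified E => b (phi x) ('d phi x A) ('d phi x B).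

Definition bilinear_tensor (G : normedModType R) (b : rF -> rF -> rF -> G) :=
  forall p (a : R) A B C, M p -> T p A -> T p B -> T p C ->
    b p (a *: A + B) C = a *: b p A C + b p B C /\
    b p C (a *: A + B) = a *: b p C A + b p C B.

Definition smooth_tensor (G : normedModType R) (b : rF -> rF -> rF -> G) :=
  forall (E : completeNormedModType R[i]) V (phi : realified E -> rF),
    chart V phi ->
    smooth (V `*` setT `*` setT)
      (fun z : realified E * realified E * realified E =>
         pullback phi b z.1.1 z.1.2 z.2).

Definition closed_2form (G : normedModType R) (b : rF -> rF -> rF -> G) : Prop :=
  [/\ bilinear_tensor b, smooth_tensor b,
      forall p A, M p -> T p A -> b p A A = 0
    & forall (E : completeNormedModType R[i]) V (phi : realified E -> rF),
        chart V phi ->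
        forall x A B C, V x -> dext (pullback phi b) x A B C = 0].

(* In infinite dimension: each inner product induces the given topology of the
   tangent space. *)
Definition riemannian (g : rF -> rF -> rF -> R^o) : Prop :=
  [/\ bilinear_tensor g, smooth_tensor g,
      forall p A B, M p -> T p A -> T p B -> g p A B = g p B A
    & forall p, M p -> exists2 c : R,
        0 < c & forall A, T p A -> c * `|A| ^+ 2 <= g p A A].

Definition hyperkahler (g : rF -> rF -> rF -> R^o) (I J : rF -> rF -> rF) : Prop :=
  [/\ riemannian g, almost_complex I /\ almost_complex J, tensors_anticommute I J
    & [/\ closed_2form (fun p A B => g p (I p A) B),
          closed_2form (fun p A B => g p (J p A) B)
        & closed_2form (fun p A B => g p (I p (J p A)) B)]].

(* The identity g(A, B) = omega(A, I B) for omega = i d dbar tau, read in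
   holomorphic charts. *)
Definition kahler_potential (tau : rF -> R^o) (g : rF -> rF -> rF -> R^o) : Prop :=
  forall (E : completeNormedModType R[i]) V (phi : realified E -> rF),
    holomorphic_chart V phi ->
    smooth V (tau \o phi) /\
    forall x A B, V x ->
      (pullback phi g x A B)%:C = i_ddbar (tau \o phi) x A (mulI B).

(* Complex bilinear with holomorphic coefficients in holomorphic charts, closed,
   and nondegenerate in the sense that it identifies each tangent space with
   its complex continuous dual. *)
Definition holomorphic_symplectic (b : rF -> rF -> rF -> realified R[i]^o) : Prop :=
  [/\ closed_2form b,
      forall p A B, M p -> T p A -> T p B ->
        b p (mulI A) B = mulI (b p A B) /\ b p A (mulI B) = mulI (b p A B),
      forall (E : completeNormedModType R[i]) V (phi : realified E -> rF),
        holomorphic_chart V phi ->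
        forall x A B v, V x ->
          'D_(mulI v) (fun y => pullback phi b y A B) x
          = mulI ('D_v (fun y => pullback phi b y A B) x)
    & forall p (l : F -> R[i]), M p ->
        (forall (a : R[i]) (A B : F), T p A -> T p B ->
           l (a *: A + B) = a * l A + l B) ->
        (exists c : R, forall A : F, T p A -> `|l A| <= c%:C * `|A|) ->
        exists! A, T p A /\ forall B, T p B -> b p A B = l B].

End Submanifold.

(* Main.v *)
From HB Require Import structures.
Require Import Defs.
From mathcomp Require Import all_boot all_order all_algebra.
From mathcomp Require Import all_classical all_reals all_analysis.
From mathcomp Require Import complex ring lra.
Import Order.TTheory GRing.Theory Num.Theory numFieldNormedType.Exports.
Local Open Scope classical_set_scope.
Local Open Scope complex_scope.
Local Open Scope ring_scope.

(* A rank-one projection is q = u <w, .> with <w, u> = 1; the lift (u, w) can be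
   normalised by |u|^2 = |w|^2, both being then equal to ||q||, is unique up to a
   phase, and can be chosen smoothly near every point.  A tangent vector is
   A = b <w, .> + u <a, .>, where (b, a) is the differential of a lift.

   In these terms Omega(A, B) = i (<a, d> - <c, b>) and
   Im h(A, B) = Im (<b, d> - <a, c>) for B = d <w, .> + u <c, .>.  These forms have
   constant coefficients in (u, w), so that they are closed because second
   derivatives are symmetric.  The derivative of ||q|| = |u|^2 along i v is
   Im (<w, D_v w> - <u, D_v u>), whose exterior derivative is again a
   constant-coefficient form, the Kaehler form of Re h.

   Integrability is proved by explicit complex charts.  For I and for J, send q to
   the range of q and the range of its adjoint, each line being met with the
   affine hyperplane e + e^perp; I and J only differ by a conjugation of the
   second coordinate.  Up to the vertical direction, bold J sends (b, a) to
   (-i a, -i b), hence acts by -i on s = u + w and by i on t = u - w; after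
   rescaling, s and t are orthogonal and |s|^2 - |t|^2 = 1.  The line of s, met with
   e + e^perp, and the vector <s, e> t, which do not depend on the phase of the
   lift, are complex coordinates once the scalars on the first one are conjugated. *)

Set Implicit Arguments.
Unset Strict Implicit.
Unset Printing Implicit Defensive.

(** * Smooth maps between normed spaces *)

(** Traces make sense on finite-rank operators only, whereas charts take values in all bounded
    operators with the operator norm, for which neither the trace nor the Hilbert-Schmidt norm is
    continuous in general. The tensors are therefore rewritten through a lift, as expressions in
    inner products of vectors of [H]. The lift itself is built from [q e] and [adj q e] for a fixed
    vector [e], which are real linear and bounded in [q].

    The normalisation has a second effect. Differentiated, it reads Re <u, b> = Re <w, a>, and this
    is exactly what cancels the rational terms of Im h and leaves constant coefficients.

    In infinite dimension the vanishing of a Nijenhuis tensor does not produce complex charts, so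
    integrability calls for explicit ones. The differentials of their scale factors are never
    computed: they only contribute a multiple of [q] for the charts by pairs of lines, and of u <u,
    .> + w <w, .> for bold J. Neither operator is tangent, so that tangency alone fixes their
    coefficients. *)

Section DiffExtras.
Variables (R : realType).

Lemma near_eq_differentiable (E F : normedModType R) (f g : E -> F) x :
  (\near x, f x = g x) -> differentiable f x ->
  differentiable g x /\ 'd g x = 'd f x :> (E -> F).
Proof.
move=> fg df; have [dfc dfl] := iffLR (diff_locallyP _ _) df.
have gl : g \o shift x = cst (g x) + 'd f x +o_ 0 id.
  apply/eqaddoP => e e0; have /eqaddoP/(_ e e0) := dfl.
  have fg0 : \forall h \near (0 : E), f (h + x) = g (h + x).
    by move: fg; rewrite (near_shift 0) subr0.
  by apply: filter_app; near=> h; rewrite !fctE /= (near fg0) // (nbhs_singleton fg).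
have gE : 'd g x = 'd f x :> (E -> F) by exact: diff_unique.
split; last exact: gE.
by apply/diff_locallyP; split; [rewrite gE; exact: dfc|rewrite gE; exact: gl].
Unshelve. all: by end_near. Qed.

Lemma open_setXT (E F : normedModType R) (U : set E) :
  open U -> open (U `*` [set: F]).
Proof.
move=> Uo; rewrite setXT; apply: open_comp => // p _; exact: cvg_fst.
Qed.

Lemma open_near (E : normedModType R) (U : set E) (P : E -> Prop) x :
  open U -> U x -> (forall y, U y -> P y) -> \near x, P x.
Proof. by move=> Uo Ux UP; apply: filterS UP _; exact: open_nbhs_nbhs. Qed.

Lemma bound_continuous_linear (E F : normedModType R) (f : {linear E -> F}) (M : R) :
  (forall x, `|f x| <= M * `|x|) -> continuous f.
Proof.
move=> fM; apply: bounded_linear_continuous; apply/linear_boundedP.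
exists `|M|; split; first exact: normr_real.
move=> r Mr x; rewrite (le_trans (fM x)) // ler_wpM2r //.
exact: le_trans (ler_norm _) (ltW Mr).
Qed.

Lemma bound_continuous_bilinear (E F G : normedModType R)
    (f : {bilinear E -> F -> G}) (M : R) :
  (forall x y, `|f x y| <= M * `|x| * `|y|) -> continuous (fun p => f p.1 p.2).
Proof.
move=> fM p; apply/cvgrPdist_le => e e0.
(* [M] may be zero or negative, while the radius [e / (2 * S)] below needs a positive constant. *)
pose K := `|M| + 1; have K0 : 0 < K by rewrite ltr_pwDr.
have fK x y : `|f x y| <= K * `|x| * `|y|.
  rewrite (le_trans (fM x y)) // ler_wpM2r // ler_wpM2r //.
  by rewrite (le_trans (ler_norm M)) // lerDl.
pose S := K * (`|p.1| + `|p.2| + 1); have S0 : 0 < S.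
  by rewrite mulr_gt0 // ltr_pwDr // addr_ge0.
have SE : S * (e / (2 * S)) = e / 2 by field; rewrite gt_eqF.
have c1 : {for p, continuous (@fst E F)} by exact: cvg_fst.
have c2 : {for p, continuous (@snd E F)} by exact: cvg_snd.
have /cvgrPdist_le N1 := c1; have /cvgrPdist_le N2 := c2.
near=> q.
have d1 : `|p.1 - q.1| <= Num.min 1 (e / (2 * S)).
  near: q; apply: N1.
  by rewrite lt_min ltr01 divr_gt0 // mulr_gt0.
have d2 : `|p.2 - q.2| <= Num.min 1 (e / (2 * S)).
  near: q; apply: N2.
  by rewrite lt_min ltr01 divr_gt0 // mulr_gt0.
move: d1 d2; rewrite !le_min => /andP[d1 d1'] /andP[d2 d2'].
have -> : f p.1 p.2 - f q.1 q.2 = f (p.1 - q.1) p.2 + f q.1 (p.2 - q.2).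
  by rewrite linearBl linearBr addrA subrK.
have q1 : `|q.1| <= `|p.1| + 1.
  by rewrite -[q.1](subKr p.1) (le_trans (ler_normB _ _)) // lerD2l.
rewrite (le_trans (ler_normD _ _)) // [e]splitr lerD //.
  rewrite (le_trans (fK _ _)) // (@le_trans _ _ (S * (e / (2 * S)))) //.
    rewrite mulrAC ler_pM ?mulr_ge0 ?(ltW K0) // /S ler_wpM2l ?(ltW K0) //.
    have := normr_ge0 p.1; lra.
  by rewrite SE.
rewrite (le_trans (fK _ _)) // (@le_trans _ _ (S * (e / (2 * S)))) //.
  rewrite ler_pM ?mulr_ge0 ?(ltW K0) // /S ler_wpM2l ?(ltW K0) //.
  have := normr_ge0 p.2; lra.
by rewrite SE.
Unshelve. all: by end_near. Qed.

End DiffExtras.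

Section Ck.
Variables (R : realType).

Lemma CkSE k (E F : normedModType R) (U : set E) (f : E -> F) :
  Ck k.+1 U f <-> (forall x, U x -> differentiable f x) /\
    Ck k (U `*` setT) (fun p : E * E => 'd f (p.1) p.2).
Proof. by []. Qed.

Lemma Ck_congr k (E F : normedModType R) (U : set E) (f g : E -> F) :
  open U -> (forall x, U x -> f x = g x) -> Ck k U f -> Ck k U g.
Proof.
elim: k E F U f g => [|k IHk] E F U f g Uo fg.
  move=> fc x Ux; rewrite /prop_for /continuous_at -(fg x Ux).
  apply: cvg_trans (fc x Ux); apply: near_eq_cvg; exact: (open_near Uo Ux).
move=> /CkSE[df Dk]; have D x (Ux : U x) : differentiable g x /\ 'd g x = 'd f x :> (E -> F).
  by apply: near_eq_differentiable (df x Ux); exact: (open_near Uo Ux).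
apply/CkSE; split=> [x /D[]//|]; apply: IHk Dk; first exact: open_setXT.
by move=> [x v] [/= /D[_ ->]].
Qed.

Lemma Ck_sub k (E F : normedModType R) (U W : set E) (f : E -> F) :
  W `<=` U -> Ck k U f -> Ck k W f.
Proof.
elim: k E F U W f => [|k IHk] E F U W f WU /=; first by move=> fc x /WU/fc.
by move=> /CkSE[df Dk]; split=> [x /WU/df//|]; apply: IHk Dk => -[x v] [/WU].
Qed.

Lemma Ck_local k (E F : normedModType R) (U : set E) (f : E -> F) :
  (forall x, U x -> exists W, W x /\ Ck k W f) -> Ck k U f.
Proof.
elim: k E F U f => [|k IHk] E F U f fl /=.
  by move=> x /fl[W [Wx]]; exact.
split=> [x /fl[W [Wx [df _]]]|]; first exact: df.
apply: IHk => -[x v] [/= /fl[W [Wx [_ Dk]]] _].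
by exists (W `*` setT).
Qed.

Lemma CkS k (E F : normedModType R) (U : set E) (f : E -> F) :
  Ck k.+1 U f -> Ck k U f.
Proof.
elim: k E F U f => [|k IHk] E F U f /=.
  by move=> [df _] x /df; exact: differentiable_continuous.
by move=> [df Dk]; split=> //; exact: IHk Dk.
Qed.

Lemma Ck_cst k (E F : normedModType R) (U : set E) (c : F) : Ck k U (fun _ : E => c).
Proof.
elim: k E F U c => [|k IHk] E F U c /=; first by move=> x _; exact: cvg_cst.
split=> [x _|]; first exact: differentiable_cst.
have -> : (fun p : E * E => 'd (fun=> c) (p.1) p.2) = fun=> 0 :> F.
  by apply/funext => p; rewrite diff_cst.
exact: IHk.
Qed.

Lemma Ck_linear k (E F : normedModType R) (U : set E) (f : {linear E -> F}) :
  continuous f -> Ck k U f.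
Proof.
elim: k E F U f => [|k IHk] E F U f fc /=; first by move=> x _; exact: fc.
split=> [x _|]; first exact: linear_differentiable.
have -> : (fun p : E * E => 'd f (p.1) p.2) = f \o snd.
  by apply/funext => p; rewrite diff_lin.
by apply: IHk => p /=; apply: continuous_comp; [exact: cvg_snd|exact: fc].
Qed.

Lemma Ck_pair k (E F G : normedModType R) (U : set E) (f : E -> F) (g : E -> G) :
  open U -> Ck k U f -> Ck k U g -> Ck k U (fun x => (f x, g x)).
Proof.
elim: k E F G U f g => [|k IHk] E F G U f g Uo.
  by move=> fc gc x Ux; apply: cvg_pair; [exact: fc|exact: gc].
move=> /CkSE[df Df] /CkSE[dg Dg]; apply/CkSE; split=> [x Ux|].
  by apply: differentiable_pair; [exact: df|exact: dg].
have UTo := @open_setXT R E E U Uo.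
apply: Ck_congr (UTo) _ (IHk _ _ _ _ _ _ UTo Df Dg).
by move=> [x v] [/= Ux _]; rewrite diff_pair; [|exact: df|exact: dg].
Qed.

(** With the differential taken as a map of the point and the vector jointly, the chain rule is a
    composition of tangent maps: ['d (g \o f)] is ['d g] after [(f, 'd f)]. The induction thus calls
    itself on another composition, for varying spaces, and no product of higher derivatives
    appears. *)
Lemma Ck_comp k (E F G : normedModType R) (U : set E) (W : set F) (f : E -> F) (g : F -> G) :
  open U -> (forall x, U x -> W (f x)) -> Ck k U f -> Ck k W g -> Ck k U (g \o f).
Proof.
elim: k E F G U W f g => [|k IHk] E F G U W f g Uo UW.
  move=> fc gc x Ux; apply: continuous_comp; [exact: fc|exact: gc (UW _ Ux)].
move=> fk /CkSE[dg Dg]; have /CkSE[df Df] := fk; apply/CkSE; split=> [x Ux|].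
  by apply: differentiable_comp; [exact: df|exact/dg/UW].
have UTo := @open_setXT R E E U Uo.
apply: (@Ck_congr k _ _ _
  ((fun p => 'd g (p.1) p.2) \o fun p : E * E => (f p.1, 'd f (p.1) p.2))) => //.
  by move=> [x v] [/= Ux _]; rewrite (diff_comp (df _ Ux) (dg _ (UW _ Ux))).
apply: (IHk) (Dg) => //; first by move=> [x v] [/= /UW].
apply: Ck_pair => //; apply: (IHk _ _ _ _ U fst f) => //; first by move=> [x v] [].
  by apply: Ck_linear => p; exact: cvg_fst.
exact: CkS.
Qed.

Lemma CkD k (E F : normedModType R) (U : set E) (f g : E -> F) :
  open U -> Ck k U f -> Ck k U g -> Ck k U (fun x => f x + g x).
Proof.
elim: k E F U f g => [|k IHk] E F U f g Uo.
  by move=> fc gc x Ux; apply: cvgD; [exact: fc|exact: gc].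
move=> /CkSE[df Df] /CkSE[dg Dg]; apply/CkSE; split=> [x Ux|].
  by apply: differentiableD; [exact: df|exact: dg].
have UTo := @open_setXT R E E U Uo.
apply: Ck_congr (UTo) _ (IHk _ _ _ _ _ UTo Df Dg).
by move=> [x v] [/= Ux _]; rewrite diffD; [|exact: df|exact: dg].
Qed.

Lemma Ck_fst k (E F : normedModType R) (U : set (E * F)) : Ck k U fst.
Proof. by apply: Ck_linear => p; exact: cvg_fst. Qed.

Lemma Ck_snd k (E F : normedModType R) (U : set (E * F)) : Ck k U snd.
Proof. by apply: Ck_linear => p; exact: cvg_snd. Qed.

Lemma Ck_fst_comp k (E F G : normedModType R) (U : set E) (f : E -> F * G) :
  open U -> Ck k U f -> Ck k U (fun x => (f x).1).
Proof.
by move=> Uo fk; apply: (@Ck_comp _ _ _ _ _ setT f fst) => //; exact: Ck_fst.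
Qed.

Lemma Ck_snd_comp k (E F G : normedModType R) (U : set E) (f : E -> F * G) :
  open U -> Ck k U f -> Ck k U (fun x => (f x).2).
Proof.
by move=> Uo fk; apply: (@Ck_comp _ _ _ _ _ setT f snd) => //; exact: Ck_snd.
Qed.

(** The differential is a sum of two copies of the same bilinear map precomposed with projections,
    so continuity alone starts the induction and feeds every step. *)
Lemma Ck_bilinear_proj k (E F G : normedModType R) (U : set (E * F)) (f : {bilinear E -> F -> G}) :
  open U -> continuous (fun p => f p.1 p.2) -> Ck k U (fun p => f p.1 p.2).
Proof.
move=> + fc; elim: k U => [|k IHk] U Uo; first by move=> x _; exact: fc.
apply/CkSE; split=> [x Ux|]; first exact: differentiable_bilin.
have UTo := @open_setXT R _ (E * F)%type U Uo.
apply: (@Ck_congr k _ _ _ (fun p => f p.1.1 p.2.2 + f p.2.1 p.1.2)) => //.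
  by move=> [x v] _ /=; rewrite diff_bilin.
apply: CkD => //.
- apply: (@Ck_comp _ _ _ _ _ setT (fun p : (E * F) * (E * F) => (p.1.1, p.2.2))
    (fun p => f p.1 p.2)) => //; last exact/IHk/openT.
  by apply: Ck_pair => //; [exact/Ck_fst_comp/Ck_fst|exact/Ck_snd_comp/Ck_snd].
- apply: (@Ck_comp _ _ _ _ _ setT (fun p : (E * F) * (E * F) => (p.2.1, p.1.2))
    (fun p => f p.1 p.2)) => //; last exact/IHk/openT.
  by apply: Ck_pair => //; [exact/Ck_fst_comp/Ck_snd|exact/Ck_snd_comp/Ck_fst].
Qed.

End Ck.

Section Smooth.
Variables (R : realType).
Implicit Types E F G : normedModType R.

Lemma smooth_congr E F (U : set E) (f g : E -> F) :
  open U -> (forall x, U x -> f x = g x) -> smooth U f -> smooth U g.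
Proof. by move=> Uo fg fs k; exact: Ck_congr fg (fs k). Qed.

Lemma smooth_sub E F (U W : set E) (f : E -> F) :
  W `<=` U -> smooth U f -> smooth W f.
Proof. by move=> WU fs k; exact: Ck_sub WU (fs k). Qed.

Lemma smooth_local E F (U : set E) (f : E -> F) :
  (forall x, U x -> exists W (g : E -> F),
     [/\ open W, W x, smooth W g & forall y, W y -> f y = g y]) -> smooth U f.
Proof.
move=> fl k; apply: Ck_local => x /fl[W [g [Wo Wx gs fg]]].
by exists W; split=> //; apply: (Ck_congr Wo) (gs k) => y /fg.
Qed.

Lemma smooth_differentiable E F (U : set E) (f : E -> F) x :
  smooth U f -> U x -> differentiable f x.
Proof. by move=> /(_ 1)[df _] /df. Qed.

Lemma smooth_continuous E F (U : set E) (f : E -> F) x :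
  smooth U f -> U x -> {for x, continuous f}.
Proof. by move=> /(_ 0); exact. Qed.

Lemma smooth_cst E F (U : set E) (c : F) : smooth U (fun _ : E => c).
Proof. by move=> k; exact: Ck_cst. Qed.

Lemma smooth_comp E F G (U : set E) (W : set F) (f : E -> F) (g : F -> G) :
  open U -> (forall x, U x -> W (f x)) -> smooth U f -> smooth W g ->
  smooth U (fun x => g (f x)).
Proof. by move=> Uo UW fs gs k; exact: Ck_comp Uo UW (fs k) (gs k). Qed.

Lemma smooth_pair E F G (U : set E) (f : E -> F) (g : E -> G) :
  open U -> smooth U f -> smooth U g -> smooth U (fun x => (f x, g x)).
Proof. by move=> Uo fs gs k; exact: Ck_pair. Qed.

Lemma smoothD E F (U : set E) (f g : E -> F) :
  open U -> smooth U f -> smooth U g -> smooth U (fun x => f x + g x).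
Proof. by move=> Uo fs gs k; exact: CkD. Qed.

Lemma smooth_fst E F (U : set (E * F)) : smooth U fst.
Proof. by move=> k; exact: Ck_fst. Qed.

Lemma smooth_snd E F (U : set (E * F)) : smooth U snd.
Proof. by move=> k; exact: Ck_snd. Qed.

Lemma smooth_id E (U : set E) : smooth U id.
Proof. by move=> k; apply: (@Ck_linear R k E E U idfun) => x; exact: cvg_id. Qed.

Lemma smooth_linear E F G (U : set E) (f : E -> F) (l : F -> G) (M : R) :
  linear l -> (forall x, `|l x| <= M * `|x|) ->
  open U -> smooth U f -> smooth U (fun x => l (f x)).
Proof.
move=> ll lM Uo fs.
pose lL : {linear F -> G} := HB.pack l (GRing.isLinear.Build _ _ _ _ _ ll).
have lc := @bound_continuous_linear R F G lL M lM.
by apply: (@smooth_comp _ _ _ _ setT) => // k; exact: (@Ck_linear R k F G setT lL).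
Qed.

Lemma diff_bound_linear E F (l : E -> F) (M : R) x :
  linear l -> (forall x, `|l x| <= M * `|x|) ->
  differentiable l x /\ 'd l x = l :> (E -> F).
Proof.
move=> ll lM.
pose lL : {linear E -> F} := HB.pack l (GRing.isLinear.Build _ _ _ _ _ ll).
have lc := @bound_continuous_linear R E F lL M lM.
by split; [exact: (@linear_differentiable R E F lL)|exact: (@diff_lin R E F lL)].
Qed.

Section Bilinear.
Variables (E F G : normedModType R) (B : E -> F -> G) (M : R).
Hypothesis Bl : forall y, linear (B^~ y).
Hypothesis Br : forall x, linear (B x).
Hypothesis BM : forall x y, `|B x y| <= M * `|x| * `|y|.

Let BB : bilinear_for *:%R *:%R B. Proof. by split. Qed.
Let Bb : {bilinear E -> F -> G} :=
  HB.pack B (bilinear_isBilinear.Build _ _ _ _ _ _ B BB).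

Lemma smooth_bilinear (T : normedModType R) (U : set T) (f : T -> E) (g : T -> F) :
  open U -> smooth U f -> smooth U g -> smooth U (fun x => B (f x) (g x)).
Proof.
move=> Uo fs gs; have Bc := @bound_continuous_bilinear R E F G Bb M BM.
apply: (@smooth_comp _ _ _ _ setT (fun x => (f x, g x)) (fun p => B p.1 p.2)) => //.
  exact: smooth_pair.
by move=> k; apply: (@Ck_bilinear_proj R k E F G setT Bb) => //; exact: openT.
Qed.

Lemma diff_bilinear (T : normedModType R) (f : T -> E) (g : T -> F) x :
  differentiable f x -> differentiable g x ->
  differentiable (fun x => B (f x) (g x)) x /\
  forall v, 'd (fun x => B (f x) (g x)) x v = B (f x) ('d g x v) + B ('d f x v) (g x).
Proof.
move=> df dg; have Bc := @bound_continuous_bilinear R E F G Bb M BM.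
have dB := differentiable_bilin (f x, g x) Bc.
have dp := differentiable_pair df dg.
have -> : (fun x => B (f x) (g x)) = (fun p => Bb p.1 p.2) \o (fun x => (f x, g x)) by [].
split; first exact: differentiable_comp.
move=> v; rewrite (diff_comp dp dB).
by rewrite -[LHS]/('d _ _ ('d _ _ v)) diff_pair // diff_bilin.
Qed.

End Bilinear.

Lemma smooth_diff E F (U : set E) (f : E -> F) :
  smooth U f -> smooth (U `*` setT) (fun p : E * E => 'd f (p.1) p.2).
Proof. by move=> fs k; have [] := fs k.+1. Qed.

Lemma smooth_diff_comp E F G (U : set E) (W : set G) (f : E -> F) (g h : G -> E) :
  open W -> (forall x, W x -> U (g x)) -> smooth U f -> smooth W g -> smooth W h ->
  smooth W (fun x => 'd f (g x) (h x)).
Proof.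
move=> Wo WU fs gs hs.
apply: (@smooth_comp _ _ _ _ (U `*` setT) (fun x => (g x, h x))
  (fun p : E * E => 'd f (p.1) p.2)) => //; first by move=> x /WU.
  exact: smooth_pair.
exact: smooth_diff.
Qed.

Lemma smooth_derive E F (U : set E) (f : E -> F) v :
  open U -> smooth U f -> smooth U ('D_v f).
Proof.
move=> Uo fs; apply: (@smooth_congr _ _ _ (fun x => 'd f x v)) => //.
  by move=> x Ux; rewrite deriveE //; exact: smooth_differentiable Ux.
apply: smooth_diff_comp fs _ _ => //; last exact: smooth_cst.
exact: smooth_id.
Qed.

Lemma Ck_mulr k E (U : set E) (f g : E -> R^o) :
  open U -> Ck k U f -> Ck k U g -> Ck k U (fun x => f x * g x : R^o).
Proof.
move=> Uo fk gk.
apply: (@Ck_comp _ _ _ _ _ _ setT (fun p => (f p, g p)) (fun p : R^o * R^o => p.1 * p.2 : R^o)) => //.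
  exact: Ck_pair.
apply: (@Ck_bilinear_proj R k R^o R^o R^o setT *%R); first exact: openT.
by move=> p; exact: mul_continuous.
Qed.

(** The differential of the inverse is a polynomial in the inverse itself and in the vector, so one
    order of smoothness yields the next. *)
Lemma Ck_invr k E (U : set E) (f : E -> R^o) :
  open U -> (forall x, U x -> f x != 0) -> Ck k U f -> Ck k U (fun x => (f x)^-1 : R^o).
Proof.
move=> Uo f0 fk; pose W := [set x : R^o | x != 0].
have Wo : open W by exact: open_neq.
apply: (@Ck_comp _ _ _ _ _ _ W f GRing.inv) => // {E U f Uo f0 fk}.
elim: k => [|k IHk]; first by move=> x x0; exact: inv_continuous.
apply/CkSE; split=> [x|]; first exact: differentiable_Rinv.
have WTo := @open_setXT R R^o R^o W Wo.
apply: (@Ck_congr R k (R^o * R^o)%type R^o (W `*` setT) (fun p => (p.1^-1 * p.1^-1) * (- p.2) : R^o)) => //.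
  by move=> [x v] [/= x0 _]; rewrite diff_Rinv // mulrN -mulNr expr2 invfM.
have i1 : Ck k (W `*` setT) (fun p : R^o * R^o => p.1^-1 : R^o).
  apply: (@Ck_comp _ _ _ _ _ _ W fst GRing.inv) => //; first by move=> [x v] [].
  exact: Ck_fst.
have i2 : Ck k (W `*` setT) (fun p : R^o * R^o => - p.2 : R^o).
  apply: (@Ck_comp _ _ _ _ _ _ setT snd -%R) => //; first exact: Ck_snd.
  by apply: (@Ck_linear _ _ _ _ _ -%R) => x; exact: opp_continuous.
by apply: Ck_mulr => //; exact: Ck_mulr.
Qed.

Lemma Ck_sqrt k E (U : set E) (f : E -> R^o) :
  open U -> (forall x, U x -> 0 < f x) -> Ck k U f ->
  Ck k U (fun x => Num.sqrt (f x) : R^o).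
Proof.
move=> Uo f0 fk; pose W := [set x : R^o | 0 < x].
have Wo : open W by exact: open_gt.
apply: (@Ck_comp _ _ _ _ _ _ W f Num.sqrt) => // {E U f Uo f0 fk}.
elim: k => [|k IHk]; first by move=> x x0; exact: sqrt_continuous.
have ds x : W x -> is_derive (x : R^o) 1 (Num.sqrt : R^o -> R^o) (2 * Num.sqrt x)^-1.
  exact: is_derive1_sqrt.
have dd x : W x -> differentiable (Num.sqrt : R^o -> R^o) x.
  by move=> /ds[d _]; exact/derivable1_diffP.
apply/CkSE; split=> //.
have WTo := @open_setXT R R^o R^o W Wo.
apply: (@Ck_congr R k (R^o * R^o)%type R^o (W `*` setT) (fun p => p.2 * (2 * Num.sqrt p.1)^-1 : R^o)) => //.
  move=> [x v] [/= x0 _]; rewrite diff1E; last exact: dd.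
  by rewrite derive1E; have [_ ->] := ds x x0.
have s2 : Ck k (W `*` setT) (fun p : R^o * R^o => Num.sqrt p.1 : R^o).
  apply: (@Ck_comp _ _ _ _ _ _ W fst Num.sqrt) => //; first by move=> [x v] [].
  exact: Ck_fst.
apply: Ck_mulr => //; first exact: Ck_snd.
apply: Ck_invr => //; last by apply: Ck_mulr => //; exact: Ck_cst.
by move=> [x v] [/= x0 _]; rewrite mulf_neq0 // gt_eqF // sqrtr_gt0.
Qed.

Lemma smooth_mulr E (U : set E) (f g : E -> R^o) :
  open U -> smooth U f -> smooth U g -> smooth U (fun x => f x * g x : R^o).
Proof. by move=> Uo fs gs k; exact: Ck_mulr. Qed.

Lemma smooth_invr E (U : set E) (f : E -> R^o) :
  open U -> (forall x, U x -> f x != 0) -> smooth U f -> smooth U (fun x => (f x)^-1 : R^o).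
Proof. by move=> Uo f0 fs k; exact: Ck_invr. Qed.

Lemma smooth_sqrt E (U : set E) (f : E -> R^o) :
  open U -> (forall x, U x -> 0 < f x) -> smooth U f ->
  smooth U (fun x => Num.sqrt (f x) : R^o).
Proof. by move=> Uo f0 fs k; exact: Ck_sqrt. Qed.

End Smooth.

(** * Symmetry of second derivatives *)

Section Schwarz.
Variables (R : realType).
Implicit Types E F G : normedModType R.

Lemma is_derive_line E F (f : E -> F) x v (t : R) :
  derivable f (x + t *: v) v ->
  is_derive (t : R^o) (1 : R^o) (fun t : R^o => f (x + t *: v)) ('D_v f (x + t *: v)).
Proof.
have e : (fun h : R => h^-1 *: (((fun t : R^o => f (x + t *: v)) \o shift t) (h *: (1 : R^o))
   - f (x + t *: v))) = (fun h => h^-1 *: ((f \o shift (x + t *: v)) (h *: v) - f (x + t *: v))).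
  apply/funext => h; congr (_ *: (f _ - _)).
  by rewrite /= [h%:A]mulr1 scalerDl addrCA.
by move=> d; split; rewrite /derivable /derive e.
Qed.

(** The mean value theorem is applied twice: along [a] to the difference of [f] on the two sides of
    the parallelogram parallel to [a], then along [b] to ['D_a f]. *)
Lemma second_difference E (f : E -> R^o) (U : set E) x a b (s : R) : 0 < s ->
  open U -> smooth U f ->
  (forall t t' : R, 0 <= t <= s -> 0 <= t' <= s -> U (x + t *: a + t' *: b)) ->
  exists t t' : R, [/\ 0 <= t <= s, 0 <= t' <= s &
    f (x + s *: a + s *: b) - f (x + s *: a) - f (x + s *: b) + f x
    = s * s * 'D_b ('D_a f) (x + t *: a + t' *: b)].
Proof.
move=> s0 Uo fs Us; have s00 := ltW s0.
have Us0 (t : R) : 0 <= t <= s -> U (x + t *: a).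
  by move=> ts; have := Us t 0 ts; rewrite scale0r addr0; apply; rewrite lexx.
have Usb (t : R) : 0 <= t <= s -> U (x + s *: b + t *: a).
  by move=> ts; have := Us t s ts; rewrite addrAC; apply; rewrite lexx s00.
have df y : U y -> derivable f y a.
  by move=> Uy; apply: diff_derivable; exact: smooth_differentiable Uy.
have D1 (t : R^o) : 0 <= t <= s -> is_derive t (1 : R^o)
    (fun t : R^o => f (x + s *: b + t *: a) - f (x + t *: a) : R^o)
    ('D_a f (x + s *: b + t *: a) - 'D_a f (x + t *: a) : R^o).
  by move=> ts; apply: is_deriveB; apply: is_derive_line; apply: df; [exact: Usb|exact: Us0].
have D2 (t t' : R^o) : 0 <= t <= s -> 0 <= t' <= s -> is_derive t' (1 : R^o)
    (fun t' : R^o => 'D_a f (x + t *: a + t' *: b) : R^o)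
    ('D_b ('D_a f) (x + t *: a + t' *: b) : R^o).
  move=> ts ts'; apply: is_derive_line; apply: diff_derivable.
  exact: smooth_differentiable (smooth_derive a Uo fs) (Us _ _ ts ts').
have mvt (g dg : R -> R) : (forall t : R^o, 0 <= t <= s -> is_derive t (1 : R^o) (g : R^o -> R^o) (dg t)) ->
    exists2 c, 0 <= c <= s & g s - g 0 = s * dg c.
  move=> gd; have [t||c] := @MVT R g dg 0 s s0.
  - by rewrite in_itv /= => /andP[t0 ts]; apply: gd; rewrite !ltW.
  - apply: derivable_within_continuous => t; rewrite in_itv /= => ts.
    by have [] := gd t ts.
  - rewrite in_itv /= => /andP[c0 cs] ->; exists c; first by rewrite !ltW.
    by rewrite subr0 mulrC.
have [t ts Et] := mvt _ _ D1; have [t' ts' Et'] := mvt _ _ (D2 t ^~ ts).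
exists t, t'; split=> //; move: Et Et'; rewrite !scale0r !addr0.
rewrite [x + s *: b + s *: a]addrAC [x + s *: b + t *: a]addrAC -mulrA => Et <-.
rewrite -Et; ring.
Qed.

Lemma derive_sym_real E (f : E -> R^o) (U : set E) x a b :
  open U -> smooth U f -> U x -> 'D_b ('D_a f) x = 'D_a ('D_b f) x.
Proof.
move=> Uo fs Ux.
have c v w : {for x, continuous ('D_v ('D_w f))}.
  by apply: smooth_continuous Ux; apply: smooth_derive => //; exact: smooth_derive.
apply/eqP; rewrite -subr_eq0 -normr_le0; apply/ler_addgt0Pr => e e0; rewrite add0r.
have e20 : 0 < e / 2 by rewrite divr_gt0.
have /cvgrPdist_le/(_ _ e20) N1 := c b a.
have /cvgrPdist_le/(_ _ e20) N2 := c a b.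
have NU : \near x, U x by exact: open_nbhs_nbhs.
have /nbhs_ballP[r /= r0 rN] : \forall y \near x,
    (`|'D_b ('D_a f) x - 'D_b ('D_a f) y| <= e / 2 /\
     `|'D_a ('D_b f) x - 'D_a ('D_b f) y| <= e / 2) /\ U y.
  exact: filterI (filterI N1 N2) NU.
(* The parallelogram of sides [s *: a] and [s *: b] stays within [r / 2] of [x]; the summand 1 keeps
   the denominator positive when [a] and [b] vanish. *)
pose s := r / (2 * (`|a| + `|b| + 1)).
have ab0 : 0 < `|a| + `|b| + 1 by rewrite ltr_pwDr // addr_ge0.
have s0 : 0 < s by rewrite divr_gt0 // mulr_gt0.
have Bs (t t' : R) : 0 <= t <= s -> 0 <= t' <= s -> ball x r (x + t *: a + t' *: b).
  move=> /andP[t0 ts] /andP[t0' ts']; rewrite -ball_normE /= -addrA opprD addNKr normrN.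
  rewrite (le_lt_trans (ler_normD _ _)) // !normrZ !ger0_norm //.
  rewrite (@le_lt_trans _ _ (s * (`|a| + `|b| + 1))) //.
    have := normr_ge0 a; have := normr_ge0 b; nra.
  have -> : s * (`|a| + `|b| + 1) = r / 2 by rewrite /s; field; rewrite gt_eqF.
  lra.
have [t1 [t1' [h1 h1' E1]]] := @second_difference E f U x a b s s0 Uo fs
  (fun (t t' : R) h h' => (rN _ (Bs t t' h h')).2).
have Bs' (t t' : R) : 0 <= t <= s -> 0 <= t' <= s -> ball x r (x + t *: b + t' *: a).
  by move=> h h'; rewrite addrAC; exact: Bs.
have [t2 [t2' [h2 h2' E2]]] := @second_difference E f U x b a s s0 Uo fs
  (fun (t t' : R) h h' => (rN _ (Bs' t t' h h')).2).
(* The second difference is symmetric in [a] and [b], so the two mixed derivatives agree at two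
   possibly different points of the ball; continuity at [x] does the rest. *)
have E12 : 'D_b ('D_a f) (x + t1 *: a + t1' *: b) = 'D_a ('D_b f) (x + t2 *: b + t2' *: a).
  apply: (@mulfI _ (s * s)); first by rewrite mulf_neq0 // gt_eqF.
  apply: etrans (esym E1) (etrans _ E2).
  by rewrite [x + s *: b + s *: a]addrAC; congr (_ + _); exact: addrAC.
have [[M1 _] _] := rN _ (Bs _ _ h1 h1'); have [[_ M2] _] := rN _ (Bs' _ _ h2 h2').
rewrite [e]splitr; apply: le_trans (lerD M1 M2); rewrite E12.
by rewrite [X in _ <= _ + X]distrC; exact: ler_distD.
Qed.

Lemma derive_bound_linear E F G (f : E -> F) (l : F -> G) (M : R) x v :
  linear l -> (forall x, `|l x| <= M * `|x|) -> differentiable f x ->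
  'D_v (fun y => l (f y)) x = l ('D_v f x).
Proof.
move=> ll lM df; have [dl lE] := diff_bound_linear (f x) ll lM.
rewrite [RHS](congr1 l (deriveE v df)) deriveE; last exact: (differentiable_comp df dl).
by rewrite (diff_comp df dl) -[LHS]/('d _ _ ('d _ _ v)) lE.
Qed.

(* Real functionals that separate points reduce the vector-valued case to the
   mean value theorem. *)
Lemma derive_sym E F (L : set (F -> R^o)) (f : E -> F) (U : set E) x a b :
  (forall l, L l -> linear l /\ exists M, forall x, `|l x| <= M * `|x|) ->
  (forall y, (forall l, L l -> l y = 0) -> y = 0) ->
  open U -> smooth U f -> U x -> 'D_b ('D_a f) x = 'D_a ('D_b f) x.
Proof.
move=> Lb Ls Uo fs Ux; apply/subr0_eq/Ls => l Ll; have [ll [M lM]] := Lb l Ll.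
have ls : smooth U (fun y => l (f y)) by exact: smooth_linear ll lM Uo fs.
have lD v w : l ('D_v ('D_w f) x) = 'D_v ('D_w (fun y => l (f y))) x.
  rewrite -(derive_bound_linear v ll lM); last first.
    exact: smooth_differentiable (smooth_derive _ Uo fs) Ux.
  apply: near_eq_derive; apply: (open_near Uo Ux) => y Uy.
  by rewrite -(derive_bound_linear w ll lM) //; exact: smooth_differentiable fs Uy.
have lB y z : l (y - z) = l y - l z.
  by rewrite addrC -scaleN1r ll scaleN1r addrC.
by rewrite lB !lD (derive_sym_real a b Uo ls Ux) subrr.
Qed.

End Schwarz.

(** * Operators and traces on a Hilbert space *)

Section InnerProduct.
Variables (R : realType) (H : hilbertType R).
Implicit Types (x y z : H) (a : R[i]).

Lemma innerDl x y z : inner (x + y) z = inner x z + inner y z.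
Proof. by rewrite innerC innerDr rmorphD /= -!innerC. Qed.

Lemma innerZl a x y : inner (a *: x) y = a^* * inner x y.
Proof. by rewrite innerC innerZr rmorphM /= -innerC. Qed.

Lemma inner0r x : inner x 0 = 0.
Proof. by rewrite -(scale0r 0) innerZr mul0r. Qed.

Lemma inner0l x : inner 0 x = 0.
Proof. by rewrite innerC inner0r rmorph0. Qed.

Lemma innerNr x y : inner x (- y) = - inner x y.
Proof. by rewrite -scaleN1r innerZr mulN1r. Qed.

Lemma innerNl x y : inner (- x) y = - inner x y.
Proof. by rewrite innerC innerNr rmorphN /= -innerC. Qed.

Lemma innerBr x y z : inner x (y - z) = inner x y - inner x z.
Proof. by rewrite innerDr innerNr. Qed.

Lemma innerBl x y z : inner (x - y) z = inner x z - inner y z.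
Proof. by rewrite innerDl innerNl. Qed.

Lemma inner_sumr (I : Type) (r : seq I) (P : pred I) (F : I -> H) x :
  inner x (\sum_(i <- r | P i) F i) = \sum_(i <- r | P i) inner x (F i).
Proof. by apply: (big_morph (inner x)) => [y z|]; rewrite ?innerDr ?inner0r. Qed.

Definition innerE := (innerDl, @innerDr R H, innerNl, innerNr, innerZl, @innerZr R H).

Lemma inner_norm x : inner x x = (complex.Re `|x| ^+ 2)%:C.
Proof. by rewrite -norm_inner -Re_norm_real rmorphXn. Qed.

Lemma inner_ge0 x : 0 <= inner x x.
Proof. by rewrite inner_norm ler0c sqr_ge0. Qed.

Lemma inner_eq0 x : inner x x = 0 -> x = 0.
Proof.
rewrite inner_norm => /eqP; rewrite -[0]/(0%:C) (inj_eq (@complexI R)) sqrf_eq0.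
by move=> /eqP/Re_norm0_eq0.
Qed.

Lemma inner_gt0 x : x != 0 -> 0 < inner x x.
Proof.
by move=> x0; rewrite lt_def inner_ge0 andbT; apply: contra_neq x0 => /inner_eq0.
Qed.

Lemma inner_extr x y : (forall z, inner z x = inner z y) -> x = y.
Proof. by move=> xy; apply/subr0_eq/inner_eq0; rewrite innerBr xy subrr. Qed.

Lemma cauchy_schwarz x y : `|inner x y| <= `|x| * `|y|.
Proof.
have [->|y0] := eqVneq y 0; first by rewrite inner0r !normr0 mulr0.
have yy := inner_gt0 y0.
pose z := inner y y *: x - inner y x *: y.
have zE : inner z z = inner y y * (inner x x * inner y y - `|inner x y| ^+ 2).
  rewrite sqr_normc /z !innerE.
  have -> : (inner y y)^* = inner y y by rewrite -innerC.
  have -> : (inner y x)^* = inner x y by rewrite -innerC.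
  have -> : (inner x y)^*%C = inner y x by rewrite [RHS]innerC.
  ring.
have := inner_ge0 z; rewrite zE pmulr_rge0 // subr_ge0 -!norm_inner -exprMn.
by rewrite ler_pXn2r // nnegrE mulr_ge0.
Qed.

Local Notation rn x := (complex.Re `|x|).

Lemma Re_inner_le x y : `|complex.Re (inner x y)| <= rn x * rn y.
Proof.
rewrite -lecR (le_trans (normc_ge_Re _)) // (le_trans (cauchy_schwarz _ _)) //.
by rewrite rmorphM /= !Re_norm_real.
Qed.

Lemma rn_sqr x : rn x ^+ 2 = complex.Re (inner x x).
Proof. by rewrite inner_norm. Qed.

Lemma ReM_real (r : R) (b : R[i]) : complex.Re (r%:C * b) = r * complex.Re b.
Proof. by case: b => u v /=; rewrite mul0r subr0. Qed.

Lemma complexRe_conj (b : R[i]) : complex.Re b^* = complex.Re b.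
Proof. by case: b. Qed.

Lemma ReM_i (b : R[i]) : complex.Re ('i%C * b) = - complex.Im b.
Proof. by case: b => u v /=; rewrite mul0r mul1r sub0r. Qed.

Lemma ReD (a b : R[i]) : complex.Re (a + b) = complex.Re a + complex.Re b.
Proof. by case: a; case: b. Qed.

Lemma ReN (a : R[i]) : complex.Re (- a) = - complex.Re a.
Proof. by case: a. Qed.

Lemma conj_real (r : R) : (r%:C)^* = r%:C.
Proof. exact: conjc_real. Qed.

Lemma Re_innerC x y : complex.Re (inner x y) = complex.Re (inner y x).
Proof. by rewrite innerC complexRe_conj. Qed.

(** The representing vector minimises [F x = |x|^2 - 2 Re f(x)]. A sequence of near-minimisers is
    Cauchy by the parallelogram identity, and at its limit the derivative of [F] vanishes in every
    direction, which is the real part of the claim. *)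
Lemma riesz (f : H -> R[i]) (M : R) :
  (forall a x y, f (a *: x + y) = a * f x + f y) ->
  (forall x, `|f x| <= M%:C * `|x|) -> exists z, forall x, f x = inner z x.
Proof.
move=> fl fM.
have f0 : f 0 = 0.
  have := fl 1 0 0; rewrite scale1r addr0 mul1r => h.
  by apply: (addrI (f 0)); rewrite addr0 -h.
have fD x y : f (x + y) = f x + f y by rewrite -[x]scale1r fl mul1r scale1r.
have fZ a x : f (a *: x) = a * f x by rewrite -[a *: x]addr0 fl f0 addr0.
have RfM x : `|complex.Re (f x)| <= M * rn x.
  by rewrite -lecR (le_trans (normc_ge_Re _)) // (le_trans (fM x)) // rmorphM /= Re_norm_real.
pose F x := rn x ^+ 2 - 2 * complex.Re (f x).
(* Half the derivative of [F] at [x] in the direction [y]. *)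
pose D x y := complex.Re (inner x y) - complex.Re (f y).
have FE x y (t : R) : F (x + t%:C *: y) = F x + t ^+ 2 * rn y ^+ 2 + 2 * t * D x y.
  rewrite /F /D !rn_sqr fD fZ !innerE conj_real !(ReD, ReM_real) (Re_innerC y x); ring.
have Flb x : - M ^+ 2 <= F x.
  have := RfM x; rewrite ler_norml => /andP[_ Mx]; rewrite /F.
  have := sqr_ge0 (rn x - M); nra.
pose d := inf (range F).
have hd : has_inf (range F).
  by split; [exists (F 0), 0|exists (- M ^+ 2) => _ [x _ <-]].
have dF x : d <= F x by apply: ge_inf; [case: hd|exists x].
have /choice[xs xsP] (n : nat) : exists x, F x < d + n.+1%:R^-1 ^+ 2.
  have e0 : 0 < n.+1%:R^-1 ^+ 2 :> R by rewrite exprn_gt0.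
  by have [_ [x _ <-] xd] := inf_adherent e0 hd; exists x.
(* Along the line through [xs n] in the direction [y], [F] drops by at most [D^2 / |y|^2], attained
   at [t = - D / |y|^2]; near-minimality bounds this drop by the square of [n.+1%:R^-1]. *)
have near_min n y : `|D (xs n) y| <= rn y * n.+1%:R^-1.
  have [->|y0] := eqVneq y 0.
    by rewrite /D inner0r f0 subrr normr0 mulr_ge0 // Re_norm_ge0.
  have Y0 : 0 < rn y.
    rewrite lt_def Re_norm_ge0 andbT; apply: contra_neq y0; exact: Re_norm0_eq0.
  rewrite -(@ler_pXn2r _ 2) ?nnegrE ?mulr_ge0 ?Re_norm_ge0 // real_normK ?num_real //.
  have h : F (xs n) - n.+1%:R^-1 ^+ 2 < F (xs n + (- D (xs n) y / rn y ^+ 2)%:C *: y).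
    by apply: lt_le_trans (dF _); rewrite ltrBlDr.
  move: h; rewrite FE => h.
  have e : (- D (xs n) y / rn y ^+ 2) ^+ 2 * rn y ^+ 2
      + 2 * (- D (xs n) y / rn y ^+ 2) * D (xs n) y = - (D (xs n) y ^+ 2 / rn y ^+ 2).
    by field; rewrite gt_eqF.
  have : D (xs n) y ^+ 2 / rn y ^+ 2 < n.+1%:R^-1 ^+ 2.
    by move: h; rewrite -[ltRHS]addrA e ltrD2l ltrN2.
  by rewrite ltr_pdivrMr ?exprn_gt0 // exprMn => /ltW; rewrite mulrC.
(* The midpoint has value at least [d], and [F] there is the mean of the two values minus a quarter
   of the squared distance. *)
have dist n m : rn (xs n - xs m) ^+ 2 <= 2 * (n.+1%:R^-1 ^+ 2 + m.+1%:R^-1 ^+ 2).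
  have h1 := FE (xs m) (xs n - xs m) 1; have h2 := FE (xs m) (xs n - xs m) 2^-1.
  move: h1; rewrite scale1r addrC subrK expr1n mul1r mulr1 => h1.
  have := dF (xs m + 2^-1%:C *: (xs n - xs m)); rewrite h2.
  have := xsP n; have := xsP m; rewrite h1.
  move: (F (xs m)) (D _ _) (rn _) (m.+1%:R^-1) (n.+1%:R^-1) => a b c e e'; clearbody d; lra.
have dinv (N n : nat) : (N <= n)%N -> n.+1%:R^-1 ^+ 2 <= N.+1%:R^-1 ^+ 2 :> R.
  by move=> Nn; rewrite ler_pXn2r ?nnegrE ?invr_ge0 // lef_pV2 ?posrE // ler_nat.
have small (e : R) : 0 < e -> exists N, forall n, (N <= n)%N -> n.+1%:R^-1 < e.
  by move=> e0; have [N _ Ne] := near_infty_natSinv_lt (PosNum e0); exists N.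
have xc : cvg (xs @ \oo).
  apply: cauchy_cvg; apply: cauchy_exP => e e0.
  (* Radii of balls are elements of [R[i]]; a positive one is real, so the estimate is carried out
     with its real part. *)
  have e0' : 0 < complex.Re e by move: e0; rewrite ltcE /= => /andP[].
  have eE : e = (complex.Re e)%:C by rewrite RRe_real // gtr0_real.
  have [N Ne] := small (complex.Re e / 2) (divr_gt0 e0' (ltr0Sn _ 1)).
  exists (xs N), N => // n /= Nn; rewrite -ball_normE /=.
  rewrite eE -Re_norm_real ltcR -(@ltr_pXn2r _ 2) ?nnegrE ?Re_norm_ge0 ?(ltW e0') //.
  apply: le_lt_trans (dist N n) _; have := dinv _ _ Nn; have := Ne N (leqnn N).
  have : 0 < N.+1%:R^-1 :> R by rewrite invr_gt0.
  clear eE; move: (N.+1%:R^-1) (n.+1%:R^-1) (complex.Re e) e0' => u v k k0 u0 uk vu.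
  have : 0 < (k - 2 * u) * (k + 2 * u) by apply: mulr_gt0; lra.
  nra.
exists (lim (xs @ \oo)); set l := lim _.
have lP (e : R) : 0 < e -> exists N, forall n, (N <= n)%N -> rn (l - xs n) < e.
  move=> e0; have /cvgrPdist_lt : xs @ \oo --> l by exact: xc.
  move=> /(_ e%:C); rewrite ltcR => /(_ e0)[N _ Ne]; exists N => n Nn.
  by rewrite -ltcR Re_norm_real; exact: Ne.
have D0 y : D l y = 0.
  apply/eqP; rewrite -normr_le0; apply/ler_addgt0Pr => e e0; rewrite add0r.
  pose k := e / (2 * (rn y + 1)).
  have Y1 : 0 < rn y + 1 by rewrite ltr_pwDr // Re_norm_ge0.
  have k0 : 0 < k by rewrite divr_gt0 // mulr_gt0.
  have [N1 h1] := lP k k0; have [N2 h2] := small k k0.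
  pose n := maxn N1 N2; have := h1 n (leq_maxl _ _); have := h2 n (leq_maxr _ _).
  have -> : D l y = complex.Re (inner (l - xs n) y) + D (xs n) y.
    by rewrite /D innerBl ReD ReN; ring.
  move=> n2 n1; have a1 := Re_inner_le (l - xs n) y; have a2 := near_min n y.
  apply: le_trans (ler_normD _ _) _; apply: le_trans (lerD a1 a2) _.
  have ek : e = k * (2 * (rn y + 1)) by rewrite /k; field; rewrite gt_eqF.
  have Y0 := Re_norm_ge0 y; rewrite ek mulrC -mulrDr.
  rewrite [leRHS](_ : _ = (rn y + 1) * (k + k)); last by ring.
  apply: ler_pM => //; [by rewrite addr_ge0 ?Re_norm_ge0|by rewrite lerDl|].
  by rewrite lerD // ltW.
have Dr y : complex.Re (f y) = complex.Re (inner l y).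
  by apply/eqP; rewrite eq_sym -subr_eq0; apply/eqP; exact: D0.
(* The imaginary parts agree because the real parts agree at [i y]. *)
move=> y; apply/eqP; rewrite eq_complex Dr eqxx /=.
by rewrite -eqr_opp -!ReM_i -fZ -innerZr Dr.
Qed.

End InnerProduct.

Section OperatorTheory.
Variables (R : realType) (H : hilbertType R).
Implicit Types (A B C : bounded_op H) (x y z : H) (a : R[i]).

Local Notation rn x := (complex.Re `|x|).

Lemma Re_norm_le (E F : normedModType R[i]) (x : E) (y : F) (M : R) :
  (`|x| <= M%:C * `|y|) = (rn x <= M * rn y).
Proof. by rewrite -(Re_norm_real x) -(Re_norm_real y) -rmorphM lecR. Qed.

Lemma rnZ_real (E : normedModType R[i]) (r : R) (x : E) :
  rn (r%:C *: x) = `|r| * rn x.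
Proof. by rewrite Re_normZ normc_def /= expr0n /= addr0 sqrtr_sqr. Qed.

Lemma norm_le1 (E : normedModType R[i]) (x : E) : (`|x| <= 1) = (rn x <= 1).
Proof. by rewrite -(Re_norm_real x) -[1]/(1%:C) lecR. Qed.

Lemma bound_op_le A (M : R) : 0 <= M -> (forall x, rn (A x) <= M * rn x) -> rn A <= M.
Proof.
move=> M0 AM; apply: ge_sup; first by exists (rn (A 0)), 0; rewrite //= normr0.
move=> _ [x x1 <-]; apply: le_trans (AM x) _; rewrite ler_piMr //.
by rewrite -norm_le1.
Qed.

Lemma op_norm_le A x : rn (A x) <= rn A * rn x.
Proof.
have [->|x0] := eqVneq x 0; first by rewrite linear0 normr0 mulr0.
have X0 : 0 < rn x by rewrite -ltcR Re_norm_real normr_gt0.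
have xE : x = (rn x)%:C *: ((rn x)^-1%:C *: x).
  by rewrite scalerA -rmorphM /= divff ?gt_eqF // scale1r.
have x1 : `|(rn x)^-1%:C *: x| <= 1.
  have r0 : 0 <= (rn x)^-1 by rewrite invr_ge0 ltW.
  by rewrite norm_le1 rnZ_real ger0_norm // mulVf // gt_eqF.
rewrite [in A x]xE linearZ rnZ_real mulrC ger0_norm ?Re_norm_ge0 // ler_pM2r //; apply: sup_upper_bound; last first.
  by exists ((rn x)^-1%:C *: x).
have [M AM] := bounded_op_bounded A.
split; first by exists (rn (A 0)), 0; rewrite //= normr0.
exists `|M| => _ [y y1 <-]; move: (AM y); rewrite Re_norm_le => h.
apply: le_trans h _; rewrite (@le_trans _ _ (`|M| * rn y)) //.
  by rewrite ler_wpM2r ?Re_norm_ge0 // ler_norm.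
by rewrite ler_piMr // -norm_le1.
Qed.

Lemma op_ext A B : (forall z y, inner z (A y) = inner z (B y)) -> A = B.
Proof. by move=> AB; apply: bounded_opP => y; apply: inner_extr => z. Qed.

(** [adj] is a choice by [xget], so the property rests on existence: Riesz gives the adjoint
    pointwise, definiteness makes it linear, and |B z|^2 = <z, A B z> bounds it by the constant of
    [A]. *)
Lemma adjP A x y : inner (adj A x) y = inner x (A y).
Proof.
have [M AM] := bounded_op_bounded A.
have AM' z : rn (A z) <= M * rn z by rewrite -Re_norm_le.
have Ax z : exists t, forall y, inner z (A y) = inner t y.
  apply: (@riesz R H _ (rn z * M)) => [a u v|u].
    by rewrite linearP innerDr innerZr.
  apply: le_trans (cauchy_schwarz _ _) _; rewrite rmorphM /= -mulrA Re_norm_real.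
  by rewrite ler_wpM2l // AM.
have [B BP] := choice Ax.
have Bl : linear B.
  move=> a u v; apply: inner_extr => z; rewrite [LHS]innerC [RHS]innerC; congr (_^*).
  by rewrite -BP !innerE -!BP.
have BM z : `|B z| <= M%:C * `|z|.
  rewrite Re_norm_le; have [Bz|Bz] := eqVneq (B z) 0.
    by rewrite Bz normr0 (le_trans _ (AM' z)) // Re_norm_ge0.
  have Bz0 : 0 < rn (B z) by rewrite -ltcR Re_norm_real normr_gt0.
  rewrite -(ler_pM2r Bz0) -expr2 rn_sqr -BP.
  apply: le_trans (ler_norm _) _; apply: le_trans (Re_inner_le _ _) _.
  by rewrite mulrC [leRHS]mulrAC ler_wpM2r ?Re_norm_ge0.
have Bb : B \in @bounded_linear_pred R H by apply/asboolP; split; [|exists M].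
have : exists B : bounded_op H, forall x y, inner (B x) y = inner x (A y).
  by exists (BoundedOp Bb) => u v /=; rewrite -BP.
by move=> /(@xgetPex _ 0 [set B : bounded_op H | forall x y, inner (B x) y = inner x (A y)]).
Qed.

Lemma adjPr A x y : inner x (adj A y) = inner (A x) y.
Proof. by rewrite innerC adjP -innerC. Qed.

Lemma adj_unique A B : (forall x y, inner (B x) y = inner x (A y)) -> adj A = B.
Proof. by move=> BA; apply: op_ext => z y; rewrite adjPr [RHS]innerC BA -innerC. Qed.

Lemma adjD A B : adj (A + B) = adj A + adj B.
Proof.
apply: adj_unique => x y.
by rewrite -[LHS]/(inner (adj A x + adj B x) y) innerDl !adjP -innerDr.
Qed.

Lemma adjZ a A : adj (a *: A) = a^* *: adj A.
Proof.
apply: adj_unique => x y.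
by rewrite -[LHS]/(inner (a^* *: adj A x) y) innerZl conjCK adjP -innerZr.
Qed.

Lemma adj_norm_le A x : rn (adj A x) <= rn A * rn x.
Proof.
have [Bz|Bz] := eqVneq (adj A x) 0.
  by rewrite Bz normr0 (le_trans _ (op_norm_le A x)) // Re_norm_ge0.
have Bz0 : 0 < rn (adj A x) by rewrite -ltcR Re_norm_real normr_gt0.
rewrite -(ler_pM2r Bz0) -expr2 rn_sqr adjP.
apply: le_trans (ler_norm _) _; apply: le_trans (Re_inner_le _ _) _.
by rewrite mulrC [leRHS]mulrAC ler_wpM2r ?Re_norm_ge0 // op_norm_le.
Qed.

Fact dyad_subproof x y : (fun z => inner y z *: x) \in @bounded_linear_pred R H.
Proof.
apply/asboolP; split=> [a u v|]; first by rewrite innerDr innerZr scalerDl scalerA.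
exists (rn x * rn y) => z; rewrite normrZ mulrC rmorphM /= !Re_norm_real -mulrA.
by rewrite ler_wpM2l // cauchy_schwarz.
Qed.

Definition dyad x y := BoundedOp (dyad_subproof x y).

Lemma dyadE x y z : dyad x y z = inner y z *: x. Proof. by []. Qed.

Lemma inner_dyad x y z t : inner z (dyad x y t) = inner y t * inner z x.
Proof. by rewrite innerZr. Qed.

Lemma op_addE A B x : (A + B) x = A x + B x. Proof. by []. Qed.
Lemma op_oppE A x : (- A) x = - A x. Proof. by []. Qed.
Lemma op_mulE A B x : (A * B) x = A (B x). Proof. by []. Qed.
Lemma op_scaleE a A x : (a *: A) x = a *: A x. Proof. by []. Qed.
Lemma op_zeroE x : (0 : bounded_op H) x = 0. Proof. by []. Qed.

Definition opE := (dyadE, op_addE, op_oppE, op_mulE, op_scaleE, op_zeroE).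

Lemma dyadDl x x' y : dyad (x + x') y = dyad x y + dyad x' y.
Proof. by apply: bounded_opP => z; rewrite !opE scalerDr. Qed.

Lemma dyadDr x y y' : dyad x (y + y') = dyad x y + dyad x y'.
Proof. by apply: bounded_opP => z; rewrite !opE innerDl scalerDl. Qed.

Lemma dyadZl a x y : dyad (a *: x) y = a *: dyad x y.
Proof. by apply: bounded_opP => z; rewrite !opE !scalerA mulrC. Qed.

Lemma dyadZr a x y : dyad x (a *: y) = a^* *: dyad x y.
Proof. by apply: bounded_opP => z; rewrite !opE innerZl !scalerA. Qed.

Lemma dyad_norm_le x y : rn (dyad x y) <= rn x * rn y.
Proof.
apply: bound_op_le => [|z]; first by rewrite mulr_ge0 ?Re_norm_ge0.
rewrite dyadE Re_normZ mulrC -mulrA ler_wpM2l ?Re_norm_ge0 //.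
by rewrite -lecR rmorphM /= !Re_norm_real cauchy_schwarz.
Qed.

Lemma adj_dyad x y : adj (dyad x y) = dyad y x.
Proof. by apply: adj_unique => z t; rewrite !opE innerZl innerZr -innerC mulrC. Qed.

Lemma op_mul_dyad A x y : A * dyad x y = dyad (A x) y.
Proof. by apply: bounded_opP => z; rewrite !opE linearZ. Qed.

Lemma dyad_mul_op A x y : dyad x y * A = dyad x (adj A y).
Proof. by apply: bounded_opP => z; rewrite !opE adjP. Qed.

Lemma op_scaleAl a A B : (a *: A) * B = a *: (A * B).
Proof. exact: bounded_opP. Qed.

Lemma op_scaleAr a A B : A * (a *: B) = a *: (A * B).
Proof. by apply: bounded_opP => z; rewrite !opE linearZ. Qed.

(** The predicate [S] keeps the orthonormal family inside a subspace, which matters when the trace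
    of an idempotent is computed from a basis of its range. Indexing by [nat] lets the family be
    extended without changing its type. *)
Lemma gram_schmidt (S : H -> Prop) (s : seq H) :
  (forall a x y, S x -> S y -> S (a *: x + y)) -> (forall x, x \in s -> S x) ->
  exists (n : nat) (g : nat -> H),
    [/\ forall i j, (i < n)%N -> (j < n)%N -> inner (g i) (g j) = (i == j)%:R,
        forall i, (i < n)%N -> S (g i)
      & forall x, x \in s -> x = \sum_(i < n) inner (g i) x *: g i].
Proof.
move=> Sl; elim: s => [|x s IHs] Ss; first by exists 0%N, (fun=> 0).
have [t ts|n [g [go gS gs]]] := IHs; first by apply: Ss; rewrite inE ts orbT.
pose r := x - \sum_(i < n) inner (g i) x *: g i.
have gr i : (i < n)%N -> inner (g i) r = 0.
  move=> i_n; rewrite innerBr inner_sumr (bigD1 (Ordinal i_n)) //= innerZr go // eqxx mulr1.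
  rewrite big1 ?addr0 ?subrr // => j ji; rewrite innerZr go //.
  rewrite (_ : (i == j) = false) ?mulr0 //; apply: contra_neqF ji => /eqP ij.
  exact/val_inj.
have [r0|r0] := eqVneq r 0.
  exists n, g; split=> // y; rewrite inE => /predU1P[->|/gs//].
  by apply/eqP; rewrite -subr_eq0; apply/eqP.
(* [S] may be empty when the list is, so 0 is obtained from the vector at hand. *)
have S0 : S 0.
  have Sx : S x by apply: Ss; rewrite inE eqxx.
  by have := Sl (-1) _ _ Sx Sx; rewrite scaleN1r addNr.
have SZ a y : S y -> S (a *: y) by move=> Sy; rewrite -[_ *: _]addr0; exact: (Sl).
have Sr : S r.
  rewrite /r -[x]opprK -opprD -scaleN1r; apply: (SZ); rewrite -scaleN1r; apply: (Sl).
    by apply: Ss; rewrite inE eqxx.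
  elim/big_ind: _ => // [u v Su Sv|i _]; last by apply: (SZ); exact: gS.
  by rewrite -[u]scale1r; exact: (Sl).
have R0 : rn r != 0 by apply: contra_neq r0; exact: Re_norm0_eq0.
pose e := (rn r)^-1%:C *: r.
have ee : inner e e = 1.
  by rewrite innerZl innerZr inner_norm conj_real -!rmorphM /= mulrA -expr2 -exprMn mulVf // expr1n.
have ge i : (i < n)%N -> inner (g i) e = 0 by move=> i_n; rewrite /e innerZr gr // mulr0.
have eg i : (i < n)%N -> inner e (g i) = 0 by move=> i_n; rewrite innerC ge // rmorph0.
pose g' i := if i == n then e else g i.
have g'g i : (i < n)%N -> g' i = g i by rewrite /g'; case: ltngtP.
have g'n : g' n = e by rewrite /g' eqxx.
exists n.+1, g'; split.
- have lt i : (i < n.+1)%N -> i = n \/ (i < n)%N.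
    by rewrite ltnS leq_eqVlt => /predU1P.
  move=> i j /lt[->|i_n] /lt[->|j_n].
  + by rewrite g'n eqxx.
  + by rewrite g'n g'g // (gtn_eqF j_n) eg.
  + by rewrite g'n g'g // (ltn_eqF i_n) ge.
  + by rewrite !g'g // go.
- move=> i; rewrite ltnS leq_eqVlt => /predU1P[->|i_n]; last by rewrite g'g //; exact: gS.
  by rewrite g'n; exact: SZ.
- move=> y; rewrite big_ord_recr /= g'n.
  have -> : \sum_(i < n) inner (g' i) y *: g' i = \sum_(i < n) inner (g i) y *: g i.
    by apply: eq_bigr => i _; rewrite g'g.
  rewrite inE => /predU1P[->|ys].
    have xe : inner e x = (rn r)%:C.
      have -> : x = r + \sum_(i < n) inner (g i) x *: g i by rewrite subrK.
      rewrite innerDr inner_sumr big1 ?addr0 => [|i _].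
        by rewrite /e innerZl conj_real inner_norm -rmorphM /= expr2 mulKf.
      by rewrite innerZr eg // mulr0.
    by rewrite xe scalerA -rmorphM /= divff // scale1r addrC subrK.
  rewrite -(gs y ys) (_ : inner e y = 0) ?scale0r ?addr0 //.
  rewrite (gs y ys) inner_sumr big1 // => i _.
  by rewrite innerZr eg // mulr0.
Qed.

End OperatorTheory.

(** * The trace of a finite-rank operator *)

Section Trace.
Variables (R : realType) (H : hilbertType R).
Implicit Types (A B C : bounded_op H) (x y z : H) (a : R[i]) (s : seq (H * H)).

Local Notation rn x := (complex.Re `|x|).

Definition dyads s : bounded_op H := \sum_(p <- s) dyad p.1 p.2.

Lemma op_sumE (I : Type) (r : seq I) (F : I -> bounded_op H) x :
  (\sum_(i <- r) F i) x = \sum_(i <- r) F i x.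
Proof. by apply: (big_morph (fun A : bounded_op H => A x)). Qed.

Lemma mul_dyads A s : A * dyads s = dyads [seq (A p.1, p.2) | p <- s].
Proof. by rewrite /dyads mulr_sumr big_map; apply: eq_bigr => p _; exact: op_mul_dyad. Qed.

Lemma dyads_mul A s : dyads s * A = dyads [seq (p.1, adj A p.2) | p <- s].
Proof. by rewrite /dyads mulr_suml big_map; apply: eq_bigr => p _; exact: dyad_mul_op. Qed.

Lemma span_dyads s : exists (n : nat) (e : nat -> H),
  (forall i j, (i < n)%N -> (j < n)%N -> inner (e i) (e j) = (i == j)%:R) /\
  forall p, p \in s -> p.1 = \sum_(i < n) inner (e i) p.1 *: e i.
Proof.
have [//|//|n [e [eo _ es]]] := @gram_schmidt R H (fun=> True) (map fst s).
by exists n, e; split=> // p ps; apply: es; exact: map_f.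
Qed.

(** This is the independence of the trace from the sum of dyads chosen to represent an operator.
    Expanding the first factors in a common orthonormal family turns the sum into diagonal entries
    of the operator, which is zero. *)
Lemma dyads_eq0_trace s : dyads s = 0 -> \sum_(p <- s) inner p.2 p.1 = 0.
Proof.
move=> s0; have [n [e [_ es]]] := span_dyads s.
transitivity (\sum_(p <- s) \sum_(i < n) inner (e i) p.1 * inner p.2 (e i)).
  by rewrite !big_seq; apply: eq_bigr => p /es {1}->; rewrite inner_sumr;
    apply: eq_bigr => i _; rewrite innerZr.
rewrite exchange_big big1 // => i _.
transitivity (inner (e i) (dyads s (e i))); last by rewrite s0 opE inner0r.
by rewrite /dyads op_sumE inner_sumr; apply: eq_bigr => p _; rewrite inner_dyad mulrC.
Qed.

Lemma is_trace_dyads s t : is_trace (dyads s) t -> t = \sum_(p <- s) inner p.2 p.1.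
Proof.
move=> [n [e [eo es ->]]]; pose P x := \sum_(i < n) inner (e i) x *: e i.
(* [P] is the orthogonal projection onto the span of [e], which contains the range of the operator;
   composing with [1 - P] gives zero, and the preceding lemma compares the two traces. *)
have P0 : dyads [seq (p.1 - P p.1, p.2) | p <- s] = 0.
  apply: bounded_opP => z; rewrite /dyads big_map op_sumE opE.
  transitivity (dyads s z - P (dyads s z)); last first.
    by apply/eqP; rewrite subr_eq0; apply/eqP; exact: es.
  rewrite /P /dyads op_sumE; under [X in _ - X]eq_bigr do rewrite inner_sumr scaler_suml.
  rewrite exchange_big -sumrB; apply: eq_bigr => p _; rewrite !dyadE scalerBr; congr (_ - _).
  by rewrite scaler_sumr; apply: eq_bigr => i _; rewrite innerZr scalerA.
apply/eqP; rewrite eq_sym -subr_eq0; apply/eqP.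
rewrite -[RHS](dyads_eq0_trace P0) big_map.
have -> : \sum_(i < n) inner (e i) (dyads s (e i)) = \sum_(p <- s) inner p.2 (P p.1).
  rewrite /dyads; under eq_bigr do rewrite op_sumE inner_sumr.
  rewrite exchange_big; apply: eq_bigr => p _; rewrite /P inner_sumr.
  by apply: eq_bigr => i _; rewrite inner_dyad innerZr mulrC.
by rewrite -sumrB; apply: eq_bigr => p _; rewrite innerBr.
Qed.

Lemma finite_rank_basis (S : H -> Prop) A n (e : 'I_n -> H) :
  (forall a x y, S x -> S y -> S (a *: x + y)) -> (forall i, S (e i)) ->
  (forall x, exists c : 'I_n -> R[i], A x = \sum_(i < n) c i *: e i) ->
  exists (m : nat) (g : nat -> H),
    [/\ forall i j, (i < m)%N -> (j < m)%N -> inner (g i) (g j) = (i == j)%:R,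
        forall i, (i < m)%N -> S (g i)
      & forall x, A x = \sum_(i < m) inner (g i) (A x) *: g i].
Proof.
move=> Sl Se eA; have [_ /mapP[i _ ->]//|m [g [go gS gs]]] :=
  @gram_schmidt R H S (map e (enum 'I_n)) Sl.
exists m, g; split=> // x; have [c Ax] := eA x.
rewrite {1}Ax; transitivity (\sum_(i < n) c i *: \sum_(j < m) inner (g j) (e i) *: g j).
  by apply: eq_bigr => i _; rewrite -gs // map_f // mem_enum.
under eq_bigr do rewrite scaler_sumr.
rewrite exchange_big; apply: eq_bigr => j _; rewrite Ax inner_sumr scaler_suml.
by apply: eq_bigr => i _; rewrite scalerA innerZr.
Qed.

Lemma basis_dyads A m (g : nat -> H) :
  (forall x, A x = \sum_(i < m) inner (g i) (A x) *: g i) ->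
  A = dyads [seq (g i, adj A (g i)) | i <- iota 0 m].
Proof.
move=> Ag; apply: bounded_opP => x; rewrite /dyads big_map op_sumE Ag.
rewrite -(big_mkord xpredT (fun i => inner (g i) (A x) *: g i)) /index_iota subn0.
by apply: eq_bigr => i _; rewrite dyadE adjP.
Qed.

Lemma dyads_finite_rank s : finite_rank (dyads s).
Proof.
exists (size s), (fun i => (nth (0, 0) s i).1) => x.
exists (fun i => inner (nth (0, 0) s i).2 x).
by rewrite /dyads op_sumE (big_nth (0, 0)) big_mkord.
Qed.

Lemma tr_dyads s : tr (dyads s) = \sum_(p <- s) inner p.2 p.1.
Proof.
apply: is_trace_dyads; apply: xgetPex; have [n [e sA]] := dyads_finite_rank s.
have [//|//|m [g [go _ gs]]] := @finite_rank_basis (fun=> True) _ n e _ _ sA.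
by eexists; exists m, (fun i : 'I_m => g i); split=> // i j; exact: go.
Qed.

Definition dyadic A := exists s, A = dyads s.

Lemma dyadic_dyad x y : dyadic (dyad x y).
Proof. by exists [:: (x, y)]; rewrite /dyads big_seq1. Qed.

Lemma dyadicD A B : dyadic A -> dyadic B -> dyadic (A + B).
Proof. by move=> [s ->] [t ->]; exists (s ++ t); rewrite /dyads big_cat. Qed.

Lemma dyadicMl A B : dyadic B -> dyadic (A * B).
Proof. by move=> [s ->]; eexists; exact: mul_dyads. Qed.

Lemma dyadicMr A B : dyadic A -> dyadic (A * B).
Proof. by move=> [s ->]; eexists; exact: dyads_mul. Qed.

Lemma tr_dyad x y : tr (dyad x y) = inner y x.
Proof.
have -> : dyad x y = dyads [:: (x, y)] by rewrite /dyads big_seq1.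
by rewrite tr_dyads big_seq1.
Qed.

Lemma tr0 : tr (0 : bounded_op H) = 0.
Proof.
have -> : 0 = dyads [::] by rewrite /dyads big_nil.
by rewrite tr_dyads big_nil.
Qed.

Lemma trD A B : dyadic A -> dyadic B -> tr (A + B) = tr A + tr B.
Proof.
move=> [s ->] [t ->].
have -> : dyads s + dyads t = dyads (s ++ t) by rewrite /dyads big_cat.
by rewrite !tr_dyads big_cat.
Qed.

Lemma tr_mulC A B : dyadic A -> tr (B * A) = tr (A * B).
Proof.
move=> [s ->]; rewrite mul_dyads dyads_mul !tr_dyads !big_map.
by apply: eq_bigr => p _; rewrite adjP.
Qed.

Lemma trZ a A : dyadic A -> tr (a *: A) = a * tr A.
Proof.
move=> [s ->].
have -> : a *: dyads s = dyads [seq (a *: p.1, p.2) | p <- s].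
  by rewrite /dyads scaler_sumr big_map; apply: eq_bigr => p _; rewrite dyadZl.
by rewrite !tr_dyads big_map mulr_sumr; apply: eq_bigr => p _; rewrite innerZr.
Qed.

(** In an orthonormal family spanning a space that contains the range of [A], the coordinates of
    [A x] are <adj A g_i, x>. Cauchy-Schwarz bounds each of them, and the sum of the |adj A g_i|^2
    is tr (A adj A) = tr (adj A A). *)
Lemma hs_bound A x : dyadic A -> (rn (A x) ^+ 2)%:C <= tr (adj A * A) * (rn x ^+ 2)%:C.
Proof.
move=> dA; have [s As] := dA; have [n [e eA]] := dyads_finite_rank s.
rewrite -As in eA.
have [//|//|m [g [go _ gs]]] := @finite_rank_basis (fun=> True) A n e _ _ eA.
have -> : tr (adj A * A) = \sum_(i < m) (rn (adj A (g i)) ^+ 2)%:C.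
  rewrite tr_mulC // {1}(basis_dyads gs) dyads_mul tr_dyads !big_map -(big_mkord xpredT
    (fun i => (rn (adj A (g i)) ^+ 2)%:C)) /index_iota subn0.
  by apply: eq_bigr => i _; rewrite /= adjP inner_norm.
rewrite -inner_norm {2}gs inner_sumr mulr_suml; apply: ler_sum => i _.
rewrite innerZr [inner (A x) _]innerC -adjP -sqr_normc -!rmorphM /= -exprMn.
rewrite rmorphXn /= ler_pXn2r // ?nnegrE ?ler0c ?mulr_ge0 ?Re_norm_ge0 //.
by rewrite rmorphM /= !Re_norm_real cauchy_schwarz.
Qed.

Lemma projectionP (q : bounded_op H) : projections q <-> q * q = q /\ is_line (range q).
Proof.
split=> [[qq qf q1]|[qq [v v0 qv]]].
  split=> //; have qqE x : q (q x) = q x by rewrite -[in RHS]qq.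
  have [n [e eq]] := qf.
  (* Applying [q] moves the spanning vectors into the range of [q], so that the orthonormal basis
     consists of fixed vectors. *)
  have qe x : exists c : 'I_n -> R[i], q x = \sum_(i < n) c i *: q (e i).
    have [c qx] := eq x; exists c.
    by rewrite -qqE {1}qx linear_sum; apply: eq_bigr => i _; rewrite linearZ.
  have [a x y [t _ <-] [u _ <-]|i|m [g [go gS gs]]] := @finite_rank_basis (range q) q n _ _ _ qe.
  - by exists (a *: t + u) => //; rewrite linearP.
  - by exists (e i).
  have qg i : (i < m)%N -> q (g i) = g i by move=> /gS[t _ <-].
  (* The trace of an idempotent counts a basis of its range; in characteristic 0 its value
     determines the number [m]. *)
  have m1 : m = 1%N.
    suff trq : tr q = m%:R by apply/eqP; rewrite -(@eqr_nat R[i]) -trq q1.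
    rewrite [in tr q](basis_dyads gs) tr_dyads big_map.
    transitivity (\sum_(i <- iota 0 m) (1 : R[i])); last first.
      by rewrite -[in iota 0 m](subn0 m) -/(index_iota 0 m) sumr_const_nat subn0.
    rewrite !big_seq; apply: eq_bigr => i.
    by rewrite mem_iota add0n => /andP[_ im]; rewrite /= adjP qg // go // eqxx.
  move: go gS gs qg; rewrite m1 => go gS gs qg; exists (g 0%N).
    apply/eqP => g0; have := go 0%N 0%N isT isT; rewrite g0 inner0l eqxx => /eqP.
    by rewrite eq_sym oner_eq0.
  apply/seteqP; split=> [_ [x _ <-]|_ [a _ <-]].
    by rewrite gs big_ord1; exists (inner (g 0%N) (q x)).
  by exists (a *: g 0%N) => //; rewrite linearZ /= qg.
have vq x : exists a, q x = a *: v.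
  have : range q (q x) by exists x.
  by rewrite qv => -[a _ <-]; exists a.
have qf : finite_rank q.
  exists 1%N, (fun=> v) => x; have [a ->] := vq x.
  by exists (fun=> a); rewrite big_ord1.
split=> //.
have qv' : q v = v.
  have : range q v by rewrite qv; exists 1; rewrite ?scale1r.
  by move=> [x _ <-]; rewrite -[in RHS]qq.
have vv := inner_gt0 v0.
(* If [q x = a *: v], then [a = <v, q x> / <v, v>], which is the pairing of [x] with this second
   factor. *)
have qE : q = dyad v ((inner v v)^-1 *: adj q v).
  apply: bounded_opP => x; rewrite dyadE innerZl adjP rmorphV ?unitf_gt0 //=.
  have [a ->] := vq x; rewrite innerZr -innerC mulrCA mulVf ?gt_eqF //.
  by rewrite mulr1.
by rewrite qE tr_dyad innerZl adjP qv' rmorphV ?unitf_gt0 //= -innerC mulVf ?gt_eqF.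
Qed.

End Trace.

(** * Lifts of rank-one projections *)

Section RankOne.
Variables (R : realType) (H : hilbertType R).
Implicit Types (A B C q : bounded_op H) (x y z u w a b c d : H).

Local Notation rn x := (complex.Re `|x|).

Lemma dyadicN A : dyadic A -> dyadic (- A).
Proof.
move=> dA; suff -> : - A = (- 1%R) * A by exact: dyadicMl.
by rewrite mulN1r.
Qed.

Lemma trB A B : dyadic A -> dyadic B -> tr (A - B) = tr A - tr B.
Proof.
move=> dA dB; rewrite -scaleN1r trD ?trZ ?mulN1r //.
by rewrite scaleN1r; exact: dyadicN.
Qed.

Local Hint Resolve dyadic_dyad dyadicD : core.

Lemma conj_imag : ('i%C : R[i])^* = - 'i%C.
Proof. by apply/eqP; rewrite eq_complex /= oppr0 !eqxx. Qed.

Lemma mul_imag : ('i%C : R[i]) * 'i%C = - 1.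
Proof. by rewrite -expr2 sqr_i. Qed.

Lemma conj_inner x y : (inner x y)^* = inner y x.
Proof. by rewrite -innerC. Qed.

(* The differential at [(u, w)] of [(u, w) |-> dyad u w]. *)
Definition ddyad u w b a := dyad b w + dyad u a.

Lemma adj_ddyad u w b a : adj (ddyad u w b a) = ddyad w u a b.
Proof. by rewrite adjD !adj_dyad addrC. Qed.

Lemma ddyadic u w b a : dyadic (ddyad u w b a).
Proof. exact: dyadicD. Qed.

Lemma ddyadE u w b a x : ddyad u w b a x = inner w x *: b + inner a x *: u.
Proof. by []. Qed.

Lemma tr_mul_ddyad u w b a u' w' d c :
  tr (ddyad u w b a * ddyad u' w' d c) =
  inner w d * inner w' b + inner w u' * inner c b + inner a d * inner w' u + inner a u' * inner c u.
Proof.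
rewrite /ddyad mulrDl !mulrDr !op_mul_dyad !dyadE !trD ?tr_dyad ?innerZr; auto.
by rewrite !addrA.
Qed.

Lemma tr_ddyad_dyad u w b a x y :
  tr (ddyad u w b a * dyad x y) = inner w x * inner y b + inner a x * inner y u.
Proof. by rewrite /ddyad mulrDl !op_mul_dyad !dyadE !trD ?tr_dyad ?innerZr; auto. Qed.

Definition is_lift q u w := q = dyad u w /\ inner w u = 1.

Definition is_nlift q u w := [/\ q = dyad u w, inner w u = 1 & inner u u = inner w w].

Lemma nlift_lift q u w : is_nlift q u w -> is_lift q u w. Proof. by case. Qed.

Lemma lift_projection q u w : is_lift q u w -> projections q.
Proof.
move=> [-> wu]; split; last by rewrite tr_dyad.
  by rewrite op_mul_dyad dyadE wu scale1r.
by have [s ->] := dyadic_dyad u w; exact: dyads_finite_rank.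
Qed.

Lemma projection_lift q : projections q -> exists u w, is_lift q u w.
Proof.
move=> /projectionP[qq [v v0 qv]].
have vq x : exists a : R[i], q x = a *: v.
  have : range q (q x) by exists x.
  by rewrite qv => -[a _ <-]; exists a.
have qv' : q v = v.
  have : range q v by rewrite qv; exists 1; rewrite ?scale1r.
  by move=> [x _ <-]; rewrite -[in RHS]qq.
have vv : inner v v != 0 by rewrite gt_eqF // inner_gt0.
exists v, ((inner v v)^-1 *: adj q v); split.
  apply: bounded_opP => x; rewrite dyadE innerZl adjP fmorphV /= conj_inner.
  by have [a ->] := vq x; rewrite innerZr mulrCA mulVf // mulr1.
by rewrite innerZl adjP qv' fmorphV /= conj_inner mulVf.
Qed.

Lemma hsnorm_dyad u w : hsnorm (dyad u w) = rn u * rn w.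
Proof.
rewrite /hsnorm adj_dyad op_mul_dyad dyadE tr_dyad innerZr !inner_norm -rmorphM /=.
by rewrite -exprMn sqrtr_sqr ger0_norm // mulr_ge0 // Re_norm_ge0.
Qed.

Lemma nlift_hsnorm q u w : is_nlift q u w -> (hsnorm q)%:C = inner u u.
Proof.
move=> [-> _ uw]; rewrite hsnorm_dyad inner_norm; congr (_%:C); rewrite expr2; congr (_ * _).
move: uw; rewrite !inner_norm => /complexI/eqP.
by rewrite eqrXn2 ?Re_norm_ge0 // => /eqP.
Qed.

Lemma lift_neq0 q u w : is_lift q u w -> u != 0 /\ w != 0.
Proof.
move=> [_ wu]; split; apply: contra_eq_neq wu => ->.
  by rewrite inner0r eq_sym oner_neq0.
by rewrite inner0l eq_sym oner_neq0.
Qed.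

Lemma nlift_gt0 q u w : is_nlift q u w -> 0 < inner u u.
Proof. by move=> /nlift_lift/lift_neq0[u0 _]; exact: inner_gt0. Qed.

Lemma hsnorm_gt0 q : projections q -> 0 < hsnorm q.
Proof.
move=> /projection_lift[u [w [qE wu]]]; have [u0 w0] := lift_neq0 (conj qE wu).
by rewrite qE hsnorm_dyad mulr_gt0 // -ltcR Re_norm_real normr_gt0.
Qed.

Lemma lift_normalize q u w : is_lift q u w -> exists u' w', is_nlift q u' w'.
Proof.
move=> l; have [u0 w0] := lift_neq0 l; have [-> wu] := l.
have U : 0 < rn u by rewrite -ltcR Re_norm_real normr_gt0.
have W : 0 < rn w by rewrite -ltcR Re_norm_real normr_gt0.
(* Multiplying [u] by [r] and [w] by [r^-1] keeps the dyad; equal norms require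
   [r^2 = |w| / |u|]. *)
pose r := Num.sqrt (rn w / rn u); have r0 : 0 < r by rewrite sqrtr_gt0 divr_gt0.
exists (r%:C *: u), (r^-1%:C *: w); split.
- by rewrite dyadZl dyadZr conj_real scalerA -rmorphM /= divff ?gt_eqF // scale1r.
- by rewrite innerZl innerZr conj_real mulrA -rmorphM /= mulVf ?gt_eqF // mul1r.
- rewrite !innerZl !innerZr !conj_real !inner_norm -!rmorphM /=; congr (_%:C).
  rewrite !mulrA -!expr2 exprVn sqr_sqrtr ?divr_ge0 ?Re_norm_ge0 //.
  by field; rewrite !gt_eqF.
Qed.

Lemma projection_nlift q : projections q -> exists u w, is_nlift q u w.
Proof. by move=> /projection_lift[u [w /lift_normalize]]. Qed.

(** The second hypothesis is the differential of the equation <w, u> = 1. *)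
Lemma tangent_ddyad u w b a :
  inner w u = 1 -> inner w b + inner a u = 0 -> tangent (dyad u w) (ddyad u w b a).
Proof.
move=> wu ba; rewrite /tangent /= /ddyad mulrDl mulrDr !op_mul_dyad !dyadE wu scale1r.
rewrite dyadZl scale1r -[X in _ = X]addr0 -[X in _ = _ + X](scale0r (dyad u w)) -ba.
rewrite scalerDl dyadZl [dyad b w + _ *: _]addrC addrACA [dyad u a + _]addrC.
by rewrite addrC.
Qed.

(** The pair [(b, a)] representing a tangent vector is determined up to the vertical direction
    [(k *: u, - k^* *: w)]. Evaluating the tangent equation at [u = q u] gives [q (A u) = 0], which
    singles out the representative with both pairings zero. *)
Lemma tangent_lift q u w A : is_lift q u w -> tangent q A ->
  A = ddyad u w (A u) (adj A w) /\ inner w (A u) = 0.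
Proof.
move=> [qE wu] qA; have qu : q u = u by rewrite qE dyadE wu scale1r.
have AE : q * A + A * q = A by exact: qA.
have : q (A u) = 0.
  have : q (q (A u)) + q (A (q u)) = q (A u) by rewrite -linearD -[in RHS]AE.
  rewrite qu (_ : q (q (A u)) = q (A u)); last by rewrite qE !dyadE innerZr wu mulr1.
  by move=> h; apply: (addrI (q (A u))); rewrite addr0.
rewrite qE dyadE => h; split.
  by rewrite /ddyad -{1}AE qE dyad_mul_op op_mul_dyad addrC.
have [u0 _] := lift_neq0 (conj qE wu).
by move/eqP: h; rewrite scaler_eq0 (negPf u0) orbF => /eqP.
Qed.

Lemma tangent_ddyadP u w b a : inner w u = 1 -> tangent (dyad u w) (ddyad u w b a) ->
  inner w b + inner a u = 0.
Proof.
move=> wu /(@tangent_lift _ u w _ (conj erefl wu))[_].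
by rewrite ddyadE wu scale1r innerDr innerZr wu mulr1.
Qed.

End RankOne.

(** * Expressions of the tensors in a lift *)

Section Formulas.
Variables (R : realType) (H : hilbertType R).
Implicit Types (A B C q : bounded_op H) (x y z u w a b c d : H).

Local Notation rn x := (complex.Re `|x|).

Lemma hform_nlift q u w b a d c : is_nlift q u w ->
  hform q (ddyad u w b a) (ddyad u w d c) =
  inner b d + inner c a
  + (inner b u * inner c w + inner u d * inner w a) / inner u u
  - (inner b u + inner w a) * (inner u d + inner c w) / (2 * inner u u).
Proof.
move=> l; have [qE wu uw] := l; rewrite /hform (nlift_hsnorm l) adj_ddyad qE adj_dyad.
rewrite tr_mul_ddyad !tr_ddyad_dyad -uw.
have := nlift_gt0 l; move: (inner u u) => r r0.
by field; rewrite gt_eqF.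
Qed.

Lemma Omega_lift q u w b a d c : is_lift q u w ->
  inner w b + inner a u = 0 -> inner w d + inner c u = 0 ->
  Omega q (ddyad u w b a) (ddyad u w d c) = 'i%C * (inner a d - inner c b).
Proof.
move=> [-> wu] ba dc; rewrite /Omega /comm mulrBr.
have dy A A' : dyadic (dyad u w * (A * A')) by apply: dyadicMr; exact: dyadic_dyad.
rewrite trB //.
have t b1 a1 d1 c1 : inner w b1 + inner a1 u = 0 -> inner w d1 + inner c1 u = 0 ->
    tr (dyad u w * (ddyad u w b1 a1 * ddyad u w d1 c1)) = inner w b1 * inner w d1 + inner a1 d1.
  move=> e1 e2; rewrite -tr_mulC; last exact: dyadic_dyad.
  rewrite op_mul_dyad tr_dyad op_mulE !ddyadE wu scale1r !innerE wu.
  by rewrite -[inner c1 u](addKr (inner w d1)) e2 -[inner a1 u](addKr (inner w b1)) e1; ring.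
rewrite !t //; ring.
Qed.

(** With [r = |u|^2], the bracket of [q] with [adj A] leaves [i/r <w, a>] on [dyad u u] and
    [- i/r <b, u>] on [dyad w w]. The correction term, a multiple of [[q, adj q] = r (dyad u u -
    dyad w w)], replaces both coefficients by their mean [l]. *)
Lemma Jbold_nlift q u w b a : is_nlift q u w ->
  let l := 'i%C / (2 * inner u u) * (inner w a - inner b u) in
  Jbold q (ddyad u w b a) =
  ddyad u w (- 'i%C *: a + l *: w) (- 'i%C *: b + l^* *: u).
Proof.
move=> n /=; have [qE wu uw] := n; rewrite /Jbold (nlift_hsnorm n) adj_ddyad qE adj_dyad.
rewrite tr_ddyad_dyad /comm -uw.
have uu := nlift_gt0 n.
have uuC := conj_inner u u.
apply: op_ext => z y; rewrite !opE !innerE.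
rewrite !(rmorphM, rmorphD, rmorphN, rmorphB, fmorphV, conj_imag, conj_inner, conjCK, rmorph_nat).
rewrite /= conj_imag -uw; move: (inner u u) uu => r r0.
by field; rewrite gt_eqF.
Qed.

Lemma Jbold_tangent u w b a (l : R[i]) : inner w u = 1 -> inner u u = inner w w ->
  l = 'i%C / (2 * inner u u) * (inner w a - inner b u) ->
  inner w (- 'i%C *: a + l *: w) + inner (- 'i%C *: b + l^* *: u) u = 0.
Proof.
move=> wu uw le; rewrite !innerE.
rewrite !(rmorphN, rmorphM, conjCK) /= conj_imag -uw le.
have u0 : u != 0 by apply: contra_eq_neq wu => ->; rewrite inner0r eq_sym oner_neq0.
have := inner_gt0 u0; move: (inner u u) => r r0.
by field; rewrite gt_eqF.
Qed.

Lemma Jbold_nlift_sqr q u w b a : is_nlift q u w -> inner w b + inner a u = 0 ->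
  Jbold q (Jbold q (ddyad u w b a)) = - ddyad u w b a.
Proof.
move=> n ba; have [qE wu uw] := n; rewrite (Jbold_nlift _ _ n) (Jbold_nlift _ _ n).
set l := 'i%C / _ * _.
(* By the constraint the multiplier of the second application vanishes. What the first one leaves,
   [(- i l^* u, - i l w)], is vertical and cancels. *)
have -> : inner w (- 'i%C *: b + l^* *: u) - inner (- 'i%C *: a + l *: w) u = 0.
  rewrite !innerE !(rmorphN, rmorphM, conjCK) /= conj_imag wu.
  by rewrite -[inner a u](addKr (inner w b)) ba; ring.
rewrite mulr0 rmorph0 !scale0r !addr0.
apply: op_ext => z y; rewrite !opE !innerE.
rewrite !(rmorphN, rmorphM, rmorphD, conjCK) /= conj_imag.
have i2 := mul_imag R.
by ring: i2.
Qed.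

Lemma hform_Jbold q u w b a d c : is_nlift q u w ->
  inner w b + inner a u = 0 -> inner w d + inner c u = 0 ->
  hform q (Jbold q (ddyad u w b a)) (ddyad u w d c) = Omega q (ddyad u w b a) (ddyad u w d c).
Proof.
move=> n ba dc; have [qE wu uw] := n.
rewrite (Omega_lift (nlift_lift n)) // (Jbold_nlift _ _ n) (hform_nlift _ _ _ _ n).
set l := 'i%C / _ * _; clearbody l; rewrite !innerE !(rmorphN, rmorphM, conjCK) /= conj_imag wu.
have uu := nlift_gt0 n; move: (inner u u) uu => r r0.
have -> : inner c u = - inner w d by rewrite -[LHS](addKr (inner w d)) dc addr0.
have -> : inner a u = - inner w b by rewrite -[LHS](addKr (inner w b)) ba addr0.
by field; rewrite gt_eqF.
Qed.

Lemma Jthird_lift u w b a : inner w u = 1 ->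
  Jthird (dyad u w) (ddyad u w b a) =
  ddyad u w ('i%C *: b) ('i%C *: a) + ('i%C * (inner a u - inner w b)) *: dyad u w.
Proof.
move=> wu; apply: op_ext => z y; rewrite /Jthird /comm /ddyad !opE !innerE.
rewrite conj_imag wu; ring.
Qed.

(** The normalisation enters here: when the real parts agree, the two rational terms of
    [hform_nlift] have the same imaginary part. *)
Lemma Im_hform q u w b a d c : is_nlift q u w ->
  complex.Re (inner u b) = complex.Re (inner w a) ->
  complex.Re (inner u d) = complex.Re (inner w c) ->
  complex.Im (hform q (ddyad u w b a) (ddyad u w d c))
  = complex.Im (inner b d) - complex.Im (inner a c).
Proof.
move=> n; rewrite (hform_nlift _ _ _ _ n); have := nlift_gt0 n; rewrite inner_norm => /=.
move: (rn u ^+ 2) => r; rewrite (ltcR 0 r) => r0.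
have e1 : (r%:C)^-1 = (r^-1)%:C by rewrite fmorphV.
have e2 : (2 * r%:C)^-1 = ((2 * r)^-1)%:C.
  by rewrite fmorphV; congr (_^-1); rewrite rmorphM rmorph_nat.
rewrite e1 e2 (innerC b u) (innerC c w) (innerC c a).
move: (inner u b) (inner w a) (inner u d) (inner w c) (inner b d) (inner a c).
move=> [b1 b2] [a1 a2] [d1 d2] [c1 c2] [k1 k2] [f1 f2] /= -> ->.
by field; rewrite gt_eqF.
Qed.

End Formulas.

Section Tensors.
Variables (R : realType) (H : hilbertType R).
Implicit Types (A B C D q : bounded_op H) (x y z u w b d : H) (a : R[i]).

Local Notation rn x := (complex.Re `|x|).

Lemma tangentZD q a A B : tangent q A -> tangent q B -> tangent q (a *: A + B).
Proof.
move=> qA qB; rewrite /tangent /= mulrDl mulrDr op_scaleAl op_scaleAr addrACA -scalerDr.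
by rewrite [q * A + A * q]qA [q * B + B * q]qB.
Qed.

Lemma tangent0 q : tangent q (0 : bounded_op H).
Proof. by rewrite /tangent /= mulr0 mul0r addr0. Qed.

Lemma tangentZ q a A : tangent q A -> tangent q (a *: A).
Proof. by move=> qA; rewrite -[_ *: _]addr0; apply: tangentZD => //; exact: tangent0. Qed.

Lemma tangentN q A : tangent q A -> tangent q (- A).
Proof. by move=> qA; rewrite -scaleN1r; exact: tangentZ. Qed.

Lemma tangentD q A B : tangent q A -> tangent q B -> tangent q (A + B).
Proof. by move=> qA qB; rewrite -[A]scale1r; exact: tangentZD. Qed.

Lemma tangent_constraint q u w A : is_lift q u w -> tangent q A ->
  inner w (A u) + inner (adj A w) u = 0.
Proof. by move=> l /(tangent_lift l)[_ Au]; rewrite adjP Au addr0. Qed.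

Lemma hform_tangent q u w A B : is_nlift q u w -> tangent q A -> tangent q B ->
  hform q A B = inner (A u) (B u) + inner (adj B w) (adj A w)
  + (inner (A u) u * inner (adj B w) w + inner u (B u) * inner w (adj A w)) / inner u u
  - (inner (A u) u + inner w (adj A w)) * (inner u (B u) + inner (adj B w) w) / (2 * inner u u).
Proof.
move=> n qA qB; have l := nlift_lift n.
rewrite {1}(tangent_lift l qA).1 {1}(tangent_lift l qB).1.
exact: hform_nlift.
Qed.

Lemma hformZDr q a A B C : projections q -> tangent q A -> tangent q B -> tangent q C ->
  hform q C (a *: A + B) = a * hform q C A + hform q C B.
Proof.
move=> /projection_nlift[u [w n]] qA qB qC.
rewrite !(hform_tangent n) //; last exact: tangentZD.
rewrite adjD adjZ !opE !innerE conjCK.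
have := nlift_gt0 n; move: (inner u u) => r r0.
by field; rewrite gt_eqF.
Qed.

Lemma hform_conj q A B : projections q -> tangent q A -> tangent q B ->
  hform q B A = (hform q A B)^*.
Proof.
move=> /projection_nlift[u [w n]] qA qB; rewrite !(hform_tangent n) //.
rewrite !(rmorphM, rmorphD, rmorphN, fmorphV, rmorph_nat) /= !conj_inner.
have := nlift_gt0 n; move: (inner u u) => r r0.
by field; rewrite gt_eqF.
Qed.

Lemma hformZDl q a A B C : projections q -> tangent q A -> tangent q B -> tangent q C ->
  hform q (a *: A + B) C = a^* * hform q A C + hform q B C.
Proof.
move=> pq qA qB qC; rewrite (hform_conj pq qC (tangentZD a qA qB)) (hform_conj pq qC qA).
by rewrite (hform_conj pq qC qB) hformZDr // rmorphD rmorphM.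
Qed.

Lemma Omega_tangent q u w A B : is_lift q u w -> tangent q A -> tangent q B ->
  Omega q A B = 'i%C * (inner (adj A w) (B u) - inner (adj B w) (A u)).
Proof.
move=> l qA qB.
rewrite {1}(tangent_lift l qA).1 {1}(tangent_lift l qB).1.
by apply: Omega_lift => //; exact: (tangent_constraint l).
Qed.

Lemma OmegaZDr q a A B C : projections q -> tangent q A -> tangent q B -> tangent q C ->
  Omega q C (a *: A + B) = a * Omega q C A + Omega q C B.
Proof.
move=> /projection_lift[u [w l]] qA qB qC.
rewrite !(Omega_tangent l) //; last exact: tangentZD.
rewrite adjD adjZ !opE !innerE conjCK; ring.
Qed.

Lemma Omega_antisym q A B : projections q -> tangent q A -> tangent q B ->
  Omega q B A = - Omega q A B.
Proof.
by move=> /projection_lift[u [w l]] qA qB; rewrite !(Omega_tangent l) // -mulrN opprB.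
Qed.

Lemma OmegaZDl q a A B C : projections q -> tangent q A -> tangent q B -> tangent q C ->
  Omega q (a *: A + B) C = a * Omega q A C + Omega q B C.
Proof.
move=> pq qA qB qC; rewrite (Omega_antisym pq qC (tangentZD a qA qB)).
by rewrite (Omega_antisym pq qC qA) (Omega_antisym pq qC qB) OmegaZDr // mulrN opprD.
Qed.

Lemma tangent_dyadic q A : projections q -> tangent q A -> dyadic A.
Proof. by move=> /projection_lift[u [w l]] /(tangent_lift l)[-> _]; exact: ddyadic. Qed.

Lemma hs_norm_le A : dyadic A -> (rn A ^+ 2)%:C <= tr (adj A * A).
Proof.
move=> dA; have hs x := hs_bound x dA.
(* Nonnegativity in [R[i]] includes being real; it is read off from [hs_bound] at a nonzero vector,
   which exists unless [A = 0]. *)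
have tge : 0 <= tr (adj A * A).
  have [A0|A0] := eqVneq A 0; first by rewrite A0 mulr0 tr0.
  have [x x0] : exists x, A x != 0.
    apply: contrapT => h; case/eqP: A0; apply: bounded_opP => x.
    by apply/eqP; apply: contrapT => /negP Ax; apply: h; exists x.
  have xx : (0 : R[i]) < (rn x ^+ 2)%:C.
    rewrite (ltcR 0) exprn_gt0 // -ltcR Re_norm_real normr_gt0.
    by apply: contra_neq x0 => ->; rewrite linear0.
  by rewrite -(pmulr_lge0 _ xx); apply: le_trans (hs x); rewrite (lecR 0) sqr_ge0.
pose t := complex.Re (tr (adj A * A)).
have trr : tr (adj A * A) = t%:C by rewrite RRe_real // ger0_real.
have t0 : 0 <= t by rewrite -(lecR 0) -trr.
rewrite trr.
rewrite lecR -[t]sqr_sqrtr // ler_pXn2r ?nnegrE ?Re_norm_ge0 ?sqrtr_ge0 //.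
apply: bound_op_le => [|x]; first exact: sqrtr_ge0.
have h : rn (A x) ^+ 2 <= (Num.sqrt t * rn x) ^+ 2.
  by rewrite exprMn sqr_sqrtr //; have := hs x; rewrite trr -rmorphM lecR.
move: h; by rewrite ler_pXn2r // ?nnegrE ?mulr_ge0 ?sqrtr_ge0 ?Re_norm_ge0.
Qed.

(** By Cauchy-Schwarz |tr (adj A q)|^2 is at most ||q||^2 tr (adj A A), so the negative term takes
    away at most half of the first one; the operator norm is then bounded by the Hilbert-Schmidt
    norm. *)
Lemma hform_pos q A : projections q -> tangent q A ->
  (rn A ^+ 2 / (2 * hsnorm q))%:C <= hform q A A.
Proof.
move=> pq qA; have [u [w n]] := projection_nlift pq; have [qE wu uw] := n.
have dA := tangent_dyadic pq qA.
have r0 := hsnorm_gt0 pq.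
have e1 : tr (adj A * q) = inner (A w) u by rewrite qE op_mul_dyad tr_dyad adjPr.
have e2 : tr (A * adj q) = inner u (A w) by rewrite qE adj_dyad op_mul_dyad tr_dyad.
rewrite /hform e1 e2.
have tle := hs_norm_le dA; have hs := hs_bound w dA.
have cs : inner (A w) u * inner u (A w) <= tr (adj A * A) * ((hsnorm q)%:C ^+ 2).
  rewrite [inner u (A w)]innerC -sqr_normc.
  apply: (@le_trans _ _ ((rn (A w) * rn u) ^+ 2)%:C).
    rewrite rmorphXn /= ler_pXn2r ?nnegrE //; last first.
      by rewrite (lecR 0) mulr_ge0 ?Re_norm_ge0.
    by rewrite rmorphM /= !Re_norm_real cauchy_schwarz.
  rewrite exprMn rmorphM /= (nlift_hsnorm n) expr2 mulrA {2}uw !inner_norm.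
  by rewrite mulrAC ler_wpM2r // (lecR 0) sqr_ge0.
move: (tr _) (_ * inner u (A w)) tle cs => t s tle cs.
have tE : t = (complex.Re t)%:C.
  by rewrite RRe_real //; apply: ger0_real; apply: le_trans tle; rewrite (lecR 0) sqr_ge0.
move: tle cs; rewrite tE -[(hsnorm q)%:C ^+ 2]rmorphXn -rmorphM /= lecR.
move=> tle cs; apply: (@le_trans _ _ ((hsnorm q)^-1 * complex.Re t
   - (2 * hsnorm q ^+ 3)^-1 * (complex.Re t * hsnorm q ^+ 2))%:C).
  rewrite lecR; set r := hsnorm q in r0 *.
  have -> : r^-1 * complex.Re t - (2 * r ^+ 3)^-1 * (complex.Re t * r ^+ 2)
     = complex.Re t / (2 * r) by field; rewrite gt_eqF.
  by rewrite ler_pM2r // invr_gt0 mulr_gt0.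
rewrite rmorphB !rmorphM !fmorphV rmorphM rmorphXn rmorph_nat /= lerD2l lerN2.
rewrite ler_wpM2l //; last by move: cs; rewrite expr2 !rmorphM.
rewrite invr_ge0 mulr_ge0 // ?ler0n // exprn_ge0 // (lecR 0) ltW //.
Qed.

End Tensors.

(** * The tensors at a point *)

Section Cotangent.
Variables (R : realType) (H : hilbertType R).
Implicit Types (A B C q : bounded_op H) (x y z u w v : H) (a : R[i]).

Lemma not_projection0 : ~ projections (0 : bounded_op H).
Proof. by move=> [_ _ /eqP]; rewrite tr0 eq_sym oner_eq0. Qed.

Definition line_proj v := (inner v v)^-1 *: dyad v v.

Lemma line_projE v x : line_proj v x = (inner v x / inner v v) *: v.
Proof. by rewrite /line_proj !opE scalerA mulrC. Qed.

Lemma line_proj_line v a : v != 0 -> line_proj v (a *: v) = a *: v.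
Proof.
by move=> v0; rewrite line_projE innerZr mulfK // gt_eqF // inner_gt0.
Qed.

Lemma line_proj_orth v x : v != 0 -> inner v (x - line_proj v x) = 0.
Proof.
move=> v0; rewrite innerBr line_projE innerZr divfK ?subrr //.
by rewrite gt_eqF // inner_gt0.
Qed.

Lemma line_orth v x : (forall y, range (fun a : R[i] => a *: v) y -> inner y x = 0) <->
  inner v x = 0.
Proof.
split=> [|vx _ [a _ <-]]; last by rewrite innerZl vx mulr0.
by apply; exists 1; rewrite ?scale1r.
Qed.

(** With [P] the orthogonal projection onto the line, the correspondence is [q |-> q (1 - P)] in
    this direction and [c |-> P + c] in the other. *)
Lemma exists_cotangent q : projections q ->
  exists! Vc : set H * bounded_op H, cotangentP Vc /\ represents q Vc.
Proof.
move=> /projection_lift[u [w l]]; have [u0 w0] := lift_neq0 l; have [qE wu] := l.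
have rq : range q = range (fun a : R[i] => a *: u).
  apply/seteqP; split=> [_ [x _ <-]|_ [a _ <-]].
    by rewrite qE dyadE; exists (inner w x).
  by exists (a *: u) => //; rewrite qE dyadE innerZr wu mulr1.
exists (range q, q * (1%R - line_proj u)); split.
  split=> /=.
    split=> [|x|x]; first by exists u.
      by exists ((1%R - line_proj u : bounded_op H) x).
    rewrite rq => -[a _ <-]; rewrite op_mulE op_addE op_oppE -[(1%R : bounded_op H) _]/(a *: u).
    by rewrite line_proj_line // subrr linear0.
  split=> // x; rewrite rq => /line_orth ux.
  rewrite op_mulE op_addE op_oppE line_projE ux mul0r scale0r subr0.
  by [].
move=> [V c] [[_ /= cV c0] [/= Vr cq]]; congr (_, _) => //.
apply: bounded_opP => x; rewrite op_mulE op_addE op_oppE -[(1%R : bounded_op H) x]/x.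
rewrite cq; last by rewrite -Vr rq; apply/line_orth; exact: line_proj_orth.
rewrite linearB /= [c (line_proj _ _)]c0 ?subr0 //.
by rewrite -Vr rq line_projE; exists (inner u x / inner u u).
Qed.

Lemma exists_projection (Vc : set H * bounded_op H) : cotangentP Vc ->
  exists! q : bounded_op H, projections q /\ represents q Vc.
Proof.
case: Vc => V c [/= [v v0 Vv] cV c0].
have Vv1 a : V (a *: v) by rewrite Vv; exists a.
have qE x : (line_proj v + c) x = line_proj v x + c x by [].
have VP x : V (line_proj v x) by rewrite line_projE.
have PV x : V x -> line_proj v x = x by rewrite Vv => -[a _ <-]; exact: line_proj_line.
have VD x y : V x -> V y -> V (x + y).
  by rewrite Vv => -[a _ <-] [b _ <-]; exists (a + b); rewrite ?scalerDl.
have rq : range (line_proj v + c) = V.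
  apply/seteqP; split=> [_ [x _ <-]|x Vx]; first by rewrite qE; exact: VD.
  by exists x => //; rewrite qE PV // c0 // addr0.
exists (line_proj v + c); split.
  split; last first.
    split=> // x; rewrite [in X in X -> _]/= Vv => /line_orth vx.
    by rewrite qE line_projE vx mul0r scale0r add0r.
  apply/projectionP; split; last by rewrite rq; exists v.
  apply: bounded_opP => x; rewrite op_mulE.
  have Vq : V ((line_proj v + c) x) by rewrite -rq; exists x.
  by rewrite qE PV // c0 // addr0.
move=> q [/projectionP[qq _] [/= qV qc]]; apply: bounded_opP => x.
have qid y : V y -> q y = y by rewrite -qV => -[z _ <-]; rewrite -[in RHS]qq.
have -> : q x = q (line_proj v x) + q (x - line_proj v x) by rewrite -linearD addrC subrK.
rewrite qid // qc; last by rewrite Vv; apply/line_orth; exact: line_proj_orth.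
by rewrite qE linearB /= [c (line_proj _ _)]c0 // subr0.
Qed.

End Cotangent.

Section ComplexStructures.
Variables (R : realType) (H : hilbertType R).
Implicit Types (A B C q : bounded_op H) (x y z u w v : H) (a : R[i]).

Local Notation rn x := (complex.Re `|x|).

Lemma Jbold_tangent_in q A : projections q -> tangent q A -> tangent q (Jbold q A).
Proof.
move=> /projection_nlift[u [w n]] qA; have [qE wu uw] := n.
rewrite (tangent_lift (nlift_lift n) qA).1 (Jbold_nlift _ _ n) qE.
by apply: tangent_ddyad => //; exact: Jbold_tangent.
Qed.

Lemma Jbold_sqr q A : projections q -> tangent q A -> Jbold q (Jbold q A) = - A.
Proof.
move=> /projection_nlift[u [w n]] qA; have l := nlift_lift n.
rewrite (tangent_lift l qA).1; apply: Jbold_nlift_sqr => //.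
exact: (tangent_constraint l).
Qed.

Lemma Jbold_Omega q A B : projections q -> tangent q A -> tangent q B ->
  hform q (Jbold q A) B = Omega q A B.
Proof.
move=> /projection_nlift[u [w n]] qA qB; have l := nlift_lift n.
rewrite (tangent_lift l qA).1 (tangent_lift l qB).1; apply: hform_Jbold => //.
  exact: (tangent_constraint l).
exact: (tangent_constraint l).
Qed.

Lemma hform0l q B : projections q -> tangent q B -> hform q 0 B = 0.
Proof.
move=> pq qB; have := hformZDl (-1) pq (tangent0 q) (tangent0 q) qB.
by rewrite scaler0 addr0 rmorphN rmorph1 mulN1r addNr.
Qed.

Lemma hform_inj q A C : projections q -> tangent q A -> tangent q C ->
  (forall B, tangent q B -> hform q A B = hform q C B) -> A = C.
Proof.
move=> pq qA qC AC; apply/subr0_eq.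
have qD : tangent q (A - C) by apply: tangentD => //; exact: tangentN.
have h0 : hform q (A - C) (A - C) = 0.
  have -> : A - C = (-1) *: C + A by rewrite scaleN1r addrC.
  rewrite hformZDl //; last by apply: tangentZD.
  have D' : tangent q (-1 *: C + A) by apply: tangentZD.
  by rewrite AC // rmorphN rmorph1 mulN1r addNr.
have := hform_pos pq qD; rewrite h0 (lecR _ 0) => h.
apply: Re_norm0_eq0; apply/eqP; rewrite -sqrf_eq0 eq_le sqr_ge0 andbT.
have r0 := hsnorm_gt0 pq.
by move: h; rewrite pmulr_lle0 // invr_gt0 mulr_gt0.
Qed.

Lemma Jbold_unique q A C : projections q -> tangent q A -> tangent q C ->
  (forall B, tangent q B -> hform q C B = Omega q A B) <-> C = Jbold q A.
Proof.
move=> pq qA qC; split=> [CA|-> B qB]; last exact: Jbold_Omega.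
apply: (hform_inj pq qC (Jbold_tangent_in pq qA)) => B qB.
by rewrite CA // Jbold_Omega.
Qed.

(** Antilinearity follows from the defining equation and not from the formula: [Omega] is linear and
    [hform] antilinear in the first argument, and [hform] separates tangent vectors. *)
Lemma JboldZD q a A B : projections q -> tangent q A -> tangent q B ->
  Jbold q (a *: A + B) = a^* *: Jbold q A + Jbold q B.
Proof.
move=> pq qA qB; have JA := Jbold_tangent_in pq qA; have JB := Jbold_tangent_in pq qB.
have qAB := tangentZD a qA qB.
apply: (hform_inj pq); [exact: Jbold_tangent_in|exact: tangentZD|move=> C qC].
by rewrite Jbold_Omega // OmegaZDl // hformZDl // conjCK !Jbold_Omega.
Qed.

Lemma Jbold0 q : projections q -> Jbold q (0 : bounded_op H) = 0.
Proof.
move=> pq; have := JboldZD (-1) pq (tangent0 q) (tangent0 q).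
by rewrite scaler0 addr0 rmorphN rmorph1 scaleN1r addNr.
Qed.

Lemma Jbold_scale q a A : projections q -> tangent q A ->
  Jbold q (a *: A) = a^* *: Jbold q A.
Proof.
move=> pq qA.
by rewrite -[a *: A]addr0 JboldZD ?Jbold0 ?addr0 //; exact: tangent0.
Qed.

Lemma Jbold_anti q A : projections q -> tangent q A ->
  'i%C *: Jbold q A = - Jbold q ('i%C *: A).
Proof. by move=> pq qA; rewrite Jbold_scale // conj_imag scaleNr opprK. Qed.

Lemma Jthird_tangent q u w A : is_lift q u w -> tangent q A ->
  Jthird q A = ddyad u w ('i%C *: A u) ('i%C *: adj A w).
Proof.
move=> l qA; have [qE wu] := l; have [AE Au] := tangent_lift l qA.
by rewrite {1}AE qE Jthird_lift // adjP Au subrr mulr0 scale0r addr0.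
Qed.

Lemma Jthird_tangent_in q A : projections q -> tangent q A -> tangent q (Jthird q A).
Proof.
move=> /projection_lift[u [w l]] qA; rewrite (Jthird_tangent l qA).
have [qE wu] := l; rewrite qE; apply: tangent_ddyad => //.
have [_ Au] := tangent_lift l qA.
by rewrite innerZr innerZl adjP Au !mulr0 addr0.
Qed.

Lemma Jthird_sqr q A : projections q -> tangent q A -> Jthird q (Jthird q A) = - A.
Proof.
move=> pq qA; have [u [w l]] := projection_lift pq.
have [AE Au] := tangent_lift l qA; have [qE wu] := l.
rewrite (Jthird_tangent l qA) qE Jthird_lift // innerZl innerZr adjP Au !mulr0 subrr mulr0.
rewrite scale0r addr0 [in RHS]AE; apply: op_ext => x y; rewrite !opE !innerE.
rewrite conj_imag; have i2 := mul_imag R; by ring: i2.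
Qed.

Lemma JthirdZD q a A B : Jthird q (a *: A + B) = a *: Jthird q A + Jthird q B.
Proof.
rewrite /Jthird /comm mulrDl mulrDr op_scaleAl op_scaleAr scalerA mulrC -scalerA -scalerDr.
by rewrite opprD addrACA -scalerBr.
Qed.

Lemma Jthird_scale q a A : Jthird q (a *: A) = a *: Jthird q A.
Proof.
have J0 : Jthird q 0 = 0 by rewrite /Jthird /comm mulr0 mul0r subr0 scaler0.
by rewrite -[a *: A]addr0 JthirdZD J0 addr0.
Qed.

Lemma Jthird_Omega q A B : projections q -> tangent q A -> tangent q B ->
  Omega q (Jthird q A) (Jthird q B) = Omega q A B.
Proof.
move=> pq qA qB; have [u [w l]] := projection_lift pq.
have [AE Au] := tangent_lift l qA; have [BE Bu] := tangent_lift l qB; have [qE wu] := l.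
rewrite (Omega_tangent l qA qB) (Jthird_tangent l qA) (Jthird_tangent l qB) (Omega_lift l).
- rewrite !innerE conj_imag; have i2 := mul_imag R; by ring: i2.
- by rewrite innerZr innerZl adjP Au !mulr0 addr0.
- by rewrite innerZr innerZl adjP Bu !mulr0 addr0.
Qed.

(* Tangent vectors at [dyad u w] are pairs of a vector orthogonal to [w] and a
   functional killing [u], so a functional on them is represented by two
   applications of Riesz' theorem. *)
Lemma Omega_nondegenerate q (l : bounded_op H -> R[i]) : projections q ->
  (forall a A B, tangent q A -> tangent q B -> l (a *: A + B) = a * l A + l B) ->
  (exists c : R, forall A, tangent q A -> `|l A| <= c%:C * `|A|) ->
  exists! A, tangent q A /\ forall B, tangent q B -> Omega q A B = l B.
Proof.
move=> pq ll [c lc]; have [u [w lf]] := projection_lift pq; have [qE wu] := lf.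
have l0 : l 0 = 0.
  by have := ll (-1) 0 0 (tangent0 q) (tangent0 q); rewrite scaler0 addr0 mulN1r addNr.
have lZ a A : tangent q A -> l (a *: A) = a * l A.
  by move=> qA; rewrite -[a *: A]addr0 ll ?l0 ?addr0 //; exact: tangent0.
(* Both maps are defined on all of [H], through the projections along [u] onto the kernel of <w, .>
   and along [w] onto that of <u, .>, so that Riesz' theorem applies on [H] itself. *)
pose T1 d := dyad (d - inner w d *: u) w.
pose T2 d := dyad u (d - inner u d *: w).
have uw : inner u w = 1 by rewrite innerC wu rmorph1.
have T1q d : tangent q (T1 d).
  rewrite qE -[T1 d]addr0; have -> : T1 d + 0 = ddyad u w (d - inner w d *: u) 0.
    by congr (_ + _); apply: op_ext => x y; rewrite !opE inner0l scale0r inner0r.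
  by apply: tangent_ddyad => //; rewrite innerBr innerZr wu mulr1 subrr inner0l addr0.
have T2q d : tangent q (T2 d).
  rewrite qE -[T2 d]add0r; have -> : 0 + T2 d = ddyad u w 0 (d - inner u d *: w).
    by congr (_ + _); apply: op_ext => x y; rewrite !opE scaler0 inner0r.
  apply: tangent_ddyad => //; rewrite innerBl innerZl conj_inner wu mulr1.
  by rewrite inner0r add0r subrr.
have T1l a x y : T1 (a *: x + y) = a *: T1 x + T1 y.
  rewrite /T1 -dyadZl -dyadDl; congr dyad; rewrite innerDr innerZr.
  by rewrite scalerBr scalerDl opprD addrACA scalerA.
have T2l a x y : T2 (a *: x + y) = a^* *: T2 x + T2 y.
  rewrite /T2 -dyadZr -dyadDr; congr dyad; rewrite innerDr innerZr.
  by rewrite scalerBr scalerDl opprD addrACA scalerA.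
have bd (T : H -> bounded_op H) (M : R) : (forall d, tangent q (T d)) -> 0 <= M ->
   (forall d, rn (T d) <= M * rn d) -> forall d, `|l (T d)| <= (`|c| * M)%:C * `|d|.
  move=> Tq M0 TM d; apply: le_trans (lc _ (Tq d)) _.
  rewrite -(Re_norm_real (T d)) -(Re_norm_real d) -!rmorphM lecR -mulrA.
  apply: (@le_trans _ _ (`|c| * rn (T d))); first by rewrite ler_wpM2r ?Re_norm_ge0 ?ler_norm.
  by rewrite ler_wpM2l.
have dn x y d : rn (d - inner x d *: y) <= (1 + rn x * rn y) * rn d.
  apply: le_trans (Re_normD _ _) _; rewrite mulrDl mul1r lerD2l normrN Re_normZ.
  rewrite mulrAC ler_wpM2r ?Re_norm_ge0 // -lecR rmorphM /= !Re_norm_real.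
  exact: cauchy_schwarz.
have M1 : forall d, rn (T1 d) <= (1 + rn w * rn u) * rn w * rn d.
  move=> d; apply: le_trans (dyad_norm_le _ _) _.
  by rewrite mulrAC ler_wpM2r ?Re_norm_ge0.
have M2 : forall d, rn (T2 d) <= (1 + rn u * rn w) * rn u * rn d.
  move=> d; apply: le_trans (dyad_norm_le _ _) _.
  by rewrite mulrC mulrAC ler_wpM2r ?Re_norm_ge0.
have p1 : 0 <= (1 + rn w * rn u) * rn w by rewrite mulr_ge0 ?addr_ge0 ?mulr_ge0 ?Re_norm_ge0.
have p2 : 0 <= (1 + rn u * rn w) * rn u by rewrite mulr_ge0 ?addr_ge0 ?mulr_ge0 ?Re_norm_ge0.
have [a' a'E] := @riesz R H (fun d => l (T1 d)) _ (fun a x y => etrans (congr1 l (T1l a x y))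
  (ll a _ _ (T1q x) (T1q y))) (bd T1 _ T1q p1 M1).
(* [T2] is antilinear, so Riesz' theorem is applied to the conjugate of [l] on its values. *)
have T2b d : `|(l (T2 d))^*| <= (`|c| * ((1 + rn u * rn w) * rn u))%:C * `|d|.
  by rewrite norm_conjC; exact: bd T2q p2 M2 d.
have T2ll a x y : (l (T2 (a *: x + y)))^* = a * (l (T2 x))^* + (l (T2 y))^*.
  by rewrite T2l ll // rmorphD rmorphM /= conjCK.
have [b' b'E] := @riesz R H (fun d => (l (T2 d))^*) _ T2ll T2b.
have a'u : inner a' u = 0.
  rewrite -a'E -[RHS]l0; congr l; rewrite /T1 wu scale1r subrr.
  by apply: op_ext => x y; rewrite !opE scaler0.
have wb' : inner w b' = 0.
  rewrite innerC -b'E conjCK -[RHS]l0; congr l; rewrite /T2 uw scale1r subrr.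
  by apply: op_ext => x y; rewrite !opE inner0l scale0r.
(* On [B = d <w, .> + u <c, .>] the functional is <a', d> + <c, b'>; the factors [i] compensate the
   factor [i] and the sign in [Omega_lift]. *)
pose A := ddyad u w ('i%C *: b') ('i%C *: a').
have cA : inner w ('i%C *: b') + inner ('i%C *: a') u = 0.
  by rewrite innerZr wb' innerZl a'u !mulr0 addr0.
have qA : tangent q A by rewrite qE; exact: tangent_ddyad.
have AO B : tangent q B -> Omega q A B = l B.
  move=> qB; have [BE Bu] := tangent_lift lf qB.
  have cB := tangent_constraint lf qB.
  rewrite [in LHS]BE (Omega_lift lf) // [in RHS]BE.
  have -> : ddyad u w (B u) (adj B w) = 1 *: T1 (B u) + T2 (adj B w).
    rewrite scale1r /T1 /T2 Bu scale0r subr0.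
    have -> : inner u (adj B w) = 0 by rewrite adjPr innerC Bu rmorph0.
    by rewrite scale0r subr0.
  rewrite ll // mul1r a'E -[l (T2 _)]conjCK b'E conj_inner !innerE conj_imag.
  have i2 := mul_imag R; by ring: i2.
exists A; split=> // A' [qA' A'l]; apply/subr0_eq; set D := A - A'.
have qD : tangent q D by apply: tangentD => //; exact: tangentN.
have DO B : tangent q B -> Omega q D B = 0.
  move=> qB; rewrite /D addrC -scaleN1r OmegaZDl // AO // A'l // mulN1r addNr.
  by [].
(* Uniqueness comes from the metric: a vector in the kernel of [Omega] has its image under [Jbold]
   in the kernel of [hform], and [Jbold] squares to -1. *)
have qJD := Jbold_tangent_in pq qD.
have JD0 : Jbold q D = 0.
  apply: (hform_inj pq qJD (tangent0 q)) => B qB.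
  by rewrite Jbold_Omega // DO // hform0l.
by rewrite -[D]opprK -(Jbold_sqr pq qD) JD0 Jbold0 // oppr0.
Qed.

End ComplexStructures.

(** * Smooth local lifts *)

Section RealCalculus.
Variables (R : realType).

Local Notation rn x := (complex.Re `|x|).
Local Notation rC := (realified R[i]^o).

Lemma realified_norm (E : normedModType R[i]) (x : E) : `|(x : realified E)| = rn x.
Proof. by []. Qed.

Lemma realified_scale (E : normedModType R[i]) (a : R) (x : E) :
  a *: (x : realified E) = a%:C *: x.
Proof. by []. Qed.

Lemma rn_ge_Re (a : R[i]) : `|complex.Re a| <= rn a.
Proof. by rewrite -lecR RRe_real ?normr_real // normc_ge_Re. Qed.

Lemma rnM (a b : R[i]) : rn (a * b) = rn a * rn b.
Proof.
have rE (c : R[i]) : (rn c)%:C = `|c| by rewrite RRe_real ?normr_real.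
by apply: (@complexI R); rewrite rmorphM !rE normrM.
Qed.

Lemma ImZ_Re (a : R[i]) : complex.Im a = - complex.Re ('i%C * a).
Proof. by rewrite ReM_i opprK. Qed.

Lemma rn_i : rn ('i%C : R[i]) = 1.
Proof. by rewrite normc_def /= expr0n expr1n add0r sqrtr1. Qed.

Section Maps.
Variables (T : normedModType R) (U : set T).
Hypothesis Uo : open U.

Lemma smoothRe (f : T -> rC) : smooth U f -> smooth U (fun x => complex.Re (f x) : R^o).
Proof.
apply: (@smooth_linear R T rC R^o U f (fun z => complex.Re z : R^o) 1) => // [a x y|z].
  by rewrite realified_scale ReD ReM_real.
by rewrite mul1r; exact: rn_ge_Re.
Qed.

Lemma smoothIm (f : T -> rC) : smooth U f -> smooth U (fun x => complex.Im (f x) : R^o).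
Proof.
apply: (@smooth_linear R T rC R^o U f (fun z => complex.Im z : R^o) 1) => // [a x y|z].
  rewrite realified_scale; case: x => x1 x2; case: y => y1 y2 /=.
  by rewrite mul0r addr0.
by rewrite mul1r ImZ_Re normrN; apply: le_trans (rn_ge_Re _) _; rewrite rnM rn_i mul1r.
Qed.

Lemma smoothRC (f : T -> R^o) : smooth U f -> smooth U (fun x => (f x)%:C : rC).
Proof.
apply: (@smooth_linear R T R^o rC U f (fun z => z%:C : rC) 1) => // [a x y|z].
  by rewrite rmorphD rmorphM.
by rewrite mul1r realified_norm normc_def /= expr0n addr0 sqrtr_sqr.
Qed.

Lemma smooth_conj (f : T -> rC) : smooth U f -> smooth U (fun x => (f x : R[i])^* : rC).
Proof.
apply: (@smooth_linear R T rC rC U f (fun z => (z : R[i])^* : rC) 1) => // [a x y|z].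
  by rewrite !realified_scale rmorphD rmorphM /= conj_real.
by rewrite mul1r !realified_norm norm_conjC.
Qed.

Lemma smooth_cscale (E : normedModType R[i]) (f : T -> rC) (g : T -> realified E) :
  smooth U f -> smooth U g -> smooth U (fun x => (f x : R[i]) *: (g x : E) : realified E).
Proof.
apply: (@smooth_bilinear R rC (realified E) (realified E) (fun a x => (a : R[i]) *: (x : E)) 1) => //.
- by move=> y a x z; rewrite !realified_scale scalerDl scalerA.
- by move=> b a x y; rewrite !realified_scale scalerDr !scalerA mulrC.
- by move=> a x; rewrite mul1r !realified_norm Re_normZ.
Qed.

Lemma smooth_cmul (f g : T -> rC) :
  smooth U f -> smooth U g -> smooth U (fun x => (f x : R[i]) * (g x : R[i]) : rC).
Proof. exact: (@smooth_cscale R[i]^o). Qed.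

Lemma smooth_scale (E : normedModType R[i]) (f : T -> R^o) (g : T -> realified E) :
  smooth U f -> smooth U g -> smooth U (fun x => (f x)%:C *: (g x : E) : realified E).
Proof. by move=> fs gs; apply: smooth_cscale => //; exact: smoothRC. Qed.

Lemma smoothN (E : normedModType R) (f : T -> E) :
  smooth U f -> smooth U (fun x => - f x).
Proof.
move=> fs; apply: (@smooth_linear R T E E U f -%R 1) => // [a x y|x].
  by rewrite opprD scalerN.
by rewrite mul1r normrN.
Qed.

Lemma smoothB (E : normedModType R) (f g : T -> E) :
  smooth U f -> smooth U g -> smooth U (fun x => f x - g x).
Proof. by move=> fs gs; apply: smoothD => //; exact: smoothN. Qed.

Variables (H : hilbertType R).

Lemma smooth_inner (f g : T -> realified H) :
  smooth U f -> smooth U g -> smooth U (fun x => inner (f x : H) (g x : H) : rC).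
Proof.
apply: (@smooth_bilinear R (realified H) (realified H) rC (fun x y => inner (x : H) (y : H)) 1) => //.
- by move=> y a x z; rewrite !realified_scale innerDl innerZl conj_real.
- by move=> b a x y; rewrite !realified_scale innerDr innerZr.
- move=> a x; rewrite mul1r !realified_norm -lecR rmorphM /= !Re_norm_real.
  exact: cauchy_schwarz.
Qed.

Lemma smooth_dyad (f g : T -> realified H) :
  smooth U f -> smooth U g -> smooth U (fun x => dyad (f x : H) (g x : H) : realified (bounded_op H)).
Proof.
apply: (@smooth_bilinear R (realified H) (realified H) (realified (bounded_op H))
  (fun x y => dyad (x : H) (y : H)) 1) => //.
- by move=> y a x z; rewrite !realified_scale dyadDl dyadZl.
- by move=> b a x y; rewrite !realified_scale dyadDr dyadZr conj_real.
- by move=> a x; rewrite mul1r !realified_norm dyad_norm_le.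
Qed.

Lemma smooth_app (e : H) (f : T -> realified (bounded_op H)) :
  smooth U f -> smooth U (fun x => (f x : bounded_op H) e : realified H).
Proof.
apply: (@smooth_linear R T (realified (bounded_op H)) (realified H) U f
  (fun A : bounded_op H => A e) (rn e)) => //.
by move=> A; rewrite !realified_norm mulrC op_norm_le.
Qed.

Lemma smooth_adj_app (e : H) (f : T -> realified (bounded_op H)) :
  smooth U f -> smooth U (fun x => adj (f x : bounded_op H) e : realified H).
Proof.
apply: (@smooth_linear R T (realified (bounded_op H)) (realified H) U f
  (fun A : bounded_op H => adj A e) (rn e)) => //.
  by move=> a A B; rewrite !realified_scale adjD adjZ conj_real.
by move=> A; rewrite !realified_norm mulrC adj_norm_le.
Qed.

End Maps.

Section Differentials.
Variables (T : normedModType R) (x : T).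
Variables (H : hilbertType R).

Lemma diff_inner (f g : T -> realified H) v :
  differentiable f x -> differentiable g x ->
  'd (fun x => inner (f x : H) (g x : H) : rC) x v =
  inner (f x : H) ('d g x v : H) + inner ('d f x v : H) (g x : H) :> R[i].
Proof.
move=> df dg.
have [||M|_] := @diff_bilinear R (realified H) (realified H) rC (fun x y => inner (x : H) (y : H)) 1
   _ _ _ T f g x df dg; last by apply.
- by move=> y a u z; rewrite !realified_scale innerDl innerZl conj_real.
- by move=> b a u y; rewrite !realified_scale innerDr innerZr.
- move=> a; rewrite mul1r !realified_norm -lecR rmorphM /= !Re_norm_real.
  exact: cauchy_schwarz.
Qed.

Lemma diff_dyad (f g : T -> realified H) v :
  differentiable f x -> differentiable g x ->
  'd (fun x => dyad (f x : H) (g x : H) : realified (bounded_op H)) x v =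
  ddyad (f x : H) (g x : H) ('d f x v : H) ('d g x v : H).
Proof.
move=> df dg.
have [||M|_ ->] := @diff_bilinear R (realified H) (realified H) (realified (bounded_op H))
   (fun x y => dyad (x : H) (y : H)) 1 _ _ _ T f g x df dg; last by rewrite addrC.
- by move=> y a u z; rewrite !realified_scale dyadDl dyadZl.
- by move=> b a u y; rewrite !realified_scale dyadDr dyadZr conj_real.
- by move=> a; rewrite mul1r !realified_norm dyad_norm_le.
Qed.

End Differentials.

(* The real parts of the functionals [inner h] separate the points of [H]. *)
Lemma derive_symH (H : hilbertType R) (E : normedModType R) (f : E -> realified H) (U : set E) x a b :
  open U -> smooth U f -> U x -> 'D_b ('D_a f) x = 'D_a ('D_b f) x.
Proof.
apply: (@derive_sym R E (realified H)
  [set l | exists h : H, l = fun y : realified H => complex.Re (inner h (y : H)) : R^o]).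
- move=> _ [h ->]; split=> [c y z|].
    by rewrite realified_scale innerDr innerZr ReD ReM_real.
  by exists (rn h) => y; rewrite realified_norm Re_inner_le.
- move=> y ly; apply: inner_eq0; have := ly _ (ex_intro _ (y : H) erefl).
  by rewrite -[RHS]/(complex.Re 0) -rn_sqr inner_norm => ->.
Qed.

End RealCalculus.

(** * A smooth normalised lift near every projection *)

Section LocalLift.
Variables (R : realType) (H : hilbertType R).
Implicit Types (u w e : H) (q A B : bounded_op H).

Local Notation rn x := (complex.Re `|x|).
Local Notation rC := (realified R[i]^o).
Local Notation rH := (realified H).
Local Notation rF := (realified (bounded_op H)).

Lemma open_pos (E : normedModType R) (U : set E) (f : E -> R^o) :
  open U -> smooth U f -> open (U `&` [set x | 0 < f x]).
Proof.
move=> Uo fs; rewrite openE => x [Ux fx].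
apply: filterI; first exact: open_nbhs_nbhs.
have fc := smooth_continuous fs Ux.
have N : nbhs (f x) [set y : R^o | 0 < y].
  by apply: open_nbhs_nbhs; split=> //; exact: open_gt.
exact: (fc _ N).
Qed.

Definition nsq (z : R[i]) : R := complex.Re z ^+ 2 + complex.Im z ^+ 2.

Lemma nsq_conj (z : R[i]) : (nsq z)%:C = z^* * z.
Proof. by rewrite add_Re2_Im2 sqr_normc mulrC. Qed.

Lemma nsq_gt0 (z : R[i]) : (0 < nsq z) = (z != 0).
Proof.
by rewrite -(ltcR 0) add_Re2_Im2 lt_def exprn_ge0 // andbT sqrf_eq0 normr_eq0.
Qed.

Lemma smooth_nsq (T : normedModType R) (U : set T) (f : T -> rC) :
  open U -> smooth U f -> smooth U (fun x => nsq (f x) : R^o).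
Proof.
move=> Uo fs; apply: smoothD => //; rewrite /GRing.exp /=.
  by apply: smooth_mulr => //; exact: smoothRe.
by apply: smooth_mulr => //; exact: smoothIm.
Qed.

Lemma smooth_rn_sqr (T : normedModType R) (U : set T) (f : T -> rH) :
  open U -> smooth U f -> smooth U (fun x => complex.Re (inner (f x : H) (f x : H)) : R^o).
Proof. by move=> Uo fs; apply: smoothRe => //; exact: smooth_inner. Qed.

Lemma Re_inner_gt0 u : u != 0 -> 0 < complex.Re (inner u u).
Proof. by move=> /inner_gt0; rewrite inner_norm (ltcR 0). Qed.

Section Ambient.
Variable e : H.

Definition lift_domain : set rF := [set q | 0 < nsq (inner e ((q : bounded_op H) e))].

(** For [q = u0 <w0, .>] the vectors [q e] and [adj q e] are <w0, e> u0 and <u0, e> w0, and [d] is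
    <w0, e> <e, u0>. Hence [rho] is |u0| |w0|, the Hilbert-Schmidt norm of [q], and [c] rescales
    [q e] to squared norm [rho]; the other factor is fixed by requiring that the dyad be [q]. *)
Let d (q : rF) : R[i] := inner e ((q : bounded_op H) e).
Let a2 (q : rF) : R := complex.Re (inner ((q : bounded_op H) e) ((q : bounded_op H) e)).
Let b2 (q : rF) : R := complex.Re (inner (adj (q : bounded_op H) e) (adj (q : bounded_op H) e)).
Let rho (q : rF) : R := Num.sqrt (a2 q * b2 q * (nsq (d q))^-1).
Let c (q : rF) : R := Num.sqrt (rho q * (a2 q)^-1).

(* Only the vectors [q e] and [adj q e] enter: unlike the Hilbert-Schmidt norm,
   they depend smoothly on an arbitrary bounded operator. *)
Definition lift_u (q : rF) : rH := (c q)%:C *: ((q : bounded_op H) e).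
Definition lift_w (q : rF) : rH :=
  ((c q * nsq (d q))^-1)%:C *: (d q *: adj (q : bounded_op H) e).

Let ds (U : set rF) : open U -> smooth U (d : rF -> rC).
Proof.
move=> Uo; apply: smooth_inner => //; first exact: smooth_cst.
by apply: smooth_app => //; exact: smooth_id.
Qed.

Lemma lift_domain_open : open lift_domain.
Proof.
rewrite -[lift_domain]setTI; apply: open_pos; first exact: openT.
by apply: smooth_nsq; [exact: openT|apply: ds; exact: openT].
Qed.

Let a2_gt0 q : lift_domain q -> 0 < a2 q.
Proof.
rewrite /lift_domain /= nsq_gt0 => dq; apply: Re_inner_gt0.
by apply: contra_neq dq => ->; rewrite inner0r.
Qed.

Let b2_gt0 q : lift_domain q -> 0 < b2 q.
Proof.
rewrite /lift_domain /= nsq_gt0 => dq; apply: Re_inner_gt0.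
by apply: contra_neq dq; rewrite -adjP => ->; rewrite inner0l.
Qed.

Let rho2_gt0 q : lift_domain q -> 0 < a2 q * b2 q * (nsq (d q))^-1.
Proof.
move=> dq; apply: mulr_gt0; last by rewrite invr_gt0; exact: dq.
by apply: mulr_gt0; [exact: a2_gt0|exact: b2_gt0].
Qed.

Let rho_gt0 q : lift_domain q -> 0 < rho q.
Proof. by move=> dq; rewrite sqrtr_gt0; exact: rho2_gt0. Qed.

Let c2_gt0 q : lift_domain q -> 0 < rho q * (a2 q)^-1.
Proof.
by move=> dq; apply: mulr_gt0; [exact: rho_gt0|rewrite invr_gt0; exact: a2_gt0].
Qed.

Let c_gt0 q : lift_domain q -> 0 < c q.
Proof. by move=> dq; rewrite sqrtr_gt0; exact: c2_gt0. Qed.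

Let Uo := lift_domain_open.

Let smooth_e : smooth lift_domain (fun q : rF => (q : bounded_op H) e : rH).
Proof. by apply: smooth_app => //; exact: smooth_id. Qed.

Let smooth_adj_e : smooth lift_domain (fun q : rF => adj (q : bounded_op H) e : rH).
Proof. by apply: smooth_adj_app => //; exact: smooth_id. Qed.

Let smooth_d2 : smooth lift_domain (fun q : rF => nsq (d q) : R^o).
Proof. by apply: smooth_nsq => //; exact: ds. Qed.

Let smooth_c : smooth lift_domain (c : rF -> R^o).
Proof.
have as' : smooth lift_domain (fun q => (a2 q)^-1 : R^o).
  apply: smooth_invr => // [q /a2_gt0/lt0r_neq0//|]; exact: smooth_rn_sqr.
apply: smooth_sqrt => //; apply: smooth_mulr => //; apply: smooth_sqrt => //.
apply: smooth_mulr => //; first by apply: smooth_mulr => //; exact: smooth_rn_sqr.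
by apply: smooth_invr => // q; exact: lt0r_neq0.
Qed.

Lemma smooth_lift_u : smooth lift_domain lift_u.
Proof. exact: smooth_scale. Qed.

Lemma smooth_lift_w : smooth lift_domain lift_w.
Proof.
apply: smooth_scale => //; last by apply: smooth_cscale => //; exact: ds.
apply: smooth_invr => // [q dq|]; last exact: smooth_mulr.
by rewrite lt0r_neq0 // mulr_gt0 ?c_gt0.
Qed.

Lemma lift_domain_nlift q : lift_domain q -> projections q ->
  is_nlift q (lift_u q) (lift_w q).
Proof.
move=> dq /projection_lift[u0 [w0 [qE wu]]].
have aE : (q : bounded_op H) e = inner w0 e *: u0 by rewrite qE.
have bE : adj q e = inner u0 e *: w0 by rewrite qE adj_dyad.
have dE : d q = inner w0 e * inner e u0 by rewrite /d aE innerZr.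
have c0 := c_gt0 dq; have d0 : 0 < nsq (d q) := dq.
have k0 : (c q)%:C * ((c q * nsq (d q))^-1)%:C * (nsq (d q))%:C = 1.
  by rewrite -!rmorphM /= invfM mulrA divff ?gt_eqF // mul1r mulVf ?gt_eqF.
have de : (d q)^* * d q = (d q)^* * (inner w0 e * inner e u0) by rewrite -dE.
split.
- rewrite /lift_u /lift_w aE bE !dyadZl !dyadZr !scalerA conj_real conj_inner.
  rewrite -[LHS]scale1r {1}qE -k0 nsq_conj; congr (_ *: _).
  rewrite de; ring.
- rewrite /lift_u /lift_w aE bE !innerZl !innerZr wu conj_real conj_inner.
  rewrite -[RHS]k0 nsq_conj de; ring.
- have r0 := rho_gt0 dq; have A0 := a2_gt0 dq; have B0 := b2_gt0 dq.
  have cc : c q ^+ 2 = rho q / a2 q by rewrite sqr_sqrtr // divr_ge0 // ltW.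
  have rr : rho q ^+ 2 = a2 q * b2 q / nsq (d q).
    by rewrite sqr_sqrtr // divr_ge0 ?mulr_ge0 // ltW.
  have innR (x : H) : inner x x = (complex.Re (inner x x))%:C by rewrite [in RHS]inner_norm -inner_norm.
  rewrite /lift_u /lift_w !innerZl !innerZr !conj_real (innR (q e)) (innR (adj q e)).
  rewrite -/(a2 q) -/(b2 q).
  transitivity ((c q ^+ 2 * a2 q)%:C); first by rewrite !rmorphM /= mulrA.
  transitivity (((c q * nsq (d q))^-1 ^+ 2 * nsq (d q) * b2 q)%:C); last first.
    by rewrite !rmorphM /= nsq_conj; ring.
  congr (_%:C); rewrite cc divfK ?gt_eqF // exprVn exprMn cc.
  apply: (@mulfI _ (rho q)); first by rewrite gt_eqF.
  rewrite -expr2 rr; field.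
  by rewrite !gt_eqF.
Qed.

End Ambient.

Lemma chart_projection (E : completeNormedModType R[i]) V (phi : realified E -> rF) x :
  chart (@projections R H) (@tangent R H) V phi -> V x -> projections (phi x).
Proof.
move=> [_ _ [U [psi [_ _ VU _]]] _] Vx.
have : (phi @` V) (phi x) by exists x.
by rewrite VU => -[].
Qed.

Lemma chart_diff_tangent (E : completeNormedModType R[i]) V (phi : realified E -> rF) x v :
  chart (@projections R H) (@tangent R H) V phi -> V x -> tangent (phi x) ('d phi x v).
Proof. by move=> [_ _ _ dT] /dT <-; exists v. Qed.

Definition local_lift (E : normedModType R) (V : set E) (phi : E -> rF) (u w : E -> rH) :=
  [/\ smooth V u, smooth V w
    & forall x, V x -> is_nlift (phi x) (u x) (w x) /\
      forall v, [/\ 'd phi x v = ddyad (u x) (w x) ('d u x v : H) ('d w x v : H),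
        inner (w x : H) ('d u x v : H) + inner ('d w x v : H) (u x : H) = 0
      & complex.Re (inner (u x : H) ('d u x v : H)) = complex.Re (inner (w x : H) ('d w x v : H))]].

(** The three identities on the differentials are obtained by differentiating the three equations of
    [is_nlift]. *)
Lemma nlift_local_lift (E : normedModType R) (V : set E) (phi : E -> rF) (u w : E -> rH) :
  open V -> smooth V u -> smooth V w -> (forall x, V x -> is_nlift (phi x) (u x) (w x)) ->
  local_lift V phi u w.
Proof.
move=> Vo us ws uw; split; [exact: us|exact: ws|move=> x Vx; split; first exact: uw].
have du := smooth_differentiable us Vx; have dw := smooth_differentiable ws Vx.
move=> v; split.
- have [_ ->] : differentiable phi x /\ 'd phi x = 'd (fun y => dyad (u y) (w y) : rF) x :> (E -> rF).
    apply: near_eq_differentiable; first by apply: (open_near Vo Vx) => y /uw[-> _ _].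
    exact: smooth_differentiable (smooth_dyad Vo us ws) Vx.
  exact: diff_dyad.
- have := diff_inner v dw du.
  have [_ ->] : differentiable (fun y => inner (w y : H) (u y : H) : rC) x /\
     'd (fun y => inner (w y : H) (u y : H) : rC) x = 'd (fun=> 1 : rC) x :> (E -> rC).
    apply: near_eq_differentiable; first by apply: (open_near Vo Vx) => y /uw[_ -> _].
    exact: differentiable_cst.
  by rewrite diff_cst => <-.
- have half (a b : R) : a + a = b + b -> a = b by move=> ab; lra.
  have h1 := diff_inner v du du; have h2 := diff_inner v dw dw.
  pose nu (y : E) : rC := inner (u y : H) (u y : H).
  pose nw (y : E) : rC := inner (w y : H) (w y : H).
  have N : \near x, nw x = nu x.
    by apply: (open_near Vo Vx) => y /uw[_ _ h]; rewrite /nw -h.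
  have dnw : differentiable nw x := smooth_differentiable (smooth_inner Vo ws ws) Vx.
  have [_ e] := near_eq_differentiable N dnw.
  have := etrans (esym h1) (etrans (congr1 (fun h : E -> rC => h v) e) h2).
  move=> /(congr1 (@complex.Re R)); rewrite !ReD.
  rewrite (Re_innerC ('d u x v : H) (u x)) (Re_innerC ('d w x v : H) (w x)).
  exact: half.
Qed.

Lemma chart_local_lift (E : completeNormedModType R[i]) V (phi : realified E -> rF) x :
  chart (@projections R H) (@tangent R H) V phi -> V x ->
  exists (W : set (realified E)) (u w : realified E -> rH), [/\ open W, W x, W `<=` V & local_lift W phi u w].
Proof.
move=> cV Vx; have [Vo ps _ _] := cV.
have [u0 [w0 n0]] := projection_nlift (chart_projection cV Vx).
(* [u0] serves as the auxiliary vector: at [x] the pairing <u0, phi x u0> is |u0|^2, so it stays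
   nonzero nearby. *)
pose W := V `&` [set y | 0 < nsq (inner u0 ((phi y : bounded_op H) u0))].
have Wo : open W.
  apply: open_pos => //; apply: smooth_nsq => //; apply: smooth_inner => //.
    exact: smooth_cst.
  exact: smooth_app.
have Wx : W x.
  split=> //=; rewrite nsq_gt0; have [-> wu _] := n0.
  by rewrite dyadE wu scale1r gt_eqF // (nlift_gt0 n0).
have WV : W `<=` V by move=> y [].
have pW : smooth W phi by exact: smooth_sub ps.
exists W, (fun y => lift_u u0 (phi y)), (fun y => lift_w u0 (phi y)).
split; [exact: Wo|exact: Wx|exact: WV|].
have Wd y : W y -> lift_domain u0 (phi y) by move=> [].
apply: (nlift_local_lift Wo).
- exact: smooth_comp Wo Wd pW (smooth_lift_u u0).
- exact: smooth_comp Wo Wd pW (smooth_lift_w u0).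
- move=> y Wy; apply: lift_domain_nlift; first exact: Wd.
  exact: chart_projection cV (WV _ Wy).
Qed.

End LocalLift.

(** * Closed forms *)

Section ClosedForms.
Variables (R : realType).
Implicit Types (E F G : normedModType R).

(** Differentiability of the coefficients is part of the notion because additivity of [dext] in the
    form relies on it. *)
Definition closed_at E G (beta : E -> E -> E -> G) x :=
  (forall A B, differentiable (fun y => beta y A B) x) /\
  (forall A B C, dext beta x A B C = 0).

Lemma closed_at_congr E G (beta gamma : E -> E -> E -> G) x :
  (forall A B, \near x, beta x A B = gamma x A B) -> closed_at beta x -> closed_at gamma x.
Proof.
move=> bg [db cb]; split=> [A B|A B C].
  by have [] := near_eq_differentiable (bg A B) (db A B).
rewrite -[RHS](cb A B C) /dext.
rewrite (near_eq_derive A (bg B C)) (near_eq_derive B (bg A C)).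
by rewrite (near_eq_derive C (bg A B)).
Qed.

Lemma closed_atD E G (beta gamma : E -> E -> E -> G) x :
  closed_at beta x -> closed_at gamma x -> closed_at (fun y A B => beta y A B + gamma y A B) x.
Proof.
move=> [db cb] [dc cc]; split=> [A B|A B C].
  exact: differentiableD (db A B) (dc A B).
have dD v A' B' : 'D_v (fun y => beta y A' B' + gamma y A' B') x =
    'D_v (fun y => beta y A' B') x + 'D_v (fun y => gamma y A' B') x.
  by apply: deriveD; apply: diff_derivable; [exact: db|exact: dc].
transitivity (dext beta x A B C + dext gamma x A B C); last by rewrite cb cc addr0.
by rewrite /dext !dD opprD [X in X + _ = _]addrACA [LHS]addrACA.
Qed.

Lemma closed_at_linear E F G (beta : E -> E -> E -> F) (l : F -> G) (M : R) x :
  linear l -> (forall z, `|l z| <= M * `|z|) ->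
  closed_at beta x -> closed_at (fun y A B => l (beta y A B)) x.
Proof.
move=> ll lM [db cb]; split=> [A B|A B C].
  by apply: (differentiable_comp (db A B)); have [] := diff_bound_linear (beta x A B) ll lM.
rewrite /dext !(derive_bound_linear _ ll lM) //.
pose lL : {linear F -> G} := HB.pack l (GRing.isLinear.Build _ _ _ _ _ ll).
have -> : l = lL by [].
rewrite -linearB -linearD; have := cb A B C; rewrite /dext => ->.
by rewrite linear0.
Qed.

End ClosedForms.

(** * Forms with constant coefficients, pulled back by smooth maps *)

Section FlatForms.
Variables (R : realType) (H : hilbertType R).
Local Notation rC := (realified R[i]^o).
Local Notation rH := (realified H).

Lemma derive_inner (E : normedModType R) (f g : E -> rH) x v :
  differentiable f x -> differentiable g x ->
  'D_v (fun y => inner (f y : H) (g y : H) : rC) x =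
  inner (f x : H) ('D_v g x : H) + inner ('D_v f x : H) (g x : H) :> R[i].
Proof.
move=> df dg; have [|||di _] := @diff_bilinear R rH rH rC (fun x y => inner (x : H) (y : H)) 1
   _ _ _ E f g x df dg.
- by move=> y a u z; rewrite !realified_scale innerDl innerZl conj_real.
- by move=> b a u y; rewrite !realified_scale innerDr innerZr.
- move=> a y; rewrite mul1r !realified_norm -lecR rmorphM /= !Re_norm_real.
  exact: cauchy_schwarz.
by rewrite deriveE // diff_inner // !deriveE.
Qed.

(** The exterior derivative of the 1-form <f, dg>. *)
Definition flat_form (E : normedModType R) (f g : E -> rH) (y A B : E) : rC :=
  inner ('D_A f y : H) ('D_B g y : H) - inner ('D_B f y : H) ('D_A g y : H).

(** The derivative of a flat form by the product rule, with first and second derivatives replaced by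
    arbitrary functions; closedness becomes a ring identity under symmetry of [f2] and [g2]. *)
Definition dflat (V : Type) (f1 g1 : V -> H) (f2 g2 : V -> V -> H) (v v1 v2 : V) : R[i] :=
  (inner (f1 v1) (g2 v v2) + inner (f2 v v1) (g1 v2))
  - (inner (f1 v2) (g2 v v1) + inner (f2 v v2) (g1 v1)).

Lemma dflat_cyclic (V : Type) (f1 g1 : V -> H) (f2 g2 : V -> V -> H) (A B C : V) :
  (forall a b, f2 b a = f2 a b) -> (forall a b, g2 b a = g2 a b) ->
  dflat f1 g1 f2 g2 A B C - dflat f1 g1 f2 g2 B A C + dflat f1 g1 f2 g2 C A B = 0.
Proof.
move=> sf sg; rewrite /dflat (sf C B) (sf C A) (sf B A) (sg C B) (sg C A) (sg B A); ring.
Qed.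

Lemma derive_flat_form (E : normedModType R) (W : set E) (f g : E -> rH) x v v1 v2 :
  open W -> smooth W f -> smooth W g -> W x ->
  'D_v (fun y => flat_form f g y v1 v2) x =
  dflat (fun a => 'D_a f x : H) (fun a => 'D_a g x : H)
    (fun a b => 'D_a ('D_b f) x : H) (fun a b => 'D_a ('D_b g) x : H) v v1 v2.
Proof.
move=> Wo fs gs Wx.
have Df w : differentiable ('D_w f) x by exact: smooth_differentiable (smooth_derive w Wo fs) Wx.
have Dg w : differentiable ('D_w g) x by exact: smooth_differentiable (smooth_derive w Wo gs) Wx.
have Di a b : differentiable (fun y => inner ('D_a f y : H) ('D_b g y : H) : rC) x.
  apply: smooth_differentiable (W) _ _ _ Wx.
  by apply: smooth_inner => //; exact: smooth_derive.
pose i1 (y : E) : rC := inner ('D_v1 f y : H) ('D_v2 g y : H).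
pose i2 (y : E) : rC := inner ('D_v2 f y : H) ('D_v1 g y : H).
have e : 'D_v (i1 - i2) x = 'D_v i1 x - 'D_v i2 x.
  by apply: deriveB; apply: diff_derivable; exact: Di.
have e1 := derive_inner v (Df v1) (Dg v2); have e2 := derive_inner v (Df v2) (Dg v1).
by rewrite -[LHS]/('D_v (i1 - i2) x) e /i1 /i2 e1 e2.
Qed.

Lemma flat_form_closed (E : normedModType R) (W : set E) (f g : E -> rH) x :
  open W -> smooth W f -> smooth W g -> W x -> closed_at (flat_form f g) x.
Proof.
move=> Wo fs gs Wx.
have Df v : differentiable ('D_v f) x by exact: smooth_differentiable (smooth_derive v Wo fs) Wx.
have Dg v : differentiable ('D_v g) x by exact: smooth_differentiable (smooth_derive v Wo gs) Wx.
have Di v w : differentiable (fun y => inner ('D_v f y : H) ('D_w g y : H) : rC) x.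
  apply: smooth_differentiable (W) _ _ _ Wx.
  by apply: smooth_inner => //; exact: smooth_derive.
split=> [A B|A B C]; first exact: differentiableB.
have D v v1 v2 := derive_flat_form v v1 v2 Wo fs gs Wx.
rewrite /dext; apply: etrans (congr2 +%R (congr2 (fun a b : rC => a - b)
  (D A B C) (D B A C)) (D C A B)) _.
have sf a b := derive_symH a b Wo fs Wx; have sg a b := derive_symH a b Wo gs Wx.
exact: (@dflat_cyclic E (fun a => 'D_a f x : H) (fun a => 'D_a g x : H)
  (fun a b => 'D_a ('D_b f) x : H) (fun a b => 'D_a ('D_b g) x : H) A B C sf sg).
Qed.

End FlatForms.

(** * Smoothness and closedness of tensors read in a lift *)

Section TensorsOnProjections.
Variables (R : realType) (H : hilbertType R).
Implicit Types (q A B C : bounded_op H).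

Local Notation rn x := (complex.Re `|x|).
Local Notation rC := (realified R[i]^o).
Local Notation rH := (realified H).
Local Notation rF := (realified (bounded_op H)).
Local Notation M := (@projections R H).
Local Notation T := (@tangent R H).

(* [b] is given on the differentials of a normalised lift by the formula [f]. *)
Definition lift_formula (G : Type) (b : rF -> rF -> rF -> G)
    (f : H -> H -> H -> H -> H -> H -> G) :=
  forall q u w b1 a1 b2 a2, is_nlift q u w ->
    inner w b1 + inner a1 u = 0 -> complex.Re (inner u b1) = complex.Re (inner w a1) ->
    inner w b2 + inner a2 u = 0 -> complex.Re (inner u b2) = complex.Re (inner w a2) ->
    b q (ddyad u w b1 a1) (ddyad u w b2 a2) = f u w b1 a1 b2 a2.

Definition smooth_formula (G : normedModType R) (f : H -> H -> H -> H -> H -> H -> G) :=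
  forall (D : normedModType R) (W : set D) (u w b1 a1 b2 a2 : D -> rH), open W ->
    smooth W u -> smooth W w -> smooth W b1 -> smooth W a1 -> smooth W b2 -> smooth W a2 ->
    (forall x, W x -> 0 < complex.Re (inner (u x : H) (u x : H))) ->
    smooth W (fun x => f (u x) (w x) (b1 x) (a1 x) (b2 x) (a2 x)).

Lemma pullback_lift (G : normedModType R) (b : rF -> rF -> rF -> G) f
    (E : normedModType R[i]) (W : set (realified E)) (phi : realified E -> rF) u w x (A B : realified E) :
  lift_formula b f -> local_lift W phi u w -> W x ->
  pullback phi b x A B = f (u x) (w x) ('d u x A) ('d w x A) ('d u x B) ('d w x B).
Proof.
move=> bf [_ _ lw] Wx; have [n d] := lw x Wx.
have [eA cA rA] := d A; have [eB cB rB] := d B.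
rewrite /pullback eA eB; exact: bf.
Qed.

Lemma nlift_Re_gt0 q (u w : H) : is_nlift q u w -> 0 < complex.Re (inner u u).
Proof. by move=> /nlift_lift/lift_neq0[u0 _]; exact: Re_inner_gt0. Qed.

Lemma smooth_tensor_lift (G : normedModType R) (b : rF -> rF -> rF -> G) f :
  lift_formula b f -> smooth_formula f -> smooth_tensor M T b.
Proof.
move=> bf fs E V phi cV; apply: smooth_local => -[[x A] B] [[/= Vx _] _].
have [W [u [w [Wo Wx WV lw]]]] := chart_local_lift cV Vx.
have [us ws lw'] := lw.
pose W3 : set (realified E * realified E * realified E) := W `*` setT `*` setT.
have W3o : open W3 by apply: open_setXT; exact: open_setXT.
have p1 : smooth W3 (fun z => z.1.1).
  by move=> k; apply: Ck_fst_comp => //; exact: Ck_fst.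
have p2 : smooth W3 (fun z => z.1.2).
  by move=> k; apply: Ck_snd_comp => //; exact: Ck_fst.
have p3 : smooth W3 (fun z => z.2) by exact: smooth_snd.
have W1 z : W3 z -> W z.1.1 by move=> [[]].
exists W3, (fun z => f (u z.1.1) (w z.1.1) ('d u (z.1.1) z.1.2) ('d w (z.1.1) z.1.2)
   ('d u (z.1.1) z.2) ('d w (z.1.1) z.2)).
split; [exact: W3o|by []| |].
- apply: fs => //.
  + exact: smooth_comp W3o W1 p1 us.
  + exact: smooth_comp W3o W1 p1 ws.
  + exact: smooth_diff_comp W3o W1 us p1 p2.
  + exact: smooth_diff_comp W3o W1 ws p1 p2.
  + exact: smooth_diff_comp W3o W1 us p1 p3.
  + exact: smooth_diff_comp W3o W1 ws p1 p3.
  + by move=> z /W1/lw'[n _]; exact: nlift_Re_gt0 n.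
- move=> z /W1 Wz; exact: (pullback_lift _ _ bf lw Wz).
Qed.

(** The formula of [hform_nlift] with real denominators, so that its smoothness reduces to that of
    the inverse of a positive real function. *)
Definition hexpr (u w b1 a1 b2 a2 : H) : R[i] :=
  inner b1 b2 + inner a2 a1
  + (inner b1 u * inner a2 w + inner u b2 * inner w a1) * ((complex.Re (inner u u))^-1)%:C
  - (inner b1 u + inner w a1) * (inner u b2 + inner a2 w)
    * ((complex.Re (inner u u))^-1 * 2^-1)%:C.

Lemma gform_lift : lift_formula (@gform R H) (fun u w b1 a1 b2 a2 =>
  complex.Re (hexpr u w b1 a1 b2 a2) : R^o).
Proof.
move=> q u w b1 a1 b2 a2 n _ _ _ _; rewrite /gform (hform_nlift _ _ _ _ n).
congr (complex.Re _); rewrite /hexpr.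
have -> : inner u u = (complex.Re (inner u u))%:C by rewrite inner_norm.
rewrite -!(fmorphV (real_complex R)) invfM; congr (_ - _ * _).
by rewrite rmorphM !fmorphV rmorph_nat mulrC.
Qed.

Lemma gform_smooth_formula : smooth_formula (fun u w b1 a1 b2 a2 =>
  complex.Re (hexpr u w b1 a1 b2 a2) : R^o).
Proof.
move=> D W u w b1 a1 b2 a2 Wo us ws b1s a1s b2s a2s u0; apply: smoothRe => //.
have iu : smooth W (fun x => (complex.Re (inner (u x : H) (u x : H)))^-1 : R^o).
  by apply: smooth_invr => // [x /u0/lt0r_neq0//|]; exact: smooth_rn_sqr.
have si (f g : D -> rH) : smooth W f -> smooth W g -> smooth W (fun x => inner (f x : H) (g x : H) : rC).
  exact: smooth_inner.
apply: smoothB => //; first (apply: smoothD => //; first (apply: smoothD => //; exact: si)).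
  apply: smooth_cmul => //; last exact: smoothRC.
  by apply: smoothD => //; apply: smooth_cmul => //; exact: si.
apply: smooth_cmul => //; last first.
  by apply: smoothRC => //; apply: smooth_mulr => //; exact: smooth_cst.
by apply: smooth_cmul => //; apply: smoothD => //; exact: si.
Qed.

Lemma gform_bilinear : bilinear_tensor M T (@gform R H).
Proof.
move=> p a A B C Mp TA TB TC; rewrite /gform !realified_scale.
rewrite hformZDl // hformZDr // conj_real; split; rewrite ReD ReM_real //.
Qed.

Lemma gform_sym q A B : M q -> T q A -> T q B -> gform q A B = gform q B A.
Proof. by move=> Mq TA TB; rewrite /gform (hform_conj Mq TB TA) complexRe_conj. Qed.

Lemma gform_riemannian : riemannian M T (@gform R H).
Proof.
split.
- exact: gform_bilinear.
- exact: smooth_tensor_lift gform_lift gform_smooth_formula.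
- exact: gform_sym.
- move=> q Mq; exists ((2 * hsnorm q)^-1); first by rewrite invr_gt0 mulr_gt0 // hsnorm_gt0.
  move=> A TA; have := hform_pos Mq TA; rewrite lecE => /andP[_].
  by rewrite mulrC.
Qed.

Lemma gform_I q A B : M q -> T q A -> T q B ->
  gform q (@ambientI R (bounded_op H) q A) B = complex.Im (hform q A B).
Proof.
move=> Mq TA TB; rewrite /gform /ambientI /mulI -[_ *: _]addr0.
rewrite hformZDl //; last exact: tangent0.
by rewrite hform0l // addr0 conj_imag mulNr ReN ReM_i opprK.
Qed.

Lemma gform_J q A B : M q -> T q A -> T q B ->
  gform q (Jbold q A) B = complex.Re (Omega q A B).
Proof. by move=> Mq TA TB; rewrite /gform Jbold_Omega. Qed.

Lemma gform_IJ q A B : M q -> T q A -> T q B ->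
  gform q (@ambientI R (bounded_op H) q (Jbold q A)) B = complex.Im (Omega q A B).
Proof.
by move=> Mq TA TB; rewrite gform_I ?Jbold_Omega //; exact: Jbold_tangent_in.
Qed.

(* The three Kaehler forms and [Omega] are constant-coefficient forms in the lift. *)
Definition flat_expr (k1 k2 k3 : R[i]) (u w b1 a1 b2 a2 : H) : R[i] :=
  k1 * (inner b1 b2 - inner b2 b1) + k2 * (inner a1 a2 - inner a2 a1)
  + k3 * (inner a1 b2 - inner a2 b1).

(** A common statement for [Omega] and the Kaehler forms: [l] is the identity, the real or the
    imaginary part, and the constants select among the flat forms of the pairs (u, u), (w, w) and
    (w, u). *)
Lemma closed_2form_lift (G : normedModType R) (b : rF -> rF -> rF -> G) (l : rC -> G) (c : R)
    (k1 k2 k3 : R[i]) :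
  linear l -> (forall z, `|l z| <= c * `|z|) ->
  bilinear_tensor M T b -> (forall p A, M p -> T p A -> b p A A = 0) ->
  lift_formula b (fun u w b1 a1 b2 a2 => l (flat_expr k1 k2 k3 u w b1 a1 b2 a2)) ->
  closed_2form M T b.
Proof.
move=> ll lc bl ba bf; split=> //.
- apply: (smooth_tensor_lift bf).
  move=> D W u w b1 a1 b2 a2 Wo us ws b1s a1s b2s a2s u0.
  apply: (@smooth_linear R D rC G W (fun x => flat_expr k1 k2 k3 (u x) (w x) (b1 x) (a1 x) (b2 x) (a2 x))
    l c ll lc Wo).
  have si (f g : D -> rH) : smooth W f -> smooth W g -> smooth W (fun x => inner (f x : H) (g x : H) : rC).
    exact: smooth_inner.
  have sk (k : R[i]) (f g : D -> rC) : smooth W f -> smooth W g ->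
      smooth W (fun x => k * (f x - g x : R[i]) : rC).
    by move=> fs gs; apply: smooth_cmul => //; [exact: smooth_cst|exact: smoothB].
  apply: smoothD => //; first (apply: smoothD => //).
  + by apply: sk; exact: si.
  + by apply: sk; exact: si.
  + by apply: sk; exact: si.
- move=> E V phi cV x A B C Vx.
  have [W [u [w [Wo Wx WV lw]]]] := chart_local_lift cV Vx; have [us ws _] := lw.
  pose beta y (A B : realified E) : rC := k1 * (flat_form u u y A B : R[i]) + k2 * (flat_form w w y A B : R[i])
     + k3 * (flat_form w u y A B : R[i]).
  have cb : closed_at beta x.
    have ck (k : R[i]) (f g : realified E -> rH) : smooth W f -> smooth W g ->
        closed_at (fun y (A B : realified E) => k * (flat_form f g y A B : R[i]) : rC) x.
      move=> fs gs; apply: (@closed_at_linear R (realified E) rC rC (flat_form f g)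
        (fun z => k * (z : R[i]) : rC) (rn k) x).
      - by move=> a y z; rewrite !realified_scale mulrDr; congr (_ + _); rewrite mulrCA.
      - by move=> z; rewrite !realified_norm rnM.
      - exact: flat_form_closed Wo fs gs Wx.
    by apply: closed_atD; [apply: closed_atD|]; exact: ck.
  have [_ cl] := closed_at_linear ll lc cb.
  suff [_ ->] : closed_at (pullback phi b) x by [].
  apply: closed_at_congr (closed_at_linear ll lc cb) => A' B'.
  apply: (open_near Wo Wx) => y Wy; rewrite (pullback_lift _ _ bf lw Wy).
  have D (f : realified E -> rH) v : smooth W f -> 'D_v f y = 'd f y v :> rH.
    by move=> fs; rewrite deriveE //; exact: smooth_differentiable fs Wy.
  by rewrite /beta /flat_form /flat_expr !D.
Qed.

Lemma Omega_closed : closed_2form M T (@Omega R H : rF -> rF -> rF -> rC).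
Proof.
apply: (@closed_2form_lift rC _ id 1 0 0 'i%C) => //.
- by move=> z; rewrite mul1r.
- move=> p a A B C Mp TA TB TC; rewrite !realified_scale.
  by rewrite OmegaZDl // OmegaZDr.
- move=> p A Mp TA; have := Omega_antisym Mp TA TA.
  move/eqP; rewrite -subr_eq0 opprK -mulr2n mulrn_eq0 /= => /eqP; exact.
- move=> q u w b1 a1 b2 a2 n c1 _ c2 _; rewrite (Omega_lift (nlift_lift n) c1 c2).
  by rewrite /flat_expr !mul0r !add0r.
Qed.

(** Forms such as [gform q (Jbold q A) B] are identified with parts of [hform] or [Omega] on tangent
    vectors only; this is enough, since differentials of charts are tangent. *)
Lemma closed_2form_ext (G : normedModType R) (b b' : rF -> rF -> rF -> G) :
  (forall q A B, M q -> T q A -> T q B -> b q A B = b' q A B) ->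
  closed_2form M T b -> closed_2form M T b'.
Proof.
move=> bb' [bl bs ba bc].
have pb (E : completeNormedModType R[i]) V (phi : realified E -> rF) y (A B : realified E) :
    chart M T V phi -> V y -> pullback phi b y A B = pullback phi b' y A B.
  move=> cV Vy; apply: bb'; first exact: chart_projection cV Vy.
    exact: chart_diff_tangent cV Vy.
  exact: chart_diff_tangent cV Vy.
split.
- move=> p a A B C Mp TA TB TC; have [h1 h2] := bl p a A B C Mp TA TB TC.
  have TAB : T p (a *: A + B) by exact: tangentZD.
  by rewrite -!bb'.
- move=> E V phi cV; have [Vo _ _ _] := cV.
  apply: smooth_congr (bs E V phi cV); first by do 2 apply: open_setXT.
  by move=> [[x A] B] [[/= Vx _] _]; exact: (pb _ _ _ _ _ _ cV Vx).
- by move=> p A Mp TA; rewrite -bb' // ba.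
- move=> E V phi cV x A B C Vx; have [Vo _ _ _] := cV.
  have N (A' B' : realified E) : \near x, pullback phi b x A' B' = pullback phi b' x A' B'.
    by apply: (open_near Vo Vx) => y Vy; exact: (pb _ _ _ _ _ _ cV Vy).
  rewrite -[RHS](bc E V phi cV x A B C Vx) /dext.
  by rewrite (near_eq_derive A (N B C)) (near_eq_derive B (N A C)) (near_eq_derive C (N A B)).
Qed.

Lemma closed_2form_linear (b : rF -> rF -> rF -> rC) (l : rC -> R^o) (c : R) (k1 k2 k3 : R[i]) :
  linear l -> (forall z, `|l z| <= c * `|z|) -> 
  bilinear_tensor M T b -> (forall p A, M p -> T p A -> l (b p A A) = 0) ->
  lift_formula (fun p A B => l (b p A B)) (fun u w b1 a1 b2 a2 => l (flat_expr k1 k2 k3 u w b1 a1 b2 a2)) ->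
  closed_2form M T (fun p A B => l (b p A B)).
Proof.
move=> ll lc bl ba bf; apply: (closed_2form_lift ll lc _ ba bf).
move=> p a A B C Mp TA TB TC; have [-> ->] := bl p a A B C Mp TA TB TC.
by rewrite !ll.
Qed.

End TensorsOnProjections.

(** * The hyperkaehler structure *)

Section KahlerHolomorphic.
Variables (R : realType) (H : hilbertType R).
Implicit Types (q : bounded_op H).

Local Notation rn x := (complex.Re `|x|).
Local Notation rC := (realified R[i]^o).
Local Notation rH := (realified H).
Local Notation rF := (realified (bounded_op H)).
Local Notation M := (@projections R H).
Local Notation T := (@tangent R H).
Local Notation I := (@ambientI R (bounded_op H)).

Lemma smooth_ddyad (D : normedModType R) (W : set D) (u w b a : D -> rH) :
  open W -> smooth W u -> smooth W w -> smooth W b -> smooth W a ->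
  smooth W (fun x => ddyad (u x : H) (w x : H) (b x : H) (a x : H) : rF).
Proof.
move=> Wo us ws bs as'; apply: (@smoothD R D rF) => //.
  exact: (smooth_dyad Wo bs ws).
exact: (smooth_dyad Wo us as').
Qed.

Definition smooth_on_charts (J : rF -> rF -> rF) :=
  forall (E : completeNormedModType R[i]) V (phi : realified E -> rF),
    chart M T V phi ->
    smooth (V `*` setT)
      (fun z : realified E * realified E => J (phi z.1) ('d phi (z.1) z.2)).

Lemma smooth_on_charts_lift (J : rF -> rF -> rF) (f : H -> H -> H -> H -> bounded_op H) :
  (forall q u w b a, is_nlift q u w -> J q (ddyad u w b a) = f u w b a) ->
  (forall (D : normedModType R) (W : set D) (u w b a : D -> rH), open W ->
    smooth W u -> smooth W w -> smooth W b -> smooth W a ->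
    (forall x, W x -> 0 < complex.Re (inner (u x : H) (u x : H))) ->
    smooth W (fun x => f (u x) (w x) (b x) (a x) : rF)) ->
  smooth_on_charts J.
Proof.
move=> Jf fs E V phi cV; apply: smooth_local => -[x A] [/= Vx _].
have [W [u [w [Wo Wx WV lw]]]] := chart_local_lift cV Vx.
have [us ws lw'] := lw.
pose W2 : set (realified E * realified E) := W `*` setT.
have W2o : open W2 by exact: open_setXT.
have p1 : smooth W2 fst by exact: smooth_fst.
have p2 : smooth W2 snd by exact: smooth_snd.
have W1 z : W2 z -> W z.1 by move=> [].
exists W2, (fun z => f (u z.1) (w z.1) ('d u (z.1) z.2) ('d w (z.1) z.2)).
split; [exact: W2o|by []| |].
- apply: (fs _ _ _ _ _ _ W2o).
  + exact: smooth_comp W2o W1 p1 us.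
  + exact: smooth_comp W2o W1 p1 ws.
  + exact: smooth_diff_comp W2o W1 us p1 p2.
  + exact: smooth_diff_comp W2o W1 ws p1 p2.
  + by move=> z /W1/lw'[n _]; exact: nlift_Re_gt0 n.
- move=> z /W1/lw'[n d]; have [-> _ _] := d z.2; exact: Jf.
Qed.

Lemma Jbold_smooth : smooth_on_charts (@Jbold R H).
Proof.
pose l (u w b a : H) : R[i] :=
  ('i%C * (2^-1 * (complex.Re (inner u u))^-1)%:C) * (inner w a - inner b u).
apply: (@smooth_on_charts_lift _ (fun u w b a =>
  ddyad u w (- 'i%C *: a + l u w b a *: w) (- 'i%C *: b + (l u w b a)^* *: u))).
  move=> q u w b a n; have lE : 'i%C / (2 * inner u u) * (inner w a - inner b u) = l u w b a.
    rewrite /l; congr (_ * _ * _); rewrite [in LHS](_ : inner u u = (complex.Re (inner u u))%:C).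
      by rewrite invfM rmorphM !fmorphV rmorph_nat.
    by rewrite inner_norm.
  by rewrite (Jbold_nlift _ _ n) /= lE.
move=> D W u w b a Wo us ws bs as' u0.
have iu : smooth W (fun x => (complex.Re (inner (u x : H) (u x : H)))^-1 : R^o).
  by apply: smooth_invr => // [x /u0/lt0r_neq0//|]; exact: smooth_rn_sqr.
have si (f g : D -> rH) : smooth W f -> smooth W g -> smooth W (fun x => inner (f x : H) (g x : H) : rC).
  exact: smooth_inner.
have ls : smooth W (fun x => l (u x) (w x) (b x) (a x) : rC).
  apply: smooth_cmul => //; last by apply: smoothB => //; exact: si.
  apply: smooth_cmul => //; first exact: smooth_cst.
  by apply: smoothRC => //; apply: smooth_mulr => //; exact: smooth_cst.
have sc (k : D -> rC) (f : D -> rH) : smooth W k -> smooth W f ->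
    smooth W (fun x => (k x : R[i]) *: (f x : H) : rH).
  exact: smooth_cscale.
apply: smooth_ddyad => //.
  by apply: (@smoothD R D rH) => //; apply: sc => //; exact: smooth_cst.
by apply: (@smoothD R D rH) => //; apply: sc => //; [exact: smooth_cst|exact: smooth_conj].
Qed.

Lemma Jthird_smooth : smooth_on_charts (@Jthird R H).
Proof.
apply: (@smooth_on_charts_lift _ (fun u w b a =>
   ddyad u w ('i%C *: b) ('i%C *: a) + ('i%C * (inner a u - inner w b)) *: dyad u w)).
  by move=> q u w b a [-> wu _]; rewrite Jthird_lift.
move=> D W u w b a Wo us ws bs as' u0.
have si (f g : D -> rH) : smooth W f -> smooth W g -> smooth W (fun x => inner (f x : H) (g x : H) : rC).
  exact: smooth_inner.
have sc (f : D -> rH) : smooth W f -> smooth W (fun x => 'i%C *: (f x : H) : rH).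
  by move=> fs; apply: (@smooth_cscale R D W Wo H (fun=> 'i%C) f) => //; exact: smooth_cst.
apply: (@smoothD R D rF) => //; first by apply: smooth_ddyad => //; exact: sc.
apply: smooth_cscale => //; last exact: smooth_dyad.
apply: smooth_cmul => //; first exact: smooth_cst.
by apply: smoothB => //; exact: si.
Qed.

Lemma I_smooth : smooth_on_charts I.
Proof.
move=> E V phi [Vo ps _ _]; apply: smooth_cscale; first exact: open_setXT.
  exact: smooth_cst.
exact: smooth_diff.
Qed.

Lemma I_almost_complex : almost_complex M T I.
Proof.
split; last exact: I_smooth.
- by move=> p A _ TA; exact: tangentZ.
- move=> p a A B _ _ _; rewrite /ambientI /mulI !realified_scale scalerDr !scalerA.
  by rewrite mulrC.
- by move=> p A _ _; rewrite /ambientI /mulI scalerA mul_imag scaleN1r.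
Qed.

Lemma Jbold_almost_complex : almost_complex M T (@Jbold R H).
Proof.
split; last exact: Jbold_smooth.
- by move=> p A Mp TA; exact: Jbold_tangent_in.
- by move=> p a A B Mp TA TB; rewrite !realified_scale JboldZD // conj_real.
- by move=> p A Mp TA; exact: Jbold_sqr.
Qed.

Lemma Jthird_almost_complex : almost_complex M T (@Jthird R H).
Proof.
split; last exact: Jthird_smooth.
- by move=> p A Mp TA; exact: Jthird_tangent_in.
- by move=> p a A B Mp TA TB; rewrite !realified_scale JthirdZD.
- by move=> p A Mp TA; exact: Jthird_sqr.
Qed.

Lemma I_Jbold_anticommute : tensors_anticommute M T I (@Jbold R H).
Proof. by move=> p A Mp TA; exact: Jbold_anti. Qed.

Lemma I_Jthird_commute : tensors_commute M T I (@Jthird R H).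
Proof. by move=> p A Mp TA; rewrite /ambientI /mulI -Jthird_scale. Qed.

Lemma linear_Re : linear (fun z : rC => complex.Re z : R^o).
Proof. by move=> a x y; rewrite realified_scale ReD ReM_real. Qed.

Lemma linear_Im : linear (fun z : rC => complex.Im z : R^o).
Proof. by move=> a [x1 x2] [y1 y2] /=; rewrite mul0r addr0. Qed.

Lemma Im_bound (z : rC) : `|complex.Im z : R^o| <= 1 * `|z|.
Proof.
by rewrite mul1r ImZ_Re normrN; apply: le_trans (rn_ge_Re _) _; rewrite rnM rn_i mul1r.
Qed.

Lemma Re_bound (z : rC) : `|complex.Re z : R^o| <= 1 * `|z|.
Proof. by rewrite mul1r; exact: rn_ge_Re. Qed.

Lemma ImHform_closed : closed_2form M T (fun p A B => complex.Im (hform p A B) : R^o).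
Proof.
apply: (closed_2form_lift (l := fun z : rC => complex.Re z : R^o) (c := 1)
  (k1 := - 'i%C / 2) (k2 := 'i%C / 2) (k3 := 0) linear_Re Re_bound).
- move=> p a A B C Mp TA TB TC; rewrite !realified_scale.
  rewrite hformZDl // hformZDr // conj_real; move: (hform _ _ _) (hform _ _ _) (hform _ _ _) (hform _ _ _).
  by move=> [x1 x2] [y1 y2] [z1 z2] [t1 t2] /=; rewrite !mul0r !addr0.
- move=> p A Mp TA; have := hform_conj Mp TA TA; case: (hform _ _ _) => x y [] /= h.
  lra.
- move=> q u w b1 a1 b2 a2 n _ r1 _ r2; rewrite (Im_hform n r1 r2) /flat_expr mul0r addr0.
  rewrite (innerC b2 b1) (innerC a2 a1).
  have e2 : 2^-1 = (2^-1)%:C :> R[i] by rewrite fmorphV rmorph_nat.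
  rewrite e2; case: (inner b1 b2) => x1 x2; case: (inner a1 a2) => y1 y2 /=.
  by field.
Qed.

Lemma ReOmega_closed : closed_2form M T (fun p A B => complex.Re (Omega p A B) : R^o).
Proof.
have [bl _ ba _] := Omega_closed H.
apply: (closed_2form_linear (k1 := 0) (k2 := 0) (k3 := 'i%C) linear_Re Re_bound bl).
  by move=> p A Mp TA; rewrite ba.
move=> q u w b1 a1 b2 a2 n c1 _ c2 _; rewrite (Omega_lift (nlift_lift n) c1 c2).
by rewrite /flat_expr !mul0r !add0r.
Qed.

Lemma ImOmega_closed : closed_2form M T (fun p A B => complex.Im (Omega p A B) : R^o).
Proof.
have [bl _ ba _] := Omega_closed H.
apply: (closed_2form_linear (k1 := 0) (k2 := 0) (k3 := 'i%C) linear_Im Im_bound bl).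
  by move=> p A Mp TA; rewrite ba.
move=> q u w b1 a1 b2 a2 n c1 _ c2 _; rewrite (Omega_lift (nlift_lift n) c1 c2).
by rewrite /flat_expr !mul0r !add0r.
Qed.

Lemma gform_hyperkahler : hyperkahler M T (@gform R H) I (@Jbold R H).
Proof.
split.
- exact: gform_riemannian.
- split; [exact: I_almost_complex|exact: Jbold_almost_complex].
- exact: I_Jbold_anticommute.
- split.
  + by apply: closed_2form_ext ImHform_closed => q A B Mq TA TB; rewrite gform_I.
  + by apply: closed_2form_ext ReOmega_closed => q A B Mq TA TB; rewrite gform_J.
  + by apply: closed_2form_ext ImOmega_closed => q A B Mq TA TB; rewrite gform_IJ.
Qed.

Lemma pullback_smooth (G : normedModType R) (b : rF -> rF -> rF -> G)
    (E : completeNormedModType R[i]) V (phi : realified E -> rF) (A B : realified E) :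
  smooth_tensor M T b -> chart M T V phi -> smooth V (fun y => pullback phi b y A B).
Proof.
move=> bs cV; have [Vo _ _ _] := cV.
apply: (@smooth_comp R (realified E) (realified E * realified E * realified E)%type G V
  (V `*` setT `*` setT) (fun y => (y, A, B)) (fun z => pullback phi b z.1.1 z.1.2 z.2)) => //.
  apply: smooth_pair => //; last exact: smooth_cst.
  by apply: smooth_pair => //; [exact: smooth_id|exact: smooth_cst].
exact: bs cV.
Qed.

Lemma linear_mulI (E : normedModType R[i]) : linear (@mulI R E).
Proof. by move=> a x y; rewrite /mulI !realified_scale scalerDr !scalerA mulrC. Qed.

Lemma mulI_bound (E : normedModType R[i]) (z : realified E) : `|mulI z| <= 1 * `|z|.
Proof. by rewrite !realified_norm Re_normZ rn_i mul1r. Qed.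

(** The two equations are closedness of a form on (v, A, B) and on (i v, A, B). In the second, the
    terms where i v is an argument of the form are [mulI] of their counterparts, so the remaining
    derivative along i v is [mulI] of the one along v. *)
Lemma mulI_cocycle (E : normedModType R[i]) (b c d a c' d' : realified E) :
  b - c + d = 0 -> a - c' + d' = 0 -> c' = mulI c -> d' = mulI d -> a = mulI b.
Proof.
move=> e1 e2 ec ed; have -> : b = c - d.
  by apply/eqP; rewrite -subr_eq0 opprB addrA addrAC; apply/eqP.
have -> : a = c' - d' by apply/eqP; rewrite -subr_eq0 opprB addrA addrAC; apply/eqP.
by rewrite ec ed /mulI scalerBr.
Qed.

(* A closed 2-form of type (2,0) has holomorphic coefficients. *)
Lemma Omega_holomorphic (E : completeNormedModType R[i]) V (phi : realified E -> rF) :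
  holomorphic_chart M T V phi -> forall x A B v, V x ->
  'D_(mulI v) (fun y => pullback phi (@Omega R H : rF -> rF -> rF -> rC) y A B) x
  = mulI ('D_v (fun y => pullback phi (@Omega R H : rF -> rF -> rF -> rC) y A B) x).
Proof.
move=> [cV hV] x A B v Vx; have [Vo _ _ _] := cV.
set P := pullback phi _.
have [_ bs _ bc] := Omega_closed H.
have Pd A' B' : differentiable (fun y => P y A' B') x.
  exact: smooth_differentiable (pullback_smooth A' B' bs cV) Vx.
have PI B' : \near x, P x (mulI v) B' = mulI (P x v B').
  apply: (open_near Vo Vx) => y Vy; rewrite /P /pullback hV // /ambientI.
  have Mq := chart_projection cV Vy.
  have TT v' : T (phi y) ('d phi y v') by exact: chart_diff_tangent cV Vy.
  have := OmegaZDl 'i%C Mq (TT v) (tangent0 _) (TT B').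
  rewrite addr0 => ->; have := OmegaZDl (-1) Mq (tangent0 _) (tangent0 _) (TT B').
  by rewrite scaler0 addr0 mulN1r addNr => ->; rewrite addr0.
have DI A' B' : 'D_A' (fun y => P y (mulI v) B') x = mulI ('D_A' (fun y => P y v B') x).
  rewrite (near_eq_derive A' (PI B')).
  exact: derive_bound_linear (@linear_mulI _) (@mulI_bound _) (Pd v B').
have e1 := bc E V phi cV x v A B Vx; have e2 := bc E V phi cV x (mulI v) A B Vx.
exact: (mulI_cocycle e1 e2 (DI A B) (DI B A)).
Qed.

Lemma Omega_holomorphic_symplectic :
  holomorphic_symplectic M T (@Omega R H : rF -> rF -> rF -> rC).
Proof.
split.
- exact: Omega_closed.
- move=> p A B Mp TA TB; split; rewrite /mulI.
    rewrite -[_ *: (A : bounded_op H)]addr0 OmegaZDl //; last exact: tangent0.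
    have := OmegaZDl (-1) Mp (tangent0 _) (tangent0 _) TB.
    by rewrite scaler0 addr0 mulN1r addNr => ->; rewrite addr0.
  rewrite -[_ *: (B : bounded_op H)]addr0 OmegaZDr //; last exact: tangent0.
  have := OmegaZDr (-1) Mp (tangent0 _) (tangent0 _) TA.
  by rewrite scaler0 addr0 mulN1r addNr => ->; rewrite addr0.
- by move=> E V phi hV x A B v; exact: Omega_holomorphic.
- by move=> p l Mp ll lc; exact: Omega_nondegenerate.
Qed.

End KahlerHolomorphic.

(** * The potential *)

Section KahlerPotential.
Variables (R : realType).
Local Notation rC := (realified R[i]^o).

Lemma derive_RC (E : normedModType R) (f : E -> R^o) x v : differentiable f x ->
  'D_v (fun y => (f y)%:C : rC) x = ('D_v f x)%:C.
Proof.
apply: (@derive_bound_linear R E R^o rC f (fun z => z%:C : rC) 1) => [a y z|z].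
  by rewrite rmorphD rmorphM.
by rewrite mul1r realified_norm normc_def /= expr0n addr0 sqrtr_sqr.
Qed.

(* For a real function the mixed terms combine into [d] of the twisted differential. *)
Lemma i_ddbar_real (E : normedModType R[i]) (V : set (realified E)) (t : realified E -> R^o) x A B :
  open V -> smooth V t -> V x ->
  i_ddbar t x A B =
  (- 2^-1 * ('D_A ('D_(mulI B) t) x - 'D_B ('D_(mulI A) t) x))%:C.
Proof.
move=> Vo ts Vx.
have dt y : V y -> differentiable t y by exact: smooth_differentiable.
have Dt v : differentiable ('D_v t) x.
  exact: smooth_differentiable (smooth_derive v Vo ts) Vx.
pose K a b := 'D_a ('D_b t) x.
have Ks a b : K a b = K b a by exact: derive_sym_real Vo ts Vx.
pose f : realified E -> rC := fun y => (t y)%:C.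
have Df y v : V y -> 'D_v f y = ('D_v t y)%:C :> R[i].
  by move=> Vy; apply: derive_RC; exact: dt.
(* [delbar] of a real function is the image under this bounded real linear map of two real
   derivatives, which allows differentiating it once more. *)
pose L (p : R^o * R^o) : rC := 2^-1 * (p.1%:C + 'i%C * p.2%:C).
have [Ll Lb] : linear L /\ forall p, `|L p| <= 1 * `|p|.
  split=> [a [p1 p2] [r1 r2]|[p1 p2]].
    rewrite /L /= realified_scale !rmorphD !rmorphM /=.
    rewrite -[RHS]/((a%:C * (2^-1 * (p1%:C + 'i%C * p2%:C))
      + 2^-1 * (r1%:C + 'i%C * r2%:C) : R[i])); ring.
  rewrite mul1r realified_norm rnM.
  have -> : complex.Re `|(2^-1 : R[i])| = 2^-1 by rewrite normfV ger0_norm ?ler0n // -(rmorph_nat (real_complex R)) -fmorphV.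
  have h : complex.Re `|p1%:C + 'i%C * p2%:C| <= `|p1| + `|p2|.
    apply: le_trans (Re_normD (p1%:C : R[i]^o) ('i%C * p2%:C : R[i]^o)) _.
    rewrite rnM rn_i mul1r !normc_def /= !expr0n !addr0 !sqrtr_sqr.
    by [].
  have m1 : `|p1| <= `|(p1, p2)| by rewrite num_le_max lexx.
  have m2 : `|p2| <= `|(p1, p2)| by rewrite num_le_max lexx orbT.
  move: h m1 m2; move: (complex.Re _) (`|p1|) (`|p2|) (`|(p1, p2)|) => n a b c; lra.
pose d (b : realified E) (y : realified E) : rC := L ('D_b t y, 'D_(mulI b) t y).
have dbarE b : \near x, delbar b f x = d b x.
  by apply: (open_near Vo Vx) => y Vy; rewrite /delbar !Df.
have Dd a b : 'D_a (d b) x = 2^-1 * ((K a b)%:C + 'i%C * (K a (mulI b))%:C) :> R[i].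
  have dp := differentiable_pair (Dt b) (Dt (mulI b)).
  rewrite (derive_bound_linear a Ll Lb dp) deriveE // diff_pair //.
  by rewrite /L /K /= !deriveE.
have Db a b : 'D_a (delbar b f) x = 2^-1 * ((K a b)%:C + 'i%C * (K a (mulI b))%:C) :> R[i].
  by rewrite (near_eq_derive a (dbarE b)) Dd.
pose kk a b : R[i] := 2^-1 * (2^-1 * ((K a b)%:C + 'i%C * (K a (mulI b))%:C)
  - 'i%C * (2^-1 * ((K (mulI a) b)%:C + 'i%C * (K (mulI a) (mulI b))%:C))).
have delE a b : del a (delbar b f) x = kk a b :> R[i].
  exact: (congr2 (fun y z : R[i] => 2^-1 * (y - 'i%C * z)) (Db a b) (Db (mulI a) b)).
transitivity ('i%C * (kk A B - kk B A)).
  exact: (congr2 (fun y z : R[i] => 'i%C * (y - z)) (delE A B) (delE B A)).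
rewrite -/(K A (mulI B)) -/(K B (mulI A)) /kk.
rewrite (Ks (mulI A) B) (Ks (mulI B) A) (Ks B A) (Ks (mulI B) (mulI A)).
have e2 : 2^-1 = (2^-1)%:C :> R[i] by rewrite fmorphV rmorph_nat.
move: (K A B) (K (mulI A) (mulI B)) (K B (mulI A)) (K A (mulI B)) => k1 k2 k3 k4; rewrite e2.
by apply/eqP; rewrite eq_complex /=; apply/andP; split; apply/eqP; field.
Qed.

End KahlerPotential.

(** * The Hilbert-Schmidt norm as a potential *)

Section HilbertSchmidtPotential.
Variables (R : realType) (H : hilbertType R).

Local Notation rC := (realified R[i]^o).
Local Notation rH := (realified H).
Local Notation rF := (realified (bounded_op H)).
Local Notation M := (@projections R H).
Local Notation T := (@tangent R H).
Local Notation I := (@ambientI R (bounded_op H)).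

Lemma local_lift_hsnorm (E : normedModType R) (W : set E) (phi : E -> rF) u w y :
  local_lift W phi u w -> W y -> hsnorm (phi y) = complex.Re (inner (u y : H) (u y : H)).
Proof. by move=> [_ _ lw] /lw[/nlift_hsnorm <-]. Qed.

Lemma hsnorm_smooth (E : completeNormedModType R[i]) V (phi : realified E -> rF) :
  chart M T V phi -> smooth V (fun y => hsnorm (phi y) : R^o).
Proof.
move=> cV; apply: smooth_local => x Vx.
have [W [u [w [Wo Wx WV lw]]]] := chart_local_lift cV Vx; have [us ws _] := lw.
exists W, (fun y => complex.Re (inner (u y : H) (u y : H)) : R^o).
split; [exact: Wo|exact: Wx|exact: smooth_rn_sqr|].
by move=> y Wy; exact: local_lift_hsnorm lw Wy.
Qed.

(** The derivative of |u|^2 is shared equally between |u|^2 and |w|^2, whose derivatives agree. The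
    resulting complex number <du, u> + <w, dw> is tr (adj A q) / |u|^2 for the tangent vector A: it
    depends on A alone and is antilinear in it. *)
Lemma derive_hsnorm (E : normedModType R) (W : set E) (phi : E -> rF) u w y v :
  open W -> local_lift W phi u w -> W y ->
  'D_v (fun z => hsnorm (phi z) : R^o) y =
  complex.Re (inner ('d u y v : H) (u y : H) + inner (w y : H) ('d w y v : H)).
Proof.
move=> Wo lw Wy; have [us ws lw'] := lw.
have du := smooth_differentiable us Wy.
have N : \near y, hsnorm (phi y) = complex.Re (inner (u y : H) (u y : H)).
  by apply: (open_near Wo Wy) => z Wz; exact: local_lift_hsnorm lw Wz.
rewrite (near_eq_derive v N).
have di : differentiable (fun z => inner (u z : H) (u z : H) : rC) y.
  exact: smooth_differentiable (smooth_inner Wo us us) Wy.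
rewrite (derive_bound_linear v (@linear_Re R) (@Re_bound R) di).
rewrite (congr1 (@complex.Re R) (derive_inner v du du)) !ReD !deriveE //.
have [n d] := lw' y Wy; have [_ _ r] := d v.
have fin (a b c : R) : a = c -> a + b = b + c by move=> ->; rewrite addrC.
exact: fin r.
Qed.

Lemma twisted_derive_hsnorm (E : completeNormedModType R[i]) V (phi : realified E -> rF)
    (W : set (realified E)) u w y v :
  holomorphic_chart M T V phi -> open W -> W `<=` V -> local_lift W phi u w -> W y ->
  'D_(mulI v) (fun z => hsnorm (phi z) : R^o) y =
  complex.Im (inner (w y : H) ('d w y v : H)) - complex.Im (inner (u y : H) ('d u y v : H)).
Proof.
move=> [cV hV] Wo WV lw Wy; rewrite (derive_hsnorm _ Wo lw Wy).
have [us ws lw'] := lw; have [n d] := lw' y Wy.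
have [e1 _ _] := d v; have [e2 _ _] := d (mulI v).
have := hV y v (WV _ Wy); rewrite e1 e2 /ambientI /mulI => e.
have [qE wu uw] := n.
(* The differential of the lift along i v is not i times the one along v; pairing with [q] under the
   trace gives a quantity independent of the lift, which is multiplied by - i. *)
have := congr1 (fun A : bounded_op H => tr (adj A * dyad (u y) (w y))) e.
rewrite adjZ op_scaleAl trZ; last by apply: dyadicMl; exact: dyadic_dyad.
rewrite !adj_ddyad !tr_ddyad_dyad conj_imag -uw => h.
have u0 : inner (u y : H) (u y) != 0 by rewrite gt_eqF // (nlift_gt0 n).
have -> : inner ('d u y (mulI v) : H) (u y : H) + inner (w y : H) ('d w y (mulI v) : H)
   = - 'i%C * (inner ('d u y v : H) (u y : H) + inner (w y : H) ('d w y v : H)).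
  apply: (mulfI u0); rewrite mulrDr [LHS]addrC [X in _ + X]mulrC h; ring.
rewrite mulNr ReN ReM_i opprK (innerC ('d u y v : H)).
by case: (inner _ _) => a b; case: (inner _ _) => a' b' /=; rewrite addrC.
Qed.

(** This evaluates the exterior derivative of Im (<w, dw> - <u, du>): second derivatives cancel by
    symmetry, and the first-order terms appear twice, which the factor one half absorbs. *)
Lemma twisted_flat (u0 w0 ua ub wa wb su1 su2 sw1 sw2 : H) : su1 = su2 -> sw1 = sw2 ->
  complex.Im (inner ua ub) - complex.Im (inner wa wb) =
  - 2^-1 * (complex.Im ((inner w0 sw2 + inner wa wb) - (inner u0 su2 + inner ua ub))
            - complex.Im ((inner w0 sw1 + inner wb wa) - (inner u0 su1 + inner ub ua))).
Proof.
move=> -> ->; rewrite (innerC wb) (innerC ub).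
move: (inner ua ub) (inner wa wb) (inner w0 sw2) (inner u0 su2).
by move=> [a1 a2] [b1 b2] [c1 c2] [e1 e2] /=; field.
Qed.

Lemma hsnorm_kahler_potential : kahler_potential M T (@hsnorm R H : rF -> R^o) (@gform R H).
Proof.
move=> E V phi hV; have [cV hd] := hV; have ts := hsnorm_smooth cV.
split=> [|x A B Vx]; first exact: ts.
have [Vo _ _ _] := cV.
rewrite (i_ddbar_real A (mulI B) Vo ts Vx).
have [W [u [w [Wo Wx WV lw]]]] := chart_local_lift cV Vx; have [us ws lw'] := lw.
pose k v (y : realified E) : rC :=
  inner (w y : H) ('D_v w y : H) - inner (u y : H) ('D_v u y : H).
have tw v : \near x, 'D_(mulI v) (fun z => hsnorm (phi z) : R^o) x = complex.Im (k v x) :> R^o.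
  apply: (open_near Wo Wx) => y Wy; rewrite (twisted_derive_hsnorm v hV Wo WV lw Wy).
  rewrite /k !deriveE; [|exact: smooth_differentiable us Wy|exact: smooth_differentiable ws Wy].
  by case: (inner _ _) => a b; case: (inner _ _).
have du := smooth_differentiable us Wx; have dw := smooth_differentiable ws Wx.
have Ddu v : differentiable ('D_v u) x by exact: smooth_differentiable (smooth_derive v Wo us) Wx.
have Ddw v : differentiable ('D_v w) x by exact: smooth_differentiable (smooth_derive v Wo ws) Wx.
have iw v : differentiable (fun y => inner (w y : H) ('D_v w y : H) : rC) x.
  apply: smooth_differentiable (W) _ _ _ Wx.
  by apply: smooth_inner => //; exact: smooth_derive.
have iu v : differentiable (fun y => inner (u y : H) ('D_v u y : H) : rC) x.
  apply: smooth_differentiable (W) _ _ _ Wx.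
  by apply: smooth_inner => //; exact: smooth_derive.
have Dk a v : 'D_a (k v) x =
   (inner (w x : H) ('D_a ('D_v w) x : H) + inner ('D_a w x : H) ('D_v w x : H))
   - (inner (u x : H) ('D_a ('D_v u) x : H) + inner ('D_a u x : H) ('D_v u x : H)) :> R[i].
  pose i1 (y : realified E) : rC := inner (w y : H) ('D_v w y : H).
  pose i2 (y : realified E) : rC := inner (u y : H) ('D_v u y : H).
  have e : 'D_a (i1 - i2) x = 'D_a i1 x - 'D_a i2 x.
    by apply: deriveB; apply: diff_derivable; [exact: iw|exact: iu].
  apply: (etrans e).
  exact: (congr2 (fun y z : R[i] => y - z) (derive_inner a dw (Ddw v)) (derive_inner a du (Ddu v))).
have Dt a v : 'D_a ('D_(mulI v) (fun z => hsnorm (phi z) : R^o)) x = complex.Im ('D_a (k v) x : R[i]).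
  rewrite (near_eq_derive a (tw v)).
  apply: (derive_bound_linear a (@linear_Im R) (@Im_bound R)).
  exact: differentiableB (iw v) (iu v).
have [n d] := lw' x Wx.
(* Since h is linear in its second argument, Re h(A, B) = Im h(A, i B), to which [Im_hform]
   applies. *)
have gE : pullback phi (@gform R H) x A B =
    complex.Im (inner ('d u x A : H) ('d u x (mulI B) : H))
    - complex.Im (inner ('d w x A : H) ('d w x (mulI B) : H)).
  have Mq := chart_projection cV Vx.
  have TT v : T (phi x) ('d phi x v) by exact: chart_diff_tangent cV Vx.
  have [eA _ rA] := d A; have [eB _ rB] := d (mulI B).
  have h : complex.Im (hform (phi x) ('d phi x A) ('d phi x (mulI B))) =
      complex.Im (inner ('d u x A : H) ('d u x (mulI B) : H))
      - complex.Im (inner ('d w x A : H) ('d w x (mulI B) : H)).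
    by rewrite eA eB; exact: Im_hform n rA rB.
  apply: etrans h; rewrite (hd x B Vx) /ambientI /mulI.
  have := hformZDr 'i%C Mq (TT B) (tangent0 _) (TT A).
  rewrite addr0 => ->; have := hformZDr (-1) Mq (tangent0 _) (tangent0 _) (TT A).
  rewrite scaler0 addr0 mulN1r addNr => ->.
  by rewrite addr0 mulrC ImiRe.
have gE' : pullback phi (@gform R H) x A B =
    complex.Im (inner ('D_A u x : H) ('D_(mulI B) u x : H))
    - complex.Im (inner ('D_A w x : H) ('D_(mulI B) w x : H)).
  apply: etrans gE _; apply: (congr2 (fun y z : R => y - z)); apply: (congr1 (@complex.Im R)).
    exact: (congr2 (@inner R H) (esym (deriveE A du)) (esym (deriveE (mulI B) du))).
  exact: (congr2 (@inner R H) (esym (deriveE A dw)) (esym (deriveE (mulI B) dw))).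
have Dt' a v := etrans (Dt a v) (congr1 (@complex.Im R) (Dk a v)).
apply: (congr1 (real_complex R)); apply: (etrans gE').
apply: (etrans (twisted_flat (u x) (w x) _ _ _ _ (derive_symH A (mulI B) Wo us Wx)
  (derive_symH A (mulI B) Wo ws Wx))).
exact: (esym (congr2 (fun y z : R => - 2^-1 * (y - z)) (Dt' A (mulI B)) (Dt' (mulI B) A))).
Qed.

End HilbertSchmidtPotential.

(** * Complex charts *)

Section ModelSpace.
Variables (R : realType) (H : hilbertType R) (e : H) (s1 s2 : bool).

Local Notation rn x := (complex.Re `|x|).

Definition conj_if (s : bool) (a : R[i]) : R[i] := if s then a^* else a.

Lemma conj_ifD s a b : conj_if s (a + b) = conj_if s a + conj_if s b.
Proof. by case: s; rewrite //= rmorphD. Qed.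

Lemma conj_ifM s a b : conj_if s (a * b) = conj_if s a * conj_if s b.
Proof. by case: s; rewrite //= rmorphM. Qed.

Lemma conj_if1 s : conj_if s 1 = 1.
Proof. by case: s; rewrite //= rmorph1. Qed.

Lemma conj_if_real s (a : R) : conj_if s a%:C = a%:C.
Proof. by case: s; rewrite //= conj_real. Qed.

Lemma norm_conj_if s a : `|conj_if s a| = `|a|.
Proof. by case: s; rewrite //= norm_conjC. Qed.

(* The flags are carried by the type so that it determines its scalar action. *)
Definition orth_pair (t1 t2 : bool) : {pred H * H} :=
  fun p => (inner e p.1 == 0) && (inner e p.2 == 0).

Fact orth_pair_zmod : zmod_closed (orth_pair s1 s2).
Proof.
split=> [|p q /andP[/eqP p1 /eqP p2] /andP[/eqP q1 /eqP q2]]; apply/andP; split.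
- by rewrite inner0r.
- by rewrite inner0r.
- by rewrite innerBr p1 q1 subrr.
- by rewrite innerBr p2 q2 subrr.
Qed.

(* Pairs of vectors orthogonal to [e], the scalars acting on the first
   (resp. second) component through complex conjugation when [s1] (resp. [s2]). *)
Record model := Model { model_val :> H * H; model_subproof : model_val \in orth_pair s1 s2 }.

HB.instance Definition _ := [isSub for model_val].
HB.instance Definition _ := [Choice of model by <:].
HB.instance Definition _ := GRing.isZmodClosed.Build (H * H)%type (orth_pair s1 s2) orth_pair_zmod.
HB.instance Definition _ := [SubChoice_isSubZmodule of model by <:].

Fact model_scale_subproof (a : R[i]) (p : model) :
  (conj_if s1 a *: p.1, conj_if s2 a *: p.2) \in orth_pair s1 s2.
Proof.
by case: p => p /= /andP[/eqP p1 /eqP p2]; rewrite /orth_pair unfold_in /= !innerZr p1 p2 !mulr0 eqxx.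
Qed.

Definition model_scale a p := Model (model_scale_subproof a p).

Let modelP (p q : model) : p.1 = q.1 -> p.2 = q.2 -> p = q.
Proof. by move=> pq1 pq2; apply: val_inj => /=; move: pq1 pq2; case: (val p); case: (val q) => ? ? ? ? /= -> ->. Qed.

Let model_scaleA a b p : model_scale a (model_scale b p) = model_scale (a * b) p.
Proof. by apply: modelP; rewrite /= scalerA -conj_ifM. Qed.

Let model_scale1 : left_id 1 model_scale.
Proof. by move=> p; apply: modelP; rewrite /= conj_if1 scale1r. Qed.

Let model_scaleDr : right_distributive model_scale +%R.
Proof. by move=> a p q; apply: modelP; rewrite /= scalerDr. Qed.

Let model_scaleDl p : {morph model_scale^~ p : a b / a + b}.
Proof. by move=> a b; apply: modelP; rewrite /= conj_ifD scalerDl. Qed.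

HB.instance Definition _ := GRing.Zmodule_isLmodule.Build R[i] model
  model_scaleA model_scale1 model_scaleDr model_scaleDl.

Definition model_norm (p : model) : R[i] := `|p.1| + `|p.2|.

Let model_normD p q : model_norm (p + q) <= model_norm p + model_norm q.
Proof. by rewrite /model_norm addrACA lerD //= ler_normD. Qed.

Let model_normZ (a : R[i]) p : model_norm (a *: p) = `|a| * model_norm p.
Proof. by rewrite /model_norm /= !normrZ !norm_conj_if mulrDr. Qed.

Let model_norm0_eq0 p : model_norm p = 0 -> p = 0.
Proof.
rewrite /model_norm => /eqP; rewrite paddr_eq0 // !normr_eq0 => /andP[/eqP p1 /eqP p2].
exact: modelP.
Qed.

HB.instance Definition _ := Lmodule_isNormed.Build R[i] model
  model_normD model_normZ model_norm0_eq0.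

Lemma model_complete (F : set_system model) : ProperFilter F -> cauchy F -> cvg F.
Proof.
move=> FF Fc.
have cv (f : model -> H) : (forall p q, f p - f q = f (p - q)) ->
    (forall p, `|f p| <= `|p|) -> cvg (f @ F).
  move=> fB fn; apply: cauchy_cvg; apply: cauchy_exP => r r0.
  have /cauchyP/(_ r r0)[p Fp] := Fc.
  exists (f p); suff h : F [set q | ball (f p) r (f q)] by exact: h.
  apply: filterS Fp => q; rewrite -ball_normE /= => pq.
  by rewrite -ball_normE /= fB; exact: le_lt_trans pq.
have n1 (p : model) : `|p.1| <= `|p| by rewrite lerDl.
have n2 (p : model) : `|p.2| <= `|p| by rewrite lerDr.
have c1 := cv (fun p => p.1) (fun p q => erefl) n1.
have c2 := cv (fun p => p.2) (fun p q => erefl) n2.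
have lim0 (f : model -> H) l : f @ F --> l -> (forall p, inner e (f p) = 0) -> inner e l = 0.
  move=> /cvgrPdist_lt fl f0; apply/eqP; rewrite -normr_le0; apply/ler_addgt0Pr => r r0.
  have e0 : 0 < `|e| + 1 by rewrite ltr_wpDl.
  have [p fp] : exists p, `|l - f p| < r / (`|e| + 1).
    by apply: (@filter_ex _ F); apply: fl; rewrite divr_gt0.
  rewrite add0r -[inner e l]subr0 -(f0 p) -innerBr.
  apply: le_trans (cauchy_schwarz _ _) _.
  apply: (@le_trans _ _ ((`|e| + 1) * (r / (`|e| + 1)))).
    by apply: ler_pM => //; [rewrite lerDl|exact: ltW].
  by rewrite mulrC divfK // gt_eqF.
have p1 (p : model) : inner e p.1 = 0 by case: p => p /= /andP[/eqP].
have p2 (p : model) : inner e p.2 = 0 by case: p => p /= /andP[_ /eqP].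
have zy : (lim ((fun p : model => p.1) @ F), lim ((fun p : model => p.2) @ F)) \in orth_pair s1 s2.
  by apply/andP; split; apply/eqP; [exact: lim0 c1 p1|exact: lim0 c2 p2].
apply/cvg_ex; exists (Model zy); apply/cvgrPdist_lt => r r0.
have r20 : 0 < r / 2 by rewrite divr_gt0.
have /cvgrPdist_lt/(_ _ r20) h1 := c1; have /cvgrPdist_lt/(_ _ r20) h2 := c2.
apply: filterS2 h1 h2 => p h1 h2.
by rewrite [r]splitr; apply: ltrD.
Qed.

HB.instance Definition _ := Uniform_isComplete.Build model model_complete.

Definition model_space : completeNormedModType R[i] := model.

End ModelSpace.

(** * Criteria for charts and for equality of tangent vectors *)

Section ChartCriterion.
Variables (R : realType) (H : hilbertType R).
Implicit Types (q A B : bounded_op H).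

Local Notation rH := (realified H).
Local Notation rF := (realified (bounded_op H)).
Local Notation M := (@projections R H).
Local Notation T := (@tangent R H).

(** Applied to [phi \o psi], which fixes the projections near [q], it exhibits the direction of a
    line of projections as a value of the differential of [phi]. *)
Lemma derive_fixed_line (E : normedModType R) (U : set E) (g : E -> E) (q B : E) :
  open U -> U q -> derivable g q B ->
  (forall t : R, U (q + t *: B) -> g (q + t *: B) = q + t *: B) -> 'D_B g q = B.
Proof.
move=> Uo Uq dg gB.
have q0 : q + 0 *: B = q by rewrite scale0r addr0.
have dg0 : derivable g (q + 0 *: B) B by rewrite q0.
have [_ d1] := is_derive_line dg0.
have [di d2] := is_derive_line (@derivable_id R E (q + 0 *: B) B).
have N : \forall t \near (0 : R^o), g (q + t *: B) = q + t *: B.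
  have c : {for (0 : R^o), continuous (fun t : R^o => q + t *: B)}.
    by apply: differentiable_continuous; exact/derivable1_diffP.
  have NU : nbhs (q + (0 : R^o) *: B) U by rewrite q0; exact: open_nbhs_nbhs.
  have cN : nbhs (0 : R^o) [set t : R^o | U (q + t *: B)] := c _ NU.
  by apply: filterS cN => t Ut; exact: gB.
have := near_eq_derive (1 : R^o) N; rewrite q0 in d1 d2.
by rewrite d1 d2 derive_id.
Qed.

(** Moving only one factor of the dyad keeps <w, u> = 1 along the whole affine line. Every tangent
    vector is a sum of two such directions, which makes surjectivity of chart differentials
    accessible. *)
Lemma projection_line q B :
  (exists u w b, [/\ is_lift q u w, inner w b = 0 & B = dyad b w]) \/
  (exists u w a, [/\ is_lift q u w, inner a u = 0 & B = dyad u a]) ->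
  forall t : R, projections (q + t%:C *: B).
Proof.
move=> [[u [w [b [[qE wu] wb BE]]]]|[u [w [a [[qE wu] au BE]]]]] t.
  apply: (@lift_projection _ _ _ (u + t%:C *: b) w); split.
    by rewrite qE BE dyadDl dyadZl.
  by rewrite innerDr innerZr wb mulr0 addr0.
apply: (@lift_projection _ _ _ u (w + t%:C *: a)); split.
  by rewrite qE BE dyadDr dyadZr conj_real.
by rewrite innerDl innerZl au mulr0 addr0.
Qed.

Lemma projection_chart (E : completeNormedModType R[i]) (V : set (realified E))
    (u w : realified E -> rH) (U : set rF) (psi : rF -> realified E) :
  let phi : realified E -> rF := fun x => dyad (u x : H) (w x : H) in
  open V -> smooth V u -> smooth V w -> (forall x, V x -> inner (w x : H) (u x : H) = 1) ->
  open U -> smooth U psi ->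
  (forall x, V x -> U (phi x)) -> (forall x, V x -> psi (phi x) = x) ->
  (forall q, U q -> M q -> V (psi q) /\ phi (psi q) = q) ->
  chart M T V phi /\ forall x v, V x -> 'd phi x v = ddyad (u x) (w x) ('d u x v : H) ('d w x v : H).
Proof.
move=> phi Vo us ws wu Uo ps VU psiK phiK.
have phis : smooth V phi by exact: smooth_dyad.
have du x : V x -> differentiable u x by exact: smooth_differentiable.
have dw x : V x -> differentiable w x by exact: smooth_differentiable.
have dphi x v : V x -> 'd phi x v = ddyad (u x) (w x) ('d u x v : H) ('d w x v : H).
  by move=> Vx; apply: diff_dyad; [exact: du|exact: dw].
have lphi x : V x -> is_lift (phi x) (u x) (w x) by move=> Vx; split=> //; exact: wu.
split; last exact: dphi.
split.
- exact: Vo.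
- exact: phis.
- exists U, psi; split; [exact: Uo|exact: ps| |exact: psiK].
  apply/seteqP; split=> [_ [x Vx <-]|q [Mq Uq]].
    by split; [exact: lift_projection (lphi x Vx)|exact: VU].
  by have [Vq <-] := phiK q Uq Mq; exists (psi q).
- move=> x Vx; apply/seteqP; split=> [_ [v _ <-]|A TA].
    rewrite dphi //; apply: tangent_ddyad; first exact: wu.
    have e := diff_inner v (dw x Vx) (du x Vx).
    have N : \near x, inner (w x : H) (u x : H) = 1.
      by apply: (open_near Vo Vx) => y /wu.
    have [_ e'] := near_eq_differentiable (E := realified E) (F := realified R[i]^o)
       (f := fun=> 1) (filterS (fun y => @esym _ _ _) N) (differentiable_cst _ _).
    have e2 : 'd (fun y => inner (w y : H) (u y : H) : realified R[i]^o) x v = 0.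
      by rewrite e' diff_cst.
    exact: etrans (esym e) e2.
  have l := lphi x Vx; have [AE Au] := tangent_lift l TA; have [_ wux] := l.
  have aux : inner (adj A (w x)) (u x) = 0 by rewrite adjP.
  (* Inside [U] the map [phi \o psi] is the identity on projections, hence on the part of the line
     lying in [U]; ['d psi] of its direction is the required preimage. *)
  have rg B : (forall t : R, projections (phi x + t%:C *: B)) -> range ('d phi x) B.
    move=> pB; have Uq := VU x Vx; have dpsi := smooth_differentiable ps Uq.
    have dp : differentiable phi (psi (phi x)).
      by rewrite psiK //; exact: smooth_differentiable phis Vx.
    exists ('d psi (phi x) B) => //.
    have dg := differentiable_comp dpsi dp.
    have := @derive_fixed_line rF U (phi \o psi) (phi x) B Uo Uq (diff_derivable dg).
    rewrite deriveE // diff_comp // /= psiK // => -> // t Ut.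
    exact: (phiK _ Ut (pB t)).2.
  have [v1 _ e1] : range ('d phi x) (dyad (A (u x)) (w x)).
    by apply/rg/projection_line; left; exists (u x), (w x), (A (u x)).
  have [v2 _ e2] : range ('d phi x) (dyad (u x) (adj A (w x))).
    by apply/rg/projection_line; right; exists (u x), (w x), (adj A (w x)).
  by exists (v1 + v2) => //; rewrite linearD e1 e2; exact: esym AE.
Qed.

(** For [A = k q] the tangent equation reads [2 k q = k q], so [q] is transverse to the tangent
    space and an identity between tangent vectors may be checked modulo [q]. *)
Lemma tangent_multiple q A B (k : R[i]) : M q -> T q A -> T q B -> A = B + k *: q -> A = B.
Proof.
move=> [qq _ _] TA TB AE; have : T q (A - B) by apply: tangentD => //; exact: tangentN.
rewrite AE addrAC subrr add0r /tangent /= op_scaleAl op_scaleAr qq -{3}[k *: q]addr0.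
by move=> /addrI ->; rewrite addr0.
Qed.

(** The operator [dyad w w + dyad u u] is transverse as well: it corresponds to [(b, a) = (w, u)],
    for which the constraint would read <w, w> + <u, u> = 0. *)
Lemma tangent_two_dyads q u w A B (k : R[i]) : is_nlift q u w -> T q A -> T q B ->
  A = B + k *: (dyad w w + dyad u u) -> A = B.
Proof.
move=> n TA TB AE; have [qE wu uw] := n.
have : T q (A - B) by apply: tangentD => //; exact: tangentN.
rewrite {1}AE addrAC subrr add0r.
have -> : k *: (dyad w w + dyad u u) = ddyad u w (k *: w) (k^* *: u).
  by rewrite /ddyad dyadZl dyadZr conjCK scalerDr.
rewrite qE => /(tangent_ddyadP wu); rewrite innerZr innerZl conjCK -uw => /eqP.
rewrite -mulrDr mulf_eq0 => /orP[/eqP k0|].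
  by rewrite AE k0 scale0r addr0.
by rewrite -mulr2n mulrn_eq0 /= gt_eqF // (nlift_gt0 n).
Qed.

End ChartCriterion.

Section ModelCoordinates.
Variables (R : realType) (H : hilbertType R) (e : H) (s1 s2 : bool).
Hypothesis ee : inner e e = 1.
Local Notation E := (model_space e s1 s2).
Local Notation rH := (realified H).
Local Notation rn x := (complex.Re `|x|).

Lemma model_orth1 (p : E) : inner e p.1 = 0.
Proof. by case: p => p /= /andP[/eqP]. Qed.

Lemma model_orth2 (p : E) : inner e p.2 = 0.
Proof. by case: p => p /= /andP[_ /eqP]. Qed.

Lemma model_ext (p q : E) : p.1 = q.1 -> p.2 = q.2 -> p = q.
Proof.
move=> pq1 pq2; apply: val_inj => /=; move: pq1 pq2.
by case: (val p); case: (val q) => ? ? ? ? /= -> ->.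
Qed.

Definition coord1 (p : realified E) : rH := (p : E).1.
Definition coord2 (p : realified E) : rH := (p : E).2.

Lemma coord1_linear : linear coord1.
Proof. by move=> a p q; rewrite !realified_scale /coord1 /= conj_if_real. Qed.

Lemma coord2_linear : linear coord2.
Proof. by move=> a p q; rewrite !realified_scale /coord2 /= conj_if_real. Qed.

Lemma model_rn (p : E) : rn p = rn p.1 + rn p.2.
Proof. by apply: (@complexI R); rewrite rmorphD /= !Re_norm_real. Qed.

Lemma coord1_bound p : `|coord1 p| <= 1 * `|p|.
Proof. by rewrite mul1r !realified_norm model_rn lerDl Re_norm_ge0. Qed.

Lemma coord2_bound p : `|coord2 p| <= 1 * `|p|.
Proof. by rewrite mul1r !realified_norm model_rn lerDr Re_norm_ge0. Qed.

Lemma smooth_coord1 (U : set (realified E)) : open U -> smooth U coord1.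
Proof.
by move=> Uo; apply: (smooth_linear coord1_linear coord1_bound Uo); exact: smooth_id.
Qed.

Lemma smooth_coord2 (U : set (realified E)) : open U -> smooth U coord2.
Proof.
by move=> Uo; apply: (smooth_linear coord2_linear coord2_bound Uo); exact: smooth_id.
Qed.

Lemma diff_coord1 p v : 'd coord1 p v = coord1 v.
Proof. by have [_ ->] := diff_bound_linear p coord1_linear coord1_bound. Qed.

Lemma diff_coord2 p v : 'd coord2 p v = coord2 v.
Proof. by have [_ ->] := diff_bound_linear p coord2_linear coord2_bound. Qed.

Definition orth_proj (x : H) : H := x - inner e x *: e.

Lemma orth_projP x : inner e (orth_proj x) = 0.
Proof. by rewrite innerBr innerZr ee mulr1 subrr. Qed.

Lemma orth_proj_addl x : inner e x = 0 -> orth_proj (e + x) = x.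
Proof. by rewrite /orth_proj innerDr ee => ->; rewrite addr0 scale1r addrC addKr. Qed.

Fact mk_model_subproof x y : (orth_proj x, orth_proj y) \in orth_pair e s1 s2.
Proof. by apply/andP; rewrite /= !orth_projP. Qed.

Definition mk_model x y : realified E := Model (mk_model_subproof x y).

Lemma orth_proj_le x : rn (orth_proj x) <= (1 + rn e * rn e) * rn x.
Proof.
apply: le_trans (Re_normD _ _) _; rewrite mulrDl mul1r lerD2l normrN Re_normZ.
rewrite mulrAC ler_wpM2r ?Re_norm_ge0 // -lecR rmorphM /= !Re_norm_real.
exact: cauchy_schwarz.
Qed.

Lemma smooth_mk_model (D : normedModType R) (U : set D) (f g : D -> rH) :
  open U -> smooth U f -> smooth U g -> smooth U (fun x => mk_model (f x) (g x)).
Proof.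
move=> Uo fs gs; pose K := 1 + rn e * rn e.
apply: (@smooth_linear R D (rH * rH)%type (realified E) U (fun x => (f x, g x))
  (fun p => mk_model p.1 p.2) (2 * K)) => //; last exact: smooth_pair.
  have ol (a : R) x y : orth_proj (a%:C *: x + y) = a%:C *: orth_proj x + orth_proj y.
    by rewrite /orth_proj innerDr innerZr scalerBr scalerDl opprD addrACA scalerA.
  move=> a [x1 x2] [y1 y2]; apply: model_ext; rewrite /= conj_if_real; exact: ol.
move=> [x y]; rewrite realified_norm model_rn /=.
have h1 := orth_proj_le x; have h2 := orth_proj_le y.
have K0 : 0 <= K by rewrite addr_ge0 // mulr_ge0 // Re_norm_ge0.
have m1 : rn (x : H) <= `|(x : rH, y : rH)| by rewrite num_le_max lexx.
have m2 : rn (y : H) <= `|(x : rH, y : rH)| by rewrite num_le_max lexx orbT.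
apply: le_trans (lerD h1 h2) _; rewrite -/K -mulrDr mulrAC mulrC ler_wpM2r //.
by rewrite [2 * _]mulr_natl mulr2n lerD.
Qed.

End ModelCoordinates.

Section PointwiseDifferentials.
Variables (R : realType) (T E : normedModType R).

Lemma diffDE (f g : T -> E) x v : differentiable f x -> differentiable g x ->
  'd (fun y => f y + g y) x v = 'd f x v + 'd g x v.
Proof. by move=> df dg; exact: (congr1 (fun h => h v) (diffD df dg)). Qed.

Lemma diffBE (f g : T -> E) x v : differentiable f x -> differentiable g x ->
  'd (fun y => f y - g y) x v = 'd f x v - 'd g x v.
Proof. by move=> df dg; exact: (congr1 (fun h => h v) (diffB df dg)). Qed.

Lemma diff_cstE (c : E) (x v : T) : 'd (fun _ : T => c) x v = 0.
Proof. exact: (congr1 (fun g => g v) (diff_cst c x)). Qed.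

Lemma diff_rscale (f : T -> R^o) (g : T -> E) x v :
  differentiable f x -> differentiable g x ->
  'd (fun y => f y *: g y) x v = f x *: 'd g x v + 'd f x v *: g x.
Proof.
move=> df dg; have [|||_] := @diff_bilinear R R^o E E (fun a y => a *: y) 1
   _ _ _ T f g x df dg; last by apply.
- by move=> y a u z; rewrite scalerDl scalerA.
- by move=> b a u y; rewrite scalerDr !scalerA mulrC.
- by move=> a y; rewrite mul1r normrZ.
Qed.

Lemma diff_add_cst (c : E) (f : T -> E) x v : differentiable f x ->
  'd (fun y => c + f y) x v = 'd f x v.
Proof.
move=> df; have dc : differentiable (fun _ : T => c) x by exact: differentiable_cst.
apply: (etrans (diffDE v dc df)); rewrite (diff_cstE c x v); exact: add0r.
Qed.

End PointwiseDifferentials.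

Section MoreDifferentials.
Variables (R : realType).
Local Notation rC := (realified R[i]^o).

Lemma diff_cscale (T : normedModType R) (E : normedModType R[i]) (f : T -> rC)
    (g : T -> realified E) x v : differentiable f x -> differentiable g x ->
  'd (fun y => (f y : R[i]) *: (g y : E) : realified E) x v =
  (f x : R[i]) *: ('d g x v : E) + ('d f x v : R[i]) *: (g x : E).
Proof.
move=> df dg.
have [|||_] := @diff_bilinear R rC (realified E) (realified E) (fun a y => (a : R[i]) *: (y : E)) 1
   _ _ _ T f g x df dg; last by apply.
- by move=> y a u z; rewrite !realified_scale scalerDl scalerA.
- by move=> b a u y; rewrite !realified_scale scalerDr !scalerA mulrC.
- by move=> a y; rewrite mul1r !realified_norm Re_normZ.
Qed.

End MoreDifferentials.

Section ProductCharts.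
Variables (R : realType) (H : hilbertType R) (e : H) (s1 s2 : bool).
Hypothesis ee : inner e e = 1.
Local Notation E := (model_space e s1 s2).
Local Notation rC := (realified R[i]^o).
Local Notation rH := (realified H).
Local Notation rF := (realified (bounded_op H)).
Local Notation M := (@projections R H).
Local Notation T := (@tangent R H).

(* A pair of lines, not orthogonal to each other nor to [e], the range of [q] and
   that of its adjoint, parametrised by their intersections with [e + e^perp]. *)
Let z (p : realified E) : H := coord1 p.
Let y (p : realified E) : H := coord2 p.
Definition pair_inner (p : realified E) : R[i] := inner (e + y p) (e + z p).
(** The inverse of [pair_inner], written with a real denominator so that only a real function is
    inverted when proving smoothness. *)
Definition pair_scale (p : realified E) : R[i] := (pair_inner p)^* * ((nsq (pair_inner p))^-1)%:C.

Definition pair_u (p : realified E) : rH := pair_scale p *: (e + z p).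
Definition pair_w (p : realified E) : rH := e + y p.
Definition pair_domain : set (realified E) := [set p | 0 < nsq (pair_inner p)].
Definition pair_chart (p : realified E) : rF := dyad (pair_u p) (pair_w p).

Let ez p : inner e (z p) = 0. Proof. exact: model_orth1. Qed.
Let ey p : inner e (y p) = 0. Proof. exact: model_orth2. Qed.

Let smooth_ez (U : set (realified E)) : open U -> smooth U (fun p => e + z p : rH).
Proof.
move=> Uo; apply: (@smoothD R (realified E) rH) => //; first exact: smooth_cst.
exact: smooth_coord1.
Qed.

Let smooth_ey (U : set (realified E)) : open U -> smooth U (fun p => e + y p : rH).
Proof.
move=> Uo; apply: (@smoothD R (realified E) rH) => //; first exact: smooth_cst.
exact: smooth_coord2.
Qed.

Let smooth_den (U : set (realified E)) : open U -> smooth U (pair_inner : realified E -> rC).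
Proof. by move=> Uo; apply: smooth_inner => //; [exact: smooth_ey|exact: smooth_ez]. Qed.

Let pair_domain_open : open pair_domain.
Proof.
rewrite -[pair_domain]setTI; apply: open_pos; first exact: openT.
by apply: smooth_nsq; [exact: openT|apply: smooth_den; exact: openT].
Qed.

Let smooth_kap : smooth pair_domain (pair_scale : realified E -> rC).
Proof.
apply: smooth_cmul => //; first by apply: smooth_conj => //; exact: smooth_den.
apply: smoothRC => //; apply: smooth_invr => // [p|]; first exact: lt0r_neq0.
by apply: smooth_nsq => //; exact: smooth_den.
Qed.

Let kapE p : pair_domain p -> pair_scale p = (pair_inner p)^-1.
Proof.
rewrite /pair_domain /= => d0; have dn0 : pair_inner p != 0 by rewrite -nsq_gt0.
apply: (mulIf dn0); rewrite mulVf // /pair_scale mulrAC -nsq_conj -rmorphM divff //.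
exact: lt0r_neq0.
Qed.

Let pair_wu p : pair_domain p -> inner (pair_w p) (pair_u p) = 1.
Proof.
move=> dp; rewrite innerZr kapE // mulVf //.
by rewrite -nsq_gt0.
Qed.

(** On its domain [k] is the inverse of <e, q e>, and <e, adj q e> is the conjugate of <e, q e>;
    these multiples of [q e] and [adj q e] thus lie in the hyperplane <e, .> = 1. Written this way
    the coordinates need no lift and are smooth in [q]. *)
Definition pair_coord (q : rF) : realified E :=
  let d := inner e ((q : bounded_op H) e) in let k := d^* * ((nsq d)^-1)%:C in
  mk_model s1 s2 ee (k *: ((q : bounded_op H) e)) (k^* *: adj (q : bounded_op H) e).

Lemma pair_coordE q u w : is_lift q u w -> lift_domain e q ->
  pair_coord q = mk_model s1 s2 ee ((inner e u)^-1 *: u) ((inner e w)^-1 *: w).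
Proof.
move=> [qE wu] dq; rewrite /pair_coord.
have aE : (q : bounded_op H) e = inner w e *: u by rewrite qE.
have bE : adj q e = inner u e *: w by rewrite qE adj_dyad.
move: dq; rewrite /lift_domain /=; set d := inner e (q e) => d0.
have dn0 : d != 0 by rewrite -nsq_gt0.
have kE : d^* * ((nsq d)^-1)%:C = d^-1.
  apply: (mulIf dn0); rewrite mulVf // mulrAC -nsq_conj -rmorphM divff //.
  exact: lt0r_neq0.
have dE : d = inner w e * inner e u by rewrite /d aE innerZr.
have [we eu] : inner w e != 0 /\ inner e u != 0.
  by move: dn0; rewrite dE mulf_eq0 negb_or => /andP.
rewrite kE aE bE !scalerA dE fmorphV rmorphM /= !conj_inner; congr mk_model.
  by rewrite invfM mulrAC mulVf // mul1r.
by rewrite invfM -mulrA mulVf ?mulr1 // -(conj_inner e u) conjC_eq0.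
Qed.

Lemma pair_lift p : pair_domain p -> is_lift (pair_chart p) (pair_u p) (pair_w p).
Proof. by move=> dp; split=> //; exact: pair_wu. Qed.

Let e_pair_u p : inner e (pair_u p) = pair_scale p.
Proof. by rewrite /pair_u innerZr innerDr ee ez addr0 mulr1. Qed.

Let e_pair_w p : inner e (pair_w p) = 1.
Proof. by rewrite /pair_w innerDr ee ey addr0. Qed.

Lemma pair_coordK (q : rF) : lift_domain e q -> M q ->
  pair_domain (pair_coord q) /\ pair_chart (pair_coord q) = q.
Proof.
move=> dq Mq; have [u [w l]] := projection_lift Mq; have [qE wu] := l.
have [we eu] : inner w e != 0 /\ inner e u != 0.
  move: dq; rewrite /lift_domain /= nsq_gt0 qE dyadE innerZr mulf_eq0 negb_or => /andP.
  by [].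
have ew : inner e w != 0 by rewrite -conj_inner conjC_eq0.
have zE : e + z (pair_coord q) = (inner e u)^-1 *: u.
  rewrite (pair_coordE l dq) /z /coord1 /= /orth_proj innerZr mulVf // scale1r.
  by rewrite addrC subrK.
have yE : e + y (pair_coord q) = (inner e w)^-1 *: w.
  rewrite (pair_coordE l dq) /y /coord2 /= /orth_proj innerZr mulVf // scale1r.
  by rewrite addrC subrK.
have dE : pair_inner (pair_coord q) = ((inner e w)^-1)^* * (inner e u)^-1.
  by rewrite /pair_inner yE zE innerZl innerZr wu mulr1.
have Vq : pair_domain (pair_coord q).
  by rewrite /pair_domain /= nsq_gt0 dE mulf_neq0 // ?conjC_eq0 invr_eq0.
split; first exact: Vq.
rewrite /pair_chart /pair_u /pair_w kapE // zE yE dE dyadZl dyadZl dyadZr !scalerA qE.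
rewrite (_ : _ * _ = 1) ?scale1r //.
by field; rewrite conjC_eq0 ew eu.
Qed.

Lemma pair_is_chart : chart M T pair_domain pair_chart /\
  forall x v, pair_domain x -> 'd pair_chart x v =
    ddyad (pair_u x) (pair_w x) ('d pair_u x v : H) ('d pair_w x v : H).
Proof.
have us : smooth pair_domain pair_u by apply: smooth_cscale => //; exact: smooth_ez.
have ws : smooth pair_domain pair_w by exact: smooth_ey.
have Uo : open (lift_domain e) by exact: lift_domain_open.
have es : smooth (lift_domain e) (fun q : rF => (q : bounded_op H) e : rH).
  by apply: smooth_app => //; exact: smooth_id.
have ds : smooth (lift_domain e) (fun q : rF => inner e ((q : bounded_op H) e) : rC).
  by apply: smooth_inner => //; exact: smooth_cst.
have ks : smooth (lift_domain e) (fun q : rF => let d := inner e ((q : bounded_op H) e) in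
    d^* * ((nsq d)^-1)%:C : rC).
  apply: smooth_cmul => //; first exact: smooth_conj.
  apply: smoothRC => //; apply: smooth_invr => // [q|]; first exact: lt0r_neq0.
  exact: smooth_nsq.
have ps : smooth (lift_domain e) pair_coord.
  apply: smooth_mk_model => //; first exact: smooth_cscale.
  apply: smooth_cscale => //; first exact: (smooth_conj Uo ks).
  by apply: smooth_adj_app => //; exact: smooth_id.
have kap0 p : pair_domain p -> pair_scale p != 0.
  by move=> dp; rewrite kapE // invr_eq0 -nsq_gt0.
have Ud p : pair_domain p -> lift_domain e (pair_chart p).
  move=> dp; rewrite /lift_domain /= nsq_gt0 innerZr e_pair_u.
  by rewrite innerC e_pair_w rmorph1 mul1r kap0.
apply: (projection_chart pair_domain_open us ws pair_wu Uo ps Ud).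
- move=> p dp; rewrite (pair_coordE (pair_lift dp) (Ud p dp)) e_pair_u e_pair_w.
  rewrite invr1 scale1r /pair_u scalerA mulVf ?kap0 // scale1r /pair_w.
  by apply: model_ext; rewrite /= orth_proj_addl.
- exact: pair_coordK.
Qed.

(** A variation of the scale moves [pair_u] along its own line and so contributes a multiple of the
    projection. That multiple stays unspecified, as [tangent_multiple] removes it. *)
Lemma diff_pair_chart x v : pair_domain x -> exists k : R[i],
  'd pair_chart x v = ddyad (pair_u x) (pair_w x)
    (pair_scale x *: (coord1 v : H)) (coord2 v : H) + k *: pair_chart x.
Proof.
move=> dx; have [_ ->] := pair_is_chart; last exact: dx.
have Uo := pair_domain_open.
have dk : differentiable (pair_scale : realified E -> rC) x := smooth_differentiable smooth_kap dx.
have dz : differentiable (fun p => e + z p : rH) x := smooth_differentiable (smooth_ez Uo) dx.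
have d1 : differentiable (@coord1 R H e s1 s2) x.
  exact: smooth_differentiable (smooth_coord1 Uo) dx.
have d2 : differentiable (@coord2 R H e s1 s2) x.
  exact: smooth_differentiable (smooth_coord2 Uo) dx.
have dze : 'd (fun p => e + z p : rH) x v = coord1 v.
  by apply: etrans (diff_add_cst (e : rH) v d1) _; exact: diff_coord1.
have dwe : 'd pair_w x v = coord2 v.
  by apply: etrans (diff_add_cst (e : rH) v d2) _; exact: diff_coord2.
set k := ('d (pair_scale : realified E -> rC) x v : R[i]).
have due : 'd pair_u x v = (pair_scale x *: (coord1 v : H) + k *: (e + z x) : H).
  apply: etrans (diff_cscale v dk dz) _.
  exact: (congr1 (fun t : H => pair_scale x *: t + k *: (e + z x)) dze).
have k0 : pair_inner x * pair_scale x = 1 by rewrite kapE // mulfV // -nsq_gt0.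
exists (k * pair_inner x).
apply: (etrans (congr2 (ddyad (pair_u x) (pair_w x)) due dwe)); clear due dwe; move: k => k.
rewrite /ddyad dyadDl addrAC; congr (_ + _).
by rewrite /pair_chart [in RHS]/pair_u !dyadZl scalerA -mulrA k0 mulr1.
Qed.

End ProductCharts.

Section ProductAtlases.
Variables (R : realType) (H : hilbertType R).
Implicit Types (e : H) (q : bounded_op H).
Local Notation rF := (realified (bounded_op H)).
Local Notation M := (@projections R H).
Local Notation T := (@tangent R H).

Lemma unit_vector (v : H) : v != 0 -> exists (c : R[i]), c != 0 /\ inner (c *: v) (c *: v) = 1.
Proof.
move=> v0; have n0 : complex.Re `|v| != 0 by apply: contra_neq v0; exact: Re_norm0_eq0.
exists ((complex.Re `|v|)^-1)%:C; split.
  by apply: contra_neq n0 => /complexI/eqP; rewrite invr_eq0 => /eqP.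
rewrite innerZl innerZr inner_norm conj_real -!rmorphM /= mulrA -expr2 -exprMn mulVf //.
by rewrite expr1n.
Qed.

(** A structure that multiplies [b] and [a] by [i] or its conjugate becomes multiplication by [i] in
    these coordinates, once each factor of the model carries the matching scalar action. The
    multiple of [q] in the hypothesis is harmless because all vectors involved are tangent. *)
Lemma pair_chart_atlas (s1 s2 : bool) (J : rF -> rF -> rF) :
  (forall q u w (b a : H), is_lift q u w -> exists k : R[i],
     J q (ddyad u w b a) =
     ddyad u w (conj_if s1 'i%C *: b) (conj_if s2 'i%C *: a) + k *: q) ->
  (forall q A, M q -> T q A -> T q (J q A)) ->
  has_complex_atlas M T J.
Proof.
move=> Jl JT q Mq; have [u [w l]] := projection_lift Mq; have [qE wu] := l.
have [u0 w0] := lift_neq0 l; have [c [c0 ee]] := unit_vector u0.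
(* A unit vector in the range of [q] satisfies [q e = e], which puts [q] in the image of the
   chart. *)
set e := c *: u in ee.
have [cV dV] := pair_is_chart s1 s2 ee.
exists (model_space e s1 s2), (@pair_domain R H e s1 s2), (@pair_chart R H e s1 s2).
split; last first.
  have qe : q e = e by rewrite qE dyadE innerZr wu mulr1.
  have dq : lift_domain e q by rewrite /lift_domain /= nsq_gt0 qe ee oner_eq0.
  have [Vq qK] := pair_coordK s1 s2 ee dq Mq.
  by exists (pair_coord s1 s2 ee q).
split; first exact: cV.
move=> x v Vx; set p := pair_chart x.
have Mp : M p := chart_projection cV Vx.
have dT v' : T p ('d (@pair_chart R H e s1 s2) x v') by exact: chart_diff_tangent cV Vx.
have [k1 e1] := diff_pair_chart ee v Vx; have [k2 e2] := diff_pair_chart ee (mulI v) Vx.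
have {}e1 : 'd (@pair_chart R H e s1 s2) x v = ddyad (pair_u x) (pair_w x)
    (pair_scale x *: (coord1 v : H) + k1 *: pair_u x) (coord2 v : H).
  by apply: etrans e1 _; rewrite /ddyad dyadDl (dyadZl k1) addrAC.
have [k3 e3] := Jl p _ _ (pair_scale x *: (coord1 v : H) + k1 *: pair_u x)
  (coord2 v : H) (pair_lift Vx).
set c1 := conj_if s1 'i%C in e3; set c2 := conj_if s2 'i%C in e3.
have tJ : T p (J p ('d (@pair_chart R H e s1 s2) x v)) by apply: JT => //; exact: dT.
apply: (@tangent_multiple R H p _ _ (k2 - c1 * k1 - k3)) => //.
rewrite e1 e2 e3.
rewrite /ddyad /c1 /c2; set z := coord1 v; set y := coord2 v.
rewrite -[coord1 (mulI v)]/(conj_if s1 'i%C *: (z : H)) -[coord2 (mulI v)]/(conj_if s2 'i%C *: (y : H)).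
rewrite -/p; have : p = dyad (pair_u x) (pair_w x) by [].
move: (pair_u x) (pair_w x) (pair_scale x) => U W s pE.
rewrite scalerDr dyadDl !scalerA [s * _]mulrC (dyadZl _ U) -pE [X in X + k3 *: p]addrAC -!addrA.
by congr (_ + (_ + _)); rewrite -!scalerDl; congr (_ *: _); ring.
Qed.

Lemma complex_submanifold_projections : complex_submanifold M T.
Proof.
(* Multiplication by [i] enters the antilinear second slot of a dyad as its conjugate, hence the
   flag [true]; [Jthird] has [i] in both slots, hence two flags [false]. *)
apply: (@pair_chart_atlas false true) => [q u w b a _|q A _ TA]; last exact: tangentZ.
exists 0; rewrite /ambientI /mulI /ddyad scale0r addr0 scalerDr dyadZl dyadZr /=.
by rewrite conjCK.
Qed.

Lemma Jthird_atlas : has_complex_atlas M T (@Jthird R H).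
Proof.
apply: (@pair_chart_atlas false false) => [q u w b a [qE wu]|q A Mq TA].
  exists ('i%C * (inner a u - inner w b)); rewrite qE; exact: Jthird_lift.
exact: Jthird_tangent_in.
Qed.

End ProductAtlases.

(** * Sums and differences of normalised lifts, and charts for bold J *)

Section NormalisedLifts.
Variables (R : realType) (H : hilbertType R).
Implicit Types (u w s t : H) (q : bounded_op H).

Let halfD : 2^-1 + 2^-1 = 1 :> R[i]. Proof. by field. Qed.

Lemma half_sumD s t : 2^-1 *: (s + t + (s - t)) = s.
Proof. by rewrite addrACA subrr addr0 scalerDr -scalerDl halfD scale1r. Qed.

Lemma half_sumB s t : 2^-1 *: (s + t - (s - t)) = t.
Proof. by rewrite opprB [t - s]addrC addrACA subrr add0r scalerDr -scalerDl halfD scale1r. Qed.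

Lemma nlift_sum_diff s t : inner s t = 0 -> inner s s = 1 + inner t t ->
  is_nlift (dyad (s + t) (s - t)) (s + t) (s - t).
Proof.
move=> st sst; have ts : inner t s = 0 by rewrite innerC st rmorph0.
by split=> //; rewrite !innerDr !innerDl ?innerNr ?innerNl st ts sst; ring.
Qed.

Lemma nlift_half_sum q u w : is_nlift q u w ->
  inner (2^-1 *: (u + w)) (2^-1 *: (u - w)) = 0 /\
  inner (2^-1 *: (u + w)) (2^-1 *: (u + w)) =
    1 + inner (2^-1 *: (u - w)) (2^-1 *: (u - w)).
Proof.
move=> [_ wu uw]; have uw1 : inner u w = 1 by rewrite innerC wu rmorph1.
have h : (2^-1)^* = 2^-1 :> R[i] by rewrite fmorphV rmorph_nat.
rewrite !innerZl !innerZr h !innerDr !innerDl ?innerNr ?innerNl wu uw1 uw.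
by split; field.
Qed.

(** Equality of the dyads gives [u' = k u] and [w' = l w]; the pairing gives [l^* k = 1] and the
    normalisation |k| = |l|, so both have modulus 1 and coincide. *)
Lemma nlift_phase q u w u' w' : is_nlift q u w -> is_nlift q u' w' ->
  exists k : R[i], [/\ k * k^* = 1, u' = k *: u & w' = k *: w].
Proof.
move=> n n'; have [qE wu uw] := n; have [qE' wu' uw'] := n'.
have e1 : u' = inner w u' *: u.
  by rewrite -[LHS]scale1r -{1}wu' -[LHS](dyadE u' w') -qE' qE dyadE.
have e2 : w' = inner u w' *: w.
  have uw1 : inner u' w' = 1 by rewrite innerC wu' rmorph1.
  by rewrite -[LHS]scale1r -{1}uw1 -[LHS](dyadE w' u') -adj_dyad -qE' qE adj_dyad dyadE.
move: e1 e2; set k := inner w u'; set l := inner u w' => e1 e2.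
have kl : l^* * k = 1 by move: wu'; rewrite e1 e2 innerZl innerZr wu mulr1.
have kk : k^* * k = l^* * l.
  have u0 : inner u u != 0 by rewrite gt_eqF // (nlift_gt0 n).
  by apply: (mulIf u0); move: uw'; rewrite e1 e2 !innerZl !innerZr -uw !mulrA.
have k1 : nsq k = 1.
  have h : nsq k ^+ 2 = 1.
    have kl' : l * k^* = 1 by rewrite -[l]conjCK -rmorphM kl rmorph1.
    apply: (@complexI R); rewrite expr2 rmorphM /= !nsq_conj {1}kk.
    by transitivity ((l^* * k) * (l * k^*)); [ring|rewrite kl kl' mulr1].
  have k0 : 0 <= nsq k by rewrite addr_ge0 // sqr_ge0.
  by apply/eqP; rewrite -(sqrp_eq1 k0) h.
have k2 : k^* * k = 1 by rewrite -nsq_conj k1.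
have k0 : k != 0 by apply: contra_eq_neq kl => ->; rewrite mulr0 eq_sym oner_eq0.
have lk : l = k by apply: (can_inj conjCK); apply: (mulIf k0); rewrite kl k2.
exists k; split; [by rewrite mulrC|by []|by rewrite -lk].
Qed.

End NormalisedLifts.

(** If [s] is proportional to a scale [r] and [t] to its inverse, a variation of [r] with
    logarithmic derivative [a] moves [s] by [a *: s] and [t] by [- a *: t], hence [s + t] by
    [a *: (s - t)] and conversely. *)
Fact scaled_sum_diff (K : fieldType) (V : lmodType K) (r a : K) (z n s t s' t' : V) :
  r != 0 -> s' = r *: z + a *: s -> n = r *: t' + (a * r) *: t ->
  s' + t' = r *: z + r^-1 *: n + a *: (s - t) /\
  s' - t' = r *: z - r^-1 *: n + a *: (s + t).
Proof.
move=> r0 sE nE; have tE : t' = r^-1 *: n - a *: t.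
  by rewrite nE [a * r]mulrC -scalerA -scalerDr scalerA mulVf // scale1r addrK.
rewrite sE tE scalerBr scalerDr; split; first by rewrite addrACA.
by rewrite opprB [a *: t - _]addrC addrACA.
Qed.

(** The left side is the chart differential along i v, the right side starts with bold J of the
    differential along v. The contributions of the scale factor [a] to bold J are vertical and drop
    out; the remaining discrepancy lies along the operator handled by [tangent_two_dyads]. *)
Fact ddyad_conj_rotate (R : realType) (H : hilbertType R) (u w z n : H) (a b : R) (l : R[i]) :
  ddyad u w (- 'i%C *: z + 'i%C *: n + b%:C *: w) (- 'i%C *: z - 'i%C *: n + b%:C *: u) =
  ddyad u w (- 'i%C *: (z - n + a%:C *: u) + l *: w)
    (- 'i%C *: (z + n + a%:C *: w) + l^* *: u) + (b%:C - l) *: (dyad w w + dyad u u).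
Proof.
have ci : (- 'i%C)^* = 'i%C :> R[i] by rewrite -conj_imag conjCK.
apply: op_ext => x y; rewrite /ddyad !opE !innerE !conj_real !conjCK conj_imag ci.
ring.
Qed.

Section BoldChart.
Variables (R : realType) (H : hilbertType R) (e : H).
Hypothesis ee : inner e e = 1.
Local Notation E := (model_space e true false).
Local Notation rC := (realified R[i]^o).
Local Notation rH := (realified H).
Local Notation rF := (realified (bounded_op H)).
Local Notation M := (@projections R H).
Local Notation T := (@tangent R H).
Local Notation sq x := (complex.Re (inner x x)).

Definition bold_dir (p : realified E) : rH := e + coord1 p.
(** The vector orthogonal to [bold_dir] whose component in the orthogonal complement of [e] is
    [coord2]. *)
Definition bold_codir (p : realified E) : rH :=
  coord2 p - inner (coord1 p : H) (coord2 p : H) *: e.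

(** With S and N the squared norms of [bold_dir] and [bold_codir], a scale r gives |s|^2 - |t|^2 =
    r^2 S - N / r^2. Setting this equal to 1 is the equation S X^2 - X - N = 0 in X = r^2, and this
    is its discriminant. *)
Definition bold_mass (p : realified E) : R^o :=
  1 + 4 * (sq (bold_dir p : H) * sq (bold_codir p : H)).

(* The scale for which |[bold_s]|^2 - |[bold_t]|^2 = 1. *)
Definition bold_scale (p : realified E) : R^o :=
  Num.sqrt (2^-1 * (1 + Num.sqrt (bold_mass p)) * (sq (bold_dir p : H))^-1).

Definition bold_s (p : realified E) : rH := bold_scale p *: bold_dir p.
Definition bold_t (p : realified E) : rH := (bold_scale p)^-1 *: bold_codir p.
Definition bold_u (p : realified E) : rH := bold_s p + bold_t p.
Definition bold_w (p : realified E) : rH := bold_s p - bold_t p.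
Definition bold_chart (p : realified E) : rF := dyad (bold_u p : H) (bold_w p : H).

Let e1 (p : realified E) : inner e (coord1 p : H) = 0. Proof. exact: model_orth1. Qed.
Let e2 (p : realified E) : inner e (coord2 p : H) = 0. Proof. exact: model_orth2. Qed.
Let e1' (p : realified E) : inner (coord1 p : H) e = 0.
Proof. by rewrite innerC e1 rmorph0. Qed.

Let dir_orth p : inner (bold_dir p : H) (bold_codir p : H) = 0.
Proof.
rewrite /bold_dir /bold_codir innerBr !innerDl !innerZr ee e1' e2; ring.
Qed.

Let e_dir p : inner e (bold_dir p : H) = 1.
Proof. by rewrite innerDr ee e1 addr0. Qed.

Let sq_dir_gt0 p : 0 < sq (bold_dir p : H).
Proof.
apply: Re_inner_gt0; apply: contra_eq_neq (e_dir p) => ->.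
by rewrite inner0r eq_sym oner_eq0.
Qed.

Let sq_ge0 (x : H) : 0 <= sq x.
Proof. by rewrite -rn_sqr sqr_ge0. Qed.

Let mass_gt0 p : 0 < bold_mass p.
Proof. by rewrite ltr_wpDr // mulr_ge0 // mulr_ge0. Qed.

Let radicand_gt0 p :
  0 < 2^-1 * (1 + Num.sqrt (bold_mass p)) * (sq (bold_dir p : H))^-1.
Proof.
rewrite !mulr_gt0 ?invr_gt0 ?ltr0n // ?sq_dir_gt0 // ltr_wpDr // sqrtr_ge0.
Qed.

Let scale_gt0 p : 0 < bold_scale p.
Proof. by rewrite sqrtr_gt0. Qed.

Let sqE (x : H) : inner x x = (sq x)%:C.
Proof. by rewrite inner_norm. Qed.

Lemma bold_nlift p : is_nlift (bold_chart p) (bold_u p) (bold_w p).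
Proof.
have r0 := scale_gt0 p; have S0 := sq_dir_gt0 p.
apply: nlift_sum_diff; rewrite /bold_s /bold_t !realified_scale !innerZl !innerZr !conj_real.
  by rewrite dir_orth !mulr0.
rewrite (sqE (bold_dir p)) (sqE (bold_codir p)) -!rmorphM /= -(rmorph1 (real_complex R)) -rmorphD; congr (_%:C).
have rr : bold_scale p * bold_scale p =
    2^-1 * (1 + Num.sqrt (bold_mass p)) * (sq (bold_dir p : H))^-1.
  by rewrite -expr2 sqr_sqrtr // ltW.
have qq : Num.sqrt (bold_mass p) * Num.sqrt (bold_mass p) = bold_mass p.
  by rewrite -expr2 sqr_sqrtr // ltW.
move: r0 S0 rr qq; rewrite /bold_mass.
set q := Num.sqrt _; set r := bold_scale p; set S := sq (bold_dir p : H); set N := sq _.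
move: q r S N => q r S N r0 S0 rr qq.
have cS : r * r * S = 2^-1 * (1 + q) by rewrite rr divfK // gt_eqF.
have rn0 : r != 0 by rewrite gt_eqF.
have Sn0 : S != 0 by rewrite gt_eqF.
have NE : N = r * r * (2^-1 * (1 + q)) - r * r.
  apply: (mulIf Sn0); rewrite mulrBl cS mulrAC cS [LHS]mulrC; nra.
rewrite mulrA cS NE; field; exact: rn0.
Qed.

Definition bold_qs (q : rF) : rH := 2^-1 *: (lift_u e q + lift_w e q : H).
Definition bold_qt (q : rF) : rH := 2^-1 *: (lift_u e q - lift_w e q : H).

Definition bold_model (s t : H) : realified E :=
  mk_model true false ee ((inner e s)^-1 *: s) ((inner e s)^* *: t).

Lemma bold_model_phase (k : R[i]) (s t : H) : k * k^* = 1 ->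
  bold_model (k *: s) (k *: t) = bold_model s t.
Proof.
move=> kk; have k0 : k != 0 by apply: contra_eq_neq kk => ->; rewrite mul0r eq_sym oner_eq0.
rewrite /bold_model innerZr; congr mk_model; rewrite scalerA.
  by rewrite invfM mulrAC mulVf // mul1r.
by rewrite rmorphM /= mulrAC [k^* * k]mulrC kk mul1r.
Qed.

Lemma bold_modelE (s t : H) : inner s t = 0 -> inner s s = 1 + inner t t -> inner e s != 0 ->
  exists k : R[i], [/\ k * k^* = 1, bold_s (bold_model s t) = k *: s :> H
    & bold_t (bold_model s t) = k *: t :> H].
Proof.
move=> st sst c0; set p := bold_model s t; set c := inner e s in c0 *.
have dE : bold_dir p = c^-1 *: s :> H.
  by rewrite /bold_dir /coord1 /= /orth_proj innerZr mulVf // scale1r addrC subrK.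
have cE : bold_codir p = c^* *: t :> H.
  (* The two vectors have the same component orthogonal to [e]. Both are orthogonal to [bold_dir],
     whose pairing with [e] is nonzero, so the multiple of [e] vanishes. *)
  have [b bE] : exists b, bold_codir p = c^* *: t - b *: e :> H.
    exists (inner e (c^* *: t) + inner (coord1 p : H) (coord2 p : H)).
    by rewrite scalerDl opprD addrA.
  have := dir_orth p; rewrite dE bE innerZl innerBr !innerZr st mulr0 sub0r.
  rewrite -[inner s e]conjCK conj_inner -/c => /eqP.
  rewrite mulrN oppr_eq0 !mulf_eq0 !conjC_eq0 invr_eq0 (negPf c0) orbF /= => /eqP ->.
  by rewrite scale0r subr0.
have S1 : sq (bold_dir p : H) = (nsq c)^-1 * sq s.
  apply: (@complexI R); rewrite -sqE dE innerZl innerZr rmorphM /= -sqE mulrA.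
  by congr (_ * _); rewrite !fmorphV /= nsq_conj invfM.
have S2 : sq (bold_codir p : H) = nsq c * sq t.
  apply: (@complexI R); rewrite -sqE cE innerZl innerZr rmorphM /= nsq_conj -sqE conjCK.
  by rewrite mulrA [c * _]mulrC.
have n0 : 0 < nsq c by rewrite nsq_gt0.
have St : sq s = 1 + sq t by rewrite sst sqE -(rmorph1 (real_complex R)) -rmorphD.
have t0 := sq_ge0 t.
have rE : bold_scale p = Num.sqrt (nsq c).
  rewrite /bold_scale /bold_mass S1 S2; congr Num.sqrt.
  (* The factors [nsq c] cancel, and |s|^2 = 1 + |t|^2 makes the discriminant a perfect square; the
     scale is then |c|. *)
  have -> : 1 + 4 * ((nsq c)^-1 * sq s * (nsq c * sq t)) = (1 + 2 * sq t) ^+ 2.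
    by rewrite St; field; rewrite gt_eqF.
  rewrite sqrtr_sqr ger0_norm ?St; last by rewrite addr_ge0 // mulr_ge0.
  by field; rewrite !gt_eqF // ltr_pwDl.
have rr : (bold_scale p)%:C * (bold_scale p)%:C = c^* * c.
  by rewrite -rmorphM /= rE -expr2 sqr_sqrtr ?ltW // nsq_conj.
have r0 : (bold_scale p)%:C != 0.
  by rewrite -[0]/(0%:C) (inj_eq (@complexI R)) gt_eqF.
(* The phase |c| / c: the chart recovers the pair (s, t) turned so that <e, s> is a positive real
   number. *)
exists ((bold_scale p)%:C * c^-1); split.
- by rewrite rmorphM fmorphV /= conj_real mulrACA rr -invfM [c * _]mulrC mulfV // mulf_neq0 // conjC_eq0.
- by rewrite /bold_s realified_scale dE scalerA.
- rewrite /bold_t realified_scale cE scalerA fmorphV; congr (_ *: _).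
  by apply: (mulfI r0); rewrite mulrA mulfV // mul1r mulrA rr mulfK.
Qed.

Lemma bold_chartK p : bold_model (bold_s p) (bold_t p) = p.
Proof.
have r0 : (bold_scale p)%:C != 0.
  by rewrite -[0]/(0%:C) (inj_eq (@complexI R)) gt_eqF.
rewrite /bold_model /bold_s /bold_t !realified_scale innerZr e_dir mulr1 conj_real !scalerA.
rewrite fmorphV mulVf // mulfV // !scale1r.
apply: model_ext; rewrite /= ?(orth_proj_addl ee) //.
by rewrite /orth_proj /bold_codir innerBr innerZr ee e2 mulr1 sub0r scaleNr opprK subrK.
Qed.

Definition bold_image : set rF := lift_domain e `&` [set q | 0 < nsq (inner e (bold_qs q : H))].
(** [bold_chart] is smooth on the whole model space; taking a preimage makes the domain open and the
    chart valued in the region where [bold_coord] inverts it. *)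
Definition bold_domain : set (realified E) := bold_chart @^-1` bold_image.

Definition bold_coord (q : rF) : realified E :=
  let c := inner e (bold_qs q : H) in
  mk_model true false ee ((c^* * ((nsq c)^-1)%:C) *: (bold_qs q : H)) (c^* *: (bold_qt q : H)).

Let bold_coordE q : bold_image q -> bold_coord q = bold_model (bold_qs q) (bold_qt q).
Proof.
move=> [_ /= c0]; rewrite /bold_coord /bold_model; set c := inner e _ in c0 *.
have cn0 : c != 0 by rewrite -nsq_gt0.
congr (mk_model _ _ _ (_ *: _)).
by rewrite fmorphV /= nsq_conj invfM mulrA mulfV ?mul1r // conjC_eq0.
Qed.

Lemma bold_chart_coord q u w : is_nlift q u w -> lift_domain e q -> exists k : R[i],
  [/\ k * k^* = 1, bold_qs q = k *: (2^-1 *: (u + w)) :> H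
    & bold_qt q = k *: (2^-1 *: (u - w)) :> H].
Proof.
move=> n dq.
have Mq : M q by exact: lift_projection (nlift_lift n).
have [k [kk ku kw]] := nlift_phase n (lift_domain_nlift dq Mq).
exists k; split=> //.
  by rewrite /bold_qs ku kw -[LHS]/(2^-1 *: (k *: u + k *: w : H)) -scalerDr !scalerA mulrC.
by rewrite /bold_qt ku kw -[LHS]/(2^-1 *: (k *: u - k *: w : H)) -scalerBr !scalerA mulrC.
Qed.

Lemma bold_coordK q : bold_image q -> M q ->
  bold_domain (bold_coord q) /\ bold_chart (bold_coord q) = q.
Proof.
move=> iq Mq; rewrite (bold_coordE iq).
have n := lift_domain_nlift iq.1 Mq; have [st sst] := nlift_half_sum n.
have c0 : inner e (bold_qs q : H) != 0 by rewrite -nsq_gt0; exact: iq.2.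
have [k [kk sE tE]] := bold_modelE st sst c0.
set p := bold_model _ _ in sE tE *.
have pK : bold_chart p = q.
  have uE : bold_u p = k *: lift_u e q :> H.
    rewrite /bold_u sE tE -[LHS]/(k *: (bold_qs q : H) + k *: (bold_qt q : H)) -scalerDr.
    by congr (_ *: _); rewrite /bold_qs /bold_qt -scalerDr half_sumD.
  have wE : bold_w p = k *: lift_w e q :> H.
    rewrite /bold_w sE tE -[LHS]/(k *: (bold_qs q : H) - k *: (bold_qt q : H)) -scalerBr.
    by congr (_ *: _); rewrite /bold_qs /bold_qt -scalerBr half_sumB.
  rewrite /bold_chart uE wE dyadZl dyadZr scalerA kk scale1r.
  by have [] := n.
by split; [rewrite /bold_domain /preimage /= pK|].
Qed.

Lemma bold_domainK p : bold_domain p -> bold_coord (bold_chart p) = p.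
Proof.
move=> ip; rewrite bold_coordE //.
have [k [kk -> ->]] := bold_chart_coord (bold_nlift p) ip.1.
rewrite bold_model_phase // -[RHS]bold_chartK /bold_u /bold_w; congr bold_model.
  exact: half_sumD.
exact: half_sumB.
Qed.

Section Smoothness.
Variable U : set (realified E).
Hypothesis Uo : open U.

Lemma smooth_dir : smooth U bold_dir.
Proof. by apply: smoothD => //; [exact: smooth_cst|exact: smooth_coord1]. Qed.

Lemma smooth_codir : smooth U bold_codir.
Proof.
apply: smoothB; [exact: Uo|exact: smooth_coord2|].
apply: smooth_cscale; [exact: Uo| |exact: smooth_cst].
by apply: smooth_inner; [exact: Uo|exact: smooth_coord1|exact: smooth_coord2].
Qed.

Lemma smooth_bold_scale : smooth U bold_scale.
Proof.
have ss := smooth_rn_sqr Uo smooth_dir; have ns := smooth_rn_sqr Uo smooth_codir.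
have c (a : R^o) : smooth U (fun=> a : R^o) by exact: smooth_cst.
apply: smooth_sqrt; [exact: Uo|by move=> x _; exact: radicand_gt0|].
apply: smooth_mulr; [exact: Uo| |]; last first.
  by apply: smooth_invr => // x _; rewrite gt_eqF.
apply: smooth_mulr; [exact: Uo|exact: c|apply: smoothD; [exact: Uo|exact: c|]].
apply: smooth_sqrt; [exact: Uo|by move=> x _; exact: mass_gt0|].
apply: smoothD; [exact: Uo|exact: c|apply: smooth_mulr; [exact: Uo|exact: c|]].
exact: smooth_mulr.
Qed.

Lemma smooth_bold_s : smooth U bold_s.
Proof. exact: (smooth_scale Uo smooth_bold_scale smooth_dir). Qed.

Lemma smooth_bold_t : smooth U bold_t.
Proof.
apply: (smooth_scale Uo _ smooth_codir).
apply: (smooth_invr Uo _ smooth_bold_scale) => x _; by rewrite gt_eqF.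
Qed.

Lemma smooth_bold_u : smooth U bold_u.
Proof. exact: (smoothD Uo smooth_bold_s smooth_bold_t). Qed.

Lemma smooth_bold_w : smooth U bold_w.
Proof. exact: (smoothB Uo smooth_bold_s smooth_bold_t). Qed.

End Smoothness.

Let smooth_qs : smooth (lift_domain e) bold_qs.
Proof.
have lo := @lift_domain_open R H e.
have c : smooth (lift_domain e) (fun=> 2^-1 : rC) by exact: smooth_cst.
apply: smooth_cscale; [exact: lo|exact: c|apply: smoothD; [exact: lo| |]].
  exact: smooth_lift_u.
exact: smooth_lift_w.
Qed.

Let smooth_qt : smooth (lift_domain e) bold_qt.
Proof.
have lo := @lift_domain_open R H e.
have c : smooth (lift_domain e) (fun=> 2^-1 : rC) by exact: smooth_cst.
apply: smooth_cscale; [exact: lo|exact: c|apply: smoothB; [exact: lo| |]].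
  exact: smooth_lift_u.
exact: smooth_lift_w.
Qed.

Let smooth_qc : smooth (lift_domain e) (fun q => inner e (bold_qs q : H) : rC).
Proof.
have lo := @lift_domain_open R H e.
by apply: smooth_inner; [exact: lo|exact: smooth_cst|exact: smooth_qs].
Qed.

Let bold_image_open : open bold_image.
Proof.
have lo := @lift_domain_open R H e.
by apply: open_pos; [exact: lo|apply: smooth_nsq; [exact: lo|exact: smooth_qc]].
Qed.

Let smooth_bold_coord : smooth bold_image bold_coord.
Proof.
have sub : bold_image `<=` lift_domain e by move=> q [].
have ss := smooth_sub sub smooth_qs; have st := smooth_sub sub smooth_qt.
have sc := smooth_sub sub smooth_qc; have Uo := bold_image_open.
have sc' := smooth_conj Uo sc.
apply: smooth_mk_model; [exact: Uo| |].
  apply: smooth_cscale; [exact: Uo| |exact: ss].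
  apply: smooth_cmul; [exact: Uo|exact: sc'|].
  apply: smoothRC; [exact: Uo|apply: smooth_invr; [exact: Uo| |]].
    by move=> q [_ /= q0]; rewrite gt_eqF.
  by apply: smooth_nsq; [exact: Uo|exact: sc].
by apply: smooth_cscale; [exact: Uo|exact: sc'|exact: st].
Qed.

Let bold_domain_open : open bold_domain.
Proof.
have sp : smooth setT bold_chart.
  apply: smooth_dyad; [exact: openT|apply: smooth_bold_u; exact: openT|].
  by apply: smooth_bold_w; exact: openT.
apply: open_comp; last exact: bold_image_open.
by move=> p _; exact: (smooth_continuous sp).
Qed.

Lemma bold_is_chart : chart M T bold_domain bold_chart /\
  forall x v, bold_domain x -> 'd bold_chart x v =
    ddyad (bold_u x : H) (bold_w x : H) ('d bold_u x v : H) ('d bold_w x v : H).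
Proof.
apply: (projection_chart bold_domain_open (smooth_bold_u bold_domain_open)
  (smooth_bold_w bold_domain_open) _ bold_image_open smooth_bold_coord).
- by move=> x _; have [] := bold_nlift x.
- by [].
- exact: bold_domainK.
- exact: bold_coordK.
Qed.

Section BoldDifferential.
Variable x : realified E.

Let To : open [set: realified E]. Proof. exact: openT. Qed.
Let dr : differentiable bold_scale x.
Proof. exact: (smooth_differentiable (smooth_bold_scale To)). Qed.
Let dd : differentiable bold_dir x.
Proof. exact: (smooth_differentiable (smooth_dir To)). Qed.
Let dc : differentiable bold_codir x.
Proof. exact: (smooth_differentiable (smooth_codir To)). Qed.
Let ds : differentiable bold_s x.
Proof. exact: (smooth_differentiable (smooth_bold_s To)). Qed.
Let dt : differentiable bold_t x.
Proof. exact: (smooth_differentiable (smooth_bold_t To)). Qed.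
Let d1 : differentiable (@coord1 R H e true false) x.
Proof. exact: (smooth_differentiable (smooth_coord1 To)). Qed.
Let d2 : differentiable (@coord2 R H e true false) x.
Proof. exact: (smooth_differentiable (smooth_coord2 To)). Qed.

Let diff_dir v : 'd bold_dir x v = coord1 v :> H.
Proof. by apply: etrans (diff_add_cst (e : rH) v d1) _; exact: diff_coord1. Qed.

Let diff_codir v : 'd bold_codir x v = coord2 v -
  (inner (coord1 v : H) (coord2 x : H) + inner (coord1 x : H) (coord2 v : H)) *: e :> H.
Proof.
have di := diff_inner v d1 d2.
have dI : differentiable (fun p => inner (@coord1 R H e true false p : H) (@coord2 R H e true false p : H) : rC) x.
  apply: (@smooth_differentiable _ _ _ setT) => //.
  by apply: smooth_inner; [exact: To|exact: smooth_coord1|exact: smooth_coord2].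
have dC : differentiable (fun _ : realified E => e : rH) x by exact: differentiable_cst.
have dG : differentiable (fun p => inner (@coord1 R H e true false p : H) (@coord2 R H e true false p : H) *: e : rH) x.
  apply: (@smooth_differentiable _ _ _ setT) => //.
  apply: smooth_cscale; [exact: To| |exact: smooth_cst].
  by apply: smooth_inner; [exact: To|exact: smooth_coord1|exact: smooth_coord2].
have dGv := diff_cscale v dI dC.
apply: (etrans (diffBE v d2 dG)).
apply: (congr2 (fun a b : H => a - b)); first exact: diff_coord2.
apply: (etrans dGv); rewrite (diff_cstE (e : rH) x v) scaler0 add0r; apply: (congr1 (fun a : R[i] => a *: e)).
apply: (etrans di); apply: (etrans (addrC _ _)).
apply: (congr2 (fun a b : R[i] => a + b)).
  exact: (congr1 (fun h : H => inner h (coord2 x : H)) (diff_coord1 x v)).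
exact: (congr1 (inner (coord1 x : H)) (diff_coord2 x v)).
Qed.

(** The conjugate scalars on the first coordinate make <coord1, coord2> complex bilinear, hence
    [bold_codir] complex analytic. This is what the flags of the model are chosen for. *)
Lemma diff_codir_mulI v : 'd bold_codir x (mulI v) = 'i%C *: ('d bold_codir x v : H).
Proof.
rewrite (diff_codir v) (diff_codir (mulI v)).
rewrite -[coord1 (mulI v)]/('i%C^* *: (coord1 v : H)) -[coord2 (mulI v)]/('i%C *: (coord2 v : H)).
by rewrite innerZl innerZr conjCK -mulrDr scalerBr scalerA.
Qed.

Lemma diff_bold v : exists a : R,
  'd bold_u x v = bold_scale x *: coord1 v + (bold_scale x)^-1 *: 'd bold_codir x v
     + a *: bold_w x /\
  'd bold_w x v = bold_scale x *: coord1 v - (bold_scale x)^-1 *: 'd bold_codir x v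
     + a *: bold_u x.
Proof.
have r0 := scale_gt0 x; have rn0 : bold_scale x != 0 by rewrite gt_eqF.
set a := ('d bold_scale x v : R) / bold_scale x.
have aE : 'd bold_scale x v = a * bold_scale x by rewrite divfK.
have sv : 'd bold_s x v = bold_scale x *: coord1 v + a *: bold_s x.
  apply: etrans (diff_rscale v dr dd) _; rewrite aE [in RHS]/bold_s scalerA.
  exact: (congr1 (fun t : rH => bold_scale x *: t + _) (diff_dir v)).
(* Differentiating this product determines the differential of [bold_t] without differentiating the
   inverse of the scale. *)
have cE : bold_codir = (fun p => bold_scale p *: bold_t p).
  by apply/funext => p; rewrite /bold_t scalerA mulfV ?scale1r // gt_eqF.
have cv : 'd bold_codir x v = bold_scale x *: 'd bold_t x v + 'd bold_scale x v *: bold_t x.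
  by rewrite {1}cE; exact: diff_rscale.
have [eu ew] := scaled_sum_diff rn0 sv (etrans cv (congr1 (fun c : R => _ + c *: _) aE)).
exists a; split; first exact: (etrans (diffDE v ds dt) eu).
exact: (etrans (diffBE v ds dt) ew).
Qed.

End BoldDifferential.

Lemma bold_complex_chart : complex_chart M T (@Jbold R H) bold_domain bold_chart.
Proof.
have [cV dV] := bold_is_chart; split; first exact: cV.
move=> x v Vx; have n := bold_nlift x.
have Mp : M (bold_chart x) := chart_projection cV Vx.
have Tv : T (bold_chart x) ('d bold_chart x v) by exact: chart_diff_tangent cV Vx.
have TIv : T (bold_chart x) ('d bold_chart x (mulI v)) by exact: chart_diff_tangent cV Vx.
have TJ := Jbold_tangent_in Mp Tv.
have [a [ub wb]] := diff_bold x v; have [a' [ub' wb']] := diff_bold x (mulI v).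
set l := 'i%C / (2 * inner (bold_u x : H) (bold_u x)) *
  (inner (bold_w x : H) ('d bold_w x v : H) - inner ('d bold_u x v : H) (bold_u x : H)).
(* The coefficient is the difference between the scale variation along i v and the multiplier [l] of
   bold J; tangency of both sides makes it irrelevant that neither is evaluated. *)
apply: (tangent_two_dyads (k := a'%:C - l) n TIv TJ).
have JE : Jbold (bold_chart x) ('d bold_chart x v) = _ :=
  etrans (congr1 (Jbold (bold_chart x)) (dV x v Vx)) (Jbold_nlift _ _ n).
set Z : H := (bold_scale x)%:C *: (coord1 v : H).
set N : H := ((bold_scale x)^-1)%:C *: ('d bold_codir x v : H).
have Z' : bold_scale x *: coord1 (mulI v) = - 'i%C *: Z :> H.
  rewrite realified_scale -[coord1 (mulI v)]/('i%C^* *: (coord1 v : H)).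
  by rewrite conj_imag /Z !scalerA mulrC.
have N' : (bold_scale x)^-1 *: 'd bold_codir x (mulI v) = 'i%C *: N :> H.
  apply: (etrans (congr1 (fun h : rH => (bold_scale x)^-1 *: h) (diff_codir_mulI x v))).
  by rewrite realified_scale /N !scalerA mulrC.
have {}ub' : 'd bold_u x (mulI v) = - 'i%C *: Z + 'i%C *: N + a'%:C *: (bold_w x : H) :> H.
  exact: (etrans ub' (congr2 (fun h k : H => h + k + _) Z' N')).
have {}wb' : 'd bold_w x (mulI v) = - 'i%C *: Z - 'i%C *: N + a'%:C *: (bold_u x : H) :> H.
  exact: (etrans wb' (congr2 (fun h k : H => h - k + _) Z' N')).
rewrite JE -/l; apply: (etrans (dV x (mulI v) Vx)).
apply: (etrans (congr2 (ddyad (bold_u x : H) (bold_w x : H)) ub' wb')).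
apply: (etrans (ddyad_conj_rotate _ _ _ _ a _ l)).
apply: (congr1 (fun h : bounded_op H => h + _)).
by apply: (congr2 (fun h k : H => ddyad (bold_u x : H) (bold_w x : H)
  (- 'i%C *: h + l *: (bold_w x : H)) (- 'i%C *: k + l^* *: (bold_u x : H)))); exact: esym.
Qed.

End BoldChart.

Lemma Jbold_atlas (R : realType) (H : hilbertType R) :
  has_complex_atlas (@projections R H) (@tangent R H) (@Jbold R H).
Proof.
move=> q Mq; have [u [w n]] := projection_nlift Mq; have [qE wu uw] := n.
have u0 := nlift_gt0 n.
(* The unit vector along [u + w] is in general position: <s, u> and <w, s> both equal |u|^2 + 1, so
   <e, q e> and <e, s> are nonzero. *)
set s := u + w; have su : inner s u = inner u u + 1 by rewrite innerDl wu.
have sw : inner w s = inner u u + 1 by rewrite innerDr wu -uw addrC.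
have u1 : inner u u + 1 != 0 by rewrite gt_eqF // ltr_wpDl // ltW.
have s0 : s != 0 by apply: contra_neq u1 => s0; rewrite -su s0 inner0l.
have [c [c0 ee]] := unit_vector s0; set e := c *: s in ee.
have iq : bold_image e q.
  have dq : lift_domain e q.
    rewrite /lift_domain /= nsq_gt0 qE dyadE !innerZr innerZl sw su.
    by rewrite !mulf_neq0 // conjC_eq0.
  have [k [kk sE _]] := bold_chart_coord n dq.
  split; first exact: dq.
  have k0 : k != 0 by apply: contra_eq_neq kk => ->; rewrite mul0r eq_sym oner_eq0.
  have ss0 : inner s s != 0 by rewrite gt_eqF // inner_gt0.
  by rewrite /= nsq_gt0 sE !innerZr -/s innerZl !mulf_neq0 // ?conjC_eq0 // invr_eq0 pnatr_eq0.
have [Vq qK] := bold_coordK ee iq Mq.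
exists (model_space e true false), (@bold_domain R H e), (@bold_chart R H e).
by split; [exact: bold_complex_chart|exists (bold_coord ee q)].
Qed.

Theorem proposition1p0p1 (R : realType) (H : hilbertType R) :
  [/\ (* the complex submanifold of rank-1 projections, identified with the
         cotangent bundle of projective space *)
      [/\ complex_submanifold (@projections R H) (@tangent R H),
          ~ projections (0 : bounded_op H),
          forall q : bounded_op H,
            projections q <-> q * q = q /\ is_line (range q),
          forall q : bounded_op H, projections q ->
            exists! Vc, cotangentP Vc /\ represents q Vc
        & forall Vc : set H * bounded_op H, cotangentP Vc ->
            exists! q : bounded_op H, projections q /\ represents q Vc],
      (* (1) *)
      riemannian (@projections R H) (@tangent R H) (@gform R H) /\
      kahler_potential (@projections R H) (@tangent R H)
        (@hsnorm R H) (@gform R H),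
      (* (2) *)
      [/\ holomorphic_symplectic (@projections R H) (@tangent R H) (@Omega R H),
          forall q A C : bounded_op H,
            projections q -> tangent q A -> tangent q C ->
            (forall B : bounded_op H,
               tangent q B -> hform q C B = Omega q A B) <-> C = Jbold q A,
          integrable_complex (@projections R H) (@tangent R H) (@Jbold R H),
          tensors_anticommute (@projections R H) (@tangent R H)
            (@ambientI R (bounded_op H)) (@Jbold R H)
        & hyperkahler (@projections R H) (@tangent R H)
            (@gform R H) (@ambientI R (bounded_op H)) (@Jbold R H)]
    & (* (3) *)
      [/\ integrable_complex (@projections R H) (@tangent R H) (@Jthird R H),
          tensors_commute (@projections R H) (@tangent R H)
            (@ambientI R (bounded_op H)) (@Jthird R H)
        & forall q A B : bounded_op H,
            projections q -> tangent q A -> tangent q B ->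
            Omega q (Jthird q A) (Jthird q B) = Omega q A B]].
Proof.
split.
- split.
  + exact: complex_submanifold_projections.
  + exact: not_projection0.
  + exact: projectionP.
  + exact: exists_cotangent.
  + exact: exists_projection.
- split; [exact: gform_riemannian|exact: hsnorm_kahler_potential].
- split.
  + exact: Omega_holomorphic_symplectic.
  + exact: Jbold_unique.
  + split; [exact: Jbold_almost_complex|exact: Jbold_atlas].
  + exact: I_Jbold_anticommute.
  + exact: gform_hyperkahler.
- split.
  + split; [exact: Jthird_almost_complex|exact: Jthird_atlas].
  + exact: I_Jthird_commute.
  + exact: Jthird_Omega.
Qed.
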